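(* Let $n\ge 1$ and let $A$ be a finite-dimensional $\Bbbk$-algebra. The following are equivalent: (1) $A$ is a silted algebra of type $A_n$; (2) $A$ is a tilted algebra of type $A_n$, or $A$ is a tilted algebra of type $A_m\times A_{n-m}$ for some integer $m$ with $1\le m\le n-1$.
   Context: $\Bbbk$ is an algebraically closed field. For $r\ge 1$, $A_r=\Bbbk\mathcal{Q}_r$ is the path algebra of the linearly oriented quiver $\mathcal{Q}_r: 1\to 2\to\cdots\to r$ of Dynkin type $\mathbb{A}_r$. Modules are finitely generated right modules. For a finite-dimensional hereditary algebra $H$ (here $H=A_n$ or $H=A_m\times A_{n-m}$), a finite-dimensional algebra $B$ is called tilted of type $H$ if $B\cong\operatorname{End}_H(T)$ for some tilting $H$-module $T$. A complex $P$ in the bounded homotopy category $K^b(\operatorname{proj}H)$ of finitely generated projective $H$-modules is presilting if $\operatorname{Hom}_{K^b(\operatorname{proj}H)}(P,P[i])=0$ for all $i>0$; it is silting if in addition it generates $K^b(\operatorname{proj}H)$ as a triangulated category (i.e. as a thick subcategory); it is 2-term if its only non-zero terms are in degrees $-1$ and $0$. A finite-dimensional algebra $B$ is called silted of type $H$ if $B\cong\operatorname{End}_{K^b(\operatorname{proj}H)}(P)$ for some 2-term silting complex $P$ over $H$. *)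

(* Defs.v *)
From HB Require Import structures.
From mathcomp Require Import all_boot all_order all_algebra all_field.

Set Implicit Arguments.
Unset Strict Implicit.
Unset Printing Implicit Defensive.

Import GRing.Theory.

Local Open Scope ring_scope.

Record quiver := Quiver {
  vertex : finType;
  arrow : finType;
  source : arrow -> vertex;
  target : arrow -> vertex
}.

Fixpoint walk (Q : quiver) (x : vertex Q) (s : seq (arrow Q)) : bool :=
  if s is a :: s' then (source a == x) && walk (target a) s' else true.

Definition walk_end (Q : quiver) (x : vertex Q) (s : seq (arrow Q)) : vertex Q :=
  foldl (fun _ a => target a) x s.

(* Nonempty quivers without oriented cycles: by the pigeonhole principle the
   absence of oriented cycles means that a path has fewer arrows than there
   are vertices. *)
Record acyclic_quiver := AcyclicQuiver {
  aquiver :> quiver;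
  base_vertex : vertex aquiver;
  walk_bounded : forall (x : vertex aquiver) (s : seq (arrow aquiver)),
    walk x s -> (size s < #|vertex aquiver|)%N
}.

Section PathAlgebra.
Variables (k : fieldType) (Q : acyclic_quiver).

Definition is_path (p : vertex Q * #|vertex Q|.-bseq (arrow Q)) : bool :=
  walk p.1 p.2.

(* A path is its starting vertex with its list of consecutive arrows; the
   length bound is no restriction, by walk_bounded. *)
Definition qpath := {p : vertex Q * #|vertex Q|.-bseq (arrow Q) | is_path p}.

Definition path_source (p : qpath) : vertex Q := (val p).1.
Definition path_arrows (p : qpath) : seq (arrow Q) := (val p).2.
Definition path_target (p : qpath) : vertex Q :=
  walk_end (path_source p) (path_arrows p).

(* p is the path "first p1, then p2" *)
Definition is_concat (p1 p2 p : qpath) : bool :=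
  [&& path_source p == path_source p1, path_target p1 == path_source p2
    & path_arrows p == path_arrows p1 ++ path_arrows p2].

(* The vector space with basis the paths of Q; the synonym hides the pointwise
   multiplication of {ffun _ -> _}. *)
Definition path_algebra : Type := {ffun qpath -> k^o}.

HB.instance Definition _ := Vector.copy path_algebra {ffun qpath -> k^o}.

(* Bilinear extension of p1 * p2 = "p1 followed by p2" if p1 ends where p2
   starts, and p1 * p2 = 0 otherwise. *)
Definition path_mul (f g : path_algebra) : path_algebra :=
  [ffun p => \sum_(p1 : qpath) \sum_(p2 : qpath | is_concat p1 p2 p)
               ((f p1 : k) * (g p2 : k))].

Definition path_one : path_algebra :=
  [ffun p => (nilp (path_arrows p))%:R].

Lemma walk_cat (x : vertex Q) (s t : seq (arrow Q)) :
  walk x (s ++ t) = walk x s && walk (walk_end x s) t.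
Proof. by elim: s x => //= a s IHs x; rewrite IHs andbA. Qed.

Lemma walk_end_cat (x : vertex Q) (s t : seq (arrow Q)) :
  walk_end x (s ++ t) = walk_end (walk_end x s) t.
Proof. by rewrite /walk_end foldl_cat. Qed.

Lemma path_walk (p : qpath) : walk (path_source p) (path_arrows p).
Proof. exact: (valP p). Qed.

Lemma qpath_eq (p q : qpath) :
  path_source p = path_source q -> path_arrows p = path_arrows q -> p = q.
Proof.
move=> es ea; apply: val_inj.
rewrite [LHS]surjective_pairing [RHS]surjective_pairing; congr pair => //.
exact: val_inj.
Qed.

Lemma qpath_exists (x : vertex Q) (s : seq (arrow Q)) :
  walk x s -> exists p : qpath, path_source p = x /\ path_arrows p = s.
Proof.
move=> ws; have sz := ltnW (walk_bounded ws).
have wp : is_path (x, Bseq sz) by [].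
by exists (exist (fun p => is_path p) _ wp).
Qed.

Lemma sum_unique (B : pred qpath) (E : bool) (c : k) :
  (forall q, B q -> E) -> (E -> exists q, B q) ->
  (forall q q', B q -> B q' -> q = q') ->
  \sum_(q | B q) c = if E then c else 0.
Proof.
case: E => BE EB uB.
  have [q0 Bq0] := EB isT; rewrite (big_pred1 q0) // => q /=.
  by apply/idP/eqP => [/uB|->] //; apply.
by rewrite big_pred0 // => q; apply/negbTE/negP => /BE.
Qed.

Definition is_concat3 (p1 p2 p3 p : qpath) : bool :=
  [&& path_source p == path_source p1, path_target p1 == path_source p2,
      path_target p2 == path_source p3
    & path_arrows p == path_arrows p1 ++ path_arrows p2 ++ path_arrows p3].

Lemma sum_concatl (p1 p2 p3 p : qpath) (c : k) :
  \sum_(q | is_concat p1 p2 q && is_concat q p3 p) c =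
  if is_concat3 p1 p2 p3 p then c else 0.
Proof.
apply: sum_unique => [q|/and4P[/eqP sp /eqP t1 /eqP t2 /eqP ap]|q q'].
- case/andP=> /and3P[/eqP sq /eqP t1 /eqP aq] /and3P[/eqP sp /eqP tq /eqP ap].
  apply/and4P; split; rewrite ?t1 ?sp ?sq //.
    by rewrite -tq /path_target aq walk_end_cat sq -/(path_target p1) t1.
  by rewrite ap aq catA.
- have := path_walk p; rewrite ap catA walk_cat => /andP[w12 _].
  have [q [sq aq]] := qpath_exists w12.
  exists q; rewrite /is_concat sq aq sp t1 ap catA !eqxx /= andbT.
  by rewrite /path_target sq aq sp walk_end_cat -/(path_target p1) t1 -t2.
- case/andP=> /and3P[/eqP sq _ /eqP aq] _ /andP[/and3P[/eqP sq' _ /eqP aq'] _].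
  by apply: qpath_eq; rewrite ?sq ?sq' ?aq ?aq'.
Qed.

Lemma sum_concatr (p1 p2 p3 p : qpath) (c : k) :
  \sum_(q | is_concat p2 p3 q && is_concat p1 q p) c =
  if is_concat3 p1 p2 p3 p then c else 0.
Proof.
apply: sum_unique => [q|/and4P[/eqP sp /eqP t1 /eqP t2 /eqP ap]|q q'].
- case/andP=> /and3P[/eqP sq /eqP t2 /eqP aq] /and3P[/eqP sp /eqP t1 /eqP ap].
  by apply/and4P; split; rewrite ?sp ?t2 ?t1 ?sq ?ap ?aq.
- have := path_walk p; rewrite ap walk_cat sp -/(path_target p1) t1.
  case/andP=> _ w23; have [q [sq aq]] := qpath_exists w23.
  by exists q; rewrite /is_concat sq aq sp t1 t2 ap !eqxx.
- case/andP=> /and3P[/eqP sq _ /eqP aq] _ /andP[/and3P[/eqP sq' _ /eqP aq'] _].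
  by apply: qpath_eq; rewrite ?sq ?sq' ?aq ?aq'.
Qed.

Lemma path_mulA : associative path_mul.
Proof.
move=> f g h; apply/ffunP => p; rewrite !ffunE.
transitivity (\sum_p1 \sum_p2 \sum_p3
    if is_concat3 p1 p2 p3 p then (f p1 : k) * g p2 * h p3 else 0).
  apply: eq_bigr => p1 _.
  under eq_bigr => q _ do rewrite ffunE mulr_sumr.
  rewrite exchange_big; apply: eq_bigr => p2 _ /=.
  under eq_bigr => q _ do rewrite mulr_sumr.
  rewrite (exchange_big_dep predT) //=; apply: eq_bigr => p3 _.
  rewrite -sum_concatr; apply: eq_big => [q|q _]; first by rewrite andbC.
  by rewrite mulrA.
under [RHS]eq_bigr => q _ do under eq_bigr => p3 _ do rewrite ffunE mulr_suml.
under [RHS]eq_bigr => q _ do rewrite exchange_big.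
rewrite [RHS]exchange_big; apply: eq_bigr => p1 _ /=.
under [RHS]eq_bigr => q _ do under eq_bigr => p3 _ do rewrite mulr_suml.
under [RHS]eq_bigr => q _ do rewrite (exchange_big_dep predT) //=.
rewrite [RHS]exchange_big; apply: eq_bigr => p2 _ /=.
under [RHS]eq_bigr => q _.
  under eq_bigl => p3 do rewrite andbC.
  over.
rewrite [RHS](exchange_big_dep predT) //=; apply: eq_bigr => p3 _.
by rewrite -sum_concatl.
Qed.

Lemma path_mul1l : left_id path_one path_mul.
Proof.
move=> f; apply/ffunP => p; rewrite ffunE.
have [e [se ae]] := @qpath_exists (path_source p) [::] isT.
have te : path_target e = path_source p by rewrite /path_target se ae.
rewrite (bigD1 e) //= [X in _ + X]big1 => [|q neq]; last first.
  apply: big1 => p2 /and3P[/eqP sq _ _]; rewrite ffunE.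
  case: nilP => [aq|]; last by rewrite mul0r.
  by case/eqP: neq; apply: qpath_eq; rewrite ?se ?ae.
rewrite addr0 (big_pred1 p) => [|q /=]; first by rewrite ffunE ae mul1r.
rewrite /is_concat se te ae eqxx /=.
apply/andP/eqP => [[/eqP sq /eqP aq]|->]; last by rewrite !eqxx.
by apply: qpath_eq.
Qed.

Lemma path_mul1r : right_id path_one path_mul.
Proof.
move=> f; apply/ffunP => p; rewrite ffunE.
have [e [se ae]] := @qpath_exists (path_target p) [::] isT.
rewrite (bigD1 p) //= [X in _ + X]big1 => [|q neq]; last first.
  apply: big1 => p2 /and3P[/eqP sq _ /eqP ap]; rewrite [path_one _]ffunE.
  case: nilP => [a2|]; last by rewrite mulr0.
  by case/eqP: neq; apply: qpath_eq; rewrite // ap a2 cats0.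
rewrite addr0 (bigD1 e) /=; last by rewrite /is_concat se ae cats0 !eqxx.
rewrite ffunE ae mulr1 big1 ?addr0 // => q.
case/andP=> /and3P[_ /eqP tq _] neq; rewrite ffunE.
case: nilP => [aq|]; last by rewrite mulr0.
by case/eqP: neq; apply: qpath_eq; rewrite ?se ?ae.
Qed.

Lemma path_mulDl : left_distributive path_mul +%R.
Proof.
move=> f g h; apply/ffunP => p; rewrite !ffunE -big_split; apply: eq_bigr.
move=> p1 _ /=; rewrite -big_split; apply: eq_bigr => p2 _ /=.
by rewrite ffunE mulrDl.
Qed.

Lemma path_mulDr : right_distributive path_mul +%R.
Proof.
move=> f g h; apply/ffunP => p; rewrite !ffunE -big_split; apply: eq_bigr.
move=> p1 _ /=; rewrite -big_split; apply: eq_bigr => p2 _ /=.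
by rewrite ffunE mulrDr.
Qed.

Lemma path_one_neq0 : path_one != 0.
Proof.
have [e [_ ae]] := @qpath_exists (base_vertex Q) [::] isT.
by apply/eqP => /ffunP/(_ e)/eqP; rewrite !ffunE ae oner_eq0.
Qed.

HB.instance Definition _ := GRing.Zmodule_isNzRing.Build path_algebra
  path_mulA path_mul1l path_mul1r path_mulDl path_mulDr path_one_neq0.

Lemma path_scaleAl (c : k) (f g : path_algebra) : c *: (f * g) = (c *: f) * g.
Proof.
apply/ffunP => p; rewrite !ffunE scaler_sumr; apply: eq_bigr => p1 _.
rewrite scaler_sumr; apply: eq_bigr => p2 _; rewrite ffunE.
by rewrite /GRing.scale /= mulrA.
Qed.

HB.instance Definition _ :=
  GRing.Lmodule_isLalgebra.Build k path_algebra path_scaleAl.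

Lemma path_scaleAr (c : k) (f g : path_algebra) : c *: (f * g) = f * (c *: g).
Proof.
apply/ffunP => p; rewrite !ffunE scaler_sumr; apply: eq_bigr => p1 _.
rewrite scaler_sumr; apply: eq_bigr => p2 _; rewrite ffunE.
by rewrite /GRing.scale /= mulrCA.
Qed.

HB.instance Definition _ :=
  GRing.Lalgebra_isAlgebra.Build k path_algebra path_scaleAr.

HB.instance Definition _ := Algebra_isFalgebra.Build k path_algebra.

End PathAlgebra.

(* The quiver 1 -> 2 -> ... -> r with vertices renumbered 0, ..., r - 1, its
   i-th arrow going from i to i + 1.  As 'I_0 is empty, r = 0 gives junk (the
   same quiver as r = 1). *)
Definition linear_quiver (r : nat) : quiver :=
  @Quiver 'I_r.-1.+1 'I_r.-1 (fun i => widen_ord (leqnSn _) i)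
    (fun i => lift ord0 i).

Lemma linear_walk_bounded (r : nat) (x : vertex (linear_quiver r))
    (s : seq (arrow (linear_quiver r))) :
  walk x s -> (size s < #|vertex (linear_quiver r)|)%N.
Proof.
rewrite card_ord ltnS => ws; suff: (x + size s <= r.-1)%N.
  by apply: leq_trans; rewrite leq_addl.
elim: s x ws => [|a s IHs] x /=; first by rewrite addn0 -ltnS ltn_ord.
by case/andP=> /eqP <- /IHs /=; rewrite addSnnS.
Qed.

Definition linear_aquiver (r : nat) : acyclic_quiver :=
  AcyclicQuiver (ord0 : vertex (linear_quiver r)) (@linear_walk_bounded r).

Definition typeA (k : fieldType) (r : nat) : falgType k :=
  path_algebra k (linear_aquiver r).

HB.instance Definition _ (k : fieldType) (H1 H2 : falgType k) :=
  GRing.UnitAlgebra.on (H1 * H2)%type.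

(* Right H-modules are lmodType H^c : (a : H^c) *: m stands for m.a .  The
   notions below are written for left modules over a ring R and used at
   R = H^c. *)

Section Modules.
Variable R : nzRingType.
Implicit Types M N P T : lmodType R.

Definition surj (X Y : Type) (f : X -> Y) : Prop := forall y, exists x, f x = y.

Definition fin_gen M : Prop :=
  exists (n : nat) (f : {linear {ffun 'I_n -> R^o} -> M}), surj f.

Definition projective P : Prop :=
  forall M N (g : {linear M -> N}) (f : {linear P -> N}), surj g ->
    exists h : {linear P -> M}, forall x, g (h x) = f x.

Definition fg_projective P : Prop := fin_gen P /\ projective P.

(* 0 -> M -> N -> P -> 0 *)
Definition short_exact M N P (f : {linear M -> N}) (g : {linear N -> P}) : Prop :=
  [/\ injective f, forall y, g y = 0 <-> exists x, f x = y & surj g].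

Definition proj_dim_le1 M : Prop :=
  exists (P1 P0 : lmodType R) (f : {linear P1 -> P0}) (g : {linear P0 -> M}),
    [/\ projective P1, projective P0 & short_exact f g].

(* Yoneda description of Ext^1(P, M) = 0 *)
Definition ext1_vanishes P M : Prop :=
  forall (E : lmodType R) (f : {linear M -> E}) (g : {linear E -> P}),
    short_exact f g -> exists s : {linear P -> E}, cancel s g.

(* M is isomorphic to a direct summand of some T^n *)
Definition in_add T M : Prop :=
  exists (n : nat) (i : {linear M -> {ffun 'I_n -> T}})
         (p : {linear {ffun 'I_n -> T} -> M}), cancel i p.

Definition tilting T : Prop :=
  [/\ fin_gen T, proj_dim_le1 T, ext1_vanishes T T
    & exists (T0 T1 : lmodType R) (f : {linear R^o -> T0}) (g : {linear T0 -> T1}),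
        [/\ in_add T T0, in_add T T1 & short_exact f g]].

End Modules.

Section Complexes.
Variable R : nzRingType.

Record complex := Complex {
  cobj :> int -> lmodType R;
  diff : forall i, {linear cobj i -> cobj (i + 1)};
  diffK : forall i (x : cobj i), diff (i + 1) (diff i x) = 0
}.

Record chain_map (X Y : complex) := ChainMap {
  cmap :> forall i, {linear X i -> Y i};
  cmap_diff : forall i (x : X i), cmap (i + 1) (diff X i x) = diff Y i (cmap i x)
}.

(* The case of index i + 1 is required for every i : int, so the homotopy
   identity holds in every degree. *)
Definition homotopic (X Y : complex) (f g : chain_map X Y) : Prop :=
  exists h : forall i, {linear X (i + 1) -> Y i},
    forall i (x : X (i + 1)),
      f (i + 1) x - g (i + 1) x = diff Y i (h i x) + h (i + 1) (diff X (i + 1) x).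

Definition czero (X Y : complex) : chain_map X Y.
Proof.
by exists (fun i => (\0 : {linear X i -> Y i})) => i x /=; rewrite raddf0.
Defined.

Definition cid (X : complex) : chain_map X X.
Proof. by exists (fun i => (idfun : {linear X i -> X i})). Defined.

Definition ccomp (X Y Z : complex) (g : chain_map Y Z) (f : chain_map X Y) :
  chain_map X Z.
Proof.
exists (fun i => (g i \o f i : {linear X i -> Z i})) => i x /=.
by rewrite !cmap_diff.
Defined.

Definition cadd (X Y : complex) (f g : chain_map X Y) : chain_map X Y.
Proof.
exists (fun i => (f i \+ g i : {linear X i -> Y i})) => i x /=.
by rewrite !cmap_diff raddfD.
Defined.

(* X[1] *)
Definition shift (X : complex) : complex.
Proof.
exists (fun i => X (i + 1))
       (fun i => (\- diff X (i + 1) : {linear X (i + 1) -> X (i + 1 + 1)})).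
by move=> i x /=; rewrite linearN opprK diffK.
Defined.

Section Cone.
Variables (X Y : complex) (f : chain_map X Y).

Definition cone_obj (i : int) : lmodType R := (X (i + 1)%R * Y i)%type.

Definition cone_diff_fun i (z : cone_obj i) : cone_obj (i + 1) :=
  (- diff X (i + 1) z.1, f (i + 1) z.1 + diff Y i z.2).

Lemma cone_diff_linear i : linear (@cone_diff_fun i).
Proof.
move=> a u v; apply: (congr2 pair) => /=; first by rewrite linearP opprD scalerN.
by rewrite !linearP scalerDr addrACA.
Qed.

HB.instance Definition _ i := GRing.isLinear.Build R (cone_obj i)
  (cone_obj (i + 1)) *:%R (@cone_diff_fun i) (@cone_diff_linear i).

Definition cone_diff i : {linear cone_obj i -> cone_obj (i + 1)} :=
  @cone_diff_fun i.

Lemma cone_diffK i (z : cone_obj i) : cone_diff (i + 1) (cone_diff i z) = 0.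
Proof.
apply: (congr2 pair) => /=; first by rewrite linearN opprK diffK.
by rewrite linearN cmap_diff linearD diffK addr0 addNr.
Qed.

Definition cone : complex := Complex cone_diffK.

End Cone.

Definition zero_module (M : lmodType R) : Prop := forall x : M, x = 0.

(* The objects of K^b(proj R) *)
Definition bounded_proj (X : complex) : Prop :=
  (forall i, fg_projective (X i)) /\
  (exists a b : int, forall i, (i < a) || (b < i) -> zero_module (X i)).

Definition two_term (X : complex) : Prop :=
  forall i : int, i != -1 -> i != 0 -> zero_module (X i).

Definition presilting (P : complex) : Prop :=
  bounded_proj P /\
  forall (i : nat) (f : chain_map P (iter i shift P)),
    (0 < i)%N -> homotopic f (czero _ _).

(* The thick subcategory of K^b(proj R) generated by P: closed under [1],
   [-1], cones and direct summands, and hence under isomorphisms. *)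
Inductive thick (P : complex) : complex -> Prop :=
| thick_gen : thick P P
| thick_shift X : thick P X -> thick P (shift X)
| thick_unshift X : thick P (shift X) -> thick P X
| thick_cone X Y (f : chain_map X Y) : thick P X -> thick P Y -> thick P (cone f)
| thick_summand X Y (i : chain_map X Y) (p : chain_map Y X) :
    bounded_proj X -> homotopic (ccomp p i) (cid X) -> thick P Y -> thick P X.

Definition silting (P : complex) : Prop :=
  presilting P /\ forall X, bounded_proj X -> thick P X.

End Complexes.

(* (E, add, mul, scale, one), taken modulo the relation eqE, is a k-algebra
   isomorphic to A. *)
Definition quotient_isom (k : fieldType) (A : falgType k) (E : Type)
    (eqE : E -> E -> Prop) (add mul : E -> E -> E) (scale : k -> E -> E)
    (one : E) : Prop :=
  exists phi : E -> A,
    [/\ forall f g, eqE f g <-> phi f = phi g,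
        surj phi,
        forall f g, phi (add f g) = phi f + phi g,
        forall c f, phi (scale c f) = c *: phi f
      & (forall f g, phi (mul f g) = phi f * phi g) /\ phi one = 1].

Section EndAlgebras.
Variables (k : fieldType) (H : falgType k).

Section Scale.
Variables (M N : lmodType H^c) (c : k) (f : {linear M -> N}).

Definition hom_scale_fun (x : M) : N := (c%:A : H^c) *: f x.

Lemma hom_scale_linear : linear hom_scale_fun.
Proof.
move=> a u v; rewrite /hom_scale_fun linearP scalerDr !scalerA.
congr (_ *: _ + _); change ((a : H) * c%:A = c%:A * (a : H)).
by rewrite -scalerAl -scalerAr mul1r mulr1.
Qed.

HB.instance Definition _ := GRing.isLinear.Build H^c M N *:%R
  hom_scale_fun hom_scale_linear.

Definition hom_scale : {linear M -> N} := hom_scale_fun.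

End Scale.

Definition cscale (X Y : complex H^c) (c : k) (f : chain_map X Y) :
  chain_map X Y.
Proof.
exists (fun i => hom_scale c (f i)) => i x /=.
by rewrite /hom_scale_fun cmap_diff linearZ.
Defined.

(* A is isomorphic to End_H(T), with (f g)(x) = f (g x) *)
Definition isom_End (A : falgType k) (T : lmodType H^c) : Prop :=
  quotient_isom A (fun f g : {linear T -> T} => f =1 g)
    (fun f g => f \+ g) (fun f g => f \o g) (@hom_scale T T) idfun.

(* A is isomorphic to the endomorphism algebra of P in K^b(proj H) *)
Definition isom_EndK (A : falgType k) (P : complex H^c) : Prop :=
  quotient_isom A (@homotopic _ P P) (@cadd _ P P) (@ccomp _ P P P)
    (@cscale P P) (cid P).

Definition tilted (A : falgType k) : Prop :=
  exists T : lmodType H^c, tilting T /\ isom_End A T.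

Definition silted (A : falgType k) : Prop :=
  exists P : complex H^c, [/\ two_term P, silting P & isom_EndK A P].

End EndAlgebras.

(* Main.v *)
Require Import Defs.
From mathcomp Require Import all_boot all_order all_algebra all_field.
From HB Require Import structures.
From mathcomp Require Import zify ring.
From Stdlib Require Import Classical ClassicalEpsilon.

Set Implicit Arguments.
Unset Strict Implicit.
Unset Printing Implicit Defensive.

Import GRing.Theory.

Local Open Scope ring_scope.

(** The proof passes through a combinatorial object. Take the points
    0, ..., n. A tube is an interval of points i, ..., j - 1, written (i, j)
    with 0 <= i <= j <= n + 1. Choose a point v; the other points form two
    chains, below and above v, whose incidence algebra is of type
    A_v x A_(n - v), hence of type A_n when v = 0 or v = n. Write P_i for the
    projective at the point i, with P_v = P_(n + 1) = 0.

    Take v = 0. A map between finitely generated projectives has a diagonal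
    form ([diagonal_form]), so every two-term complex is a sum of complexes
    P_j -> P_i, that is, of tubes (i, j) other than (0, n + 1), where i = 0
    gives P_j[1] and j = n + 1 gives P_i. It is presilting exactly when no two
    tubes cross, in the sense i < k <= j < l, and it generates exactly when
    any two points are separated by some tube: two points p < q that are not
    separated give a nonzero object, the cone of P_q -> P_p, orthogonal to all
    summands.

    For arbitrary v, the modules of finite type over the algebra of v are
    sums of quotients P_i / P_j, that is, of tubes contained in one of the
    two chains, by the diagonal form of the inclusion of the kernel of a free
    cover. Such a sum is tilting exactly under the same two conditions
    ([tilted_tubing], [tubing_tilted]).

    The two descriptions meet because a noncrossing separating family without
    (0, n + 1) leaves out a point: some v is in no tube, and then every tube
    lies below or above v ([tubing_split]). So two-term silting complexes in
    type A_n are, by their tubes, tilting modules in type A_v x A_(n - v), for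
    a v depending on the complex. The endomorphism algebras agree: in both
    cases there is at most a one-dimensional space of morphisms from the tube
    (i, j) to the tube (k, l), nonzero when k <= i < l <= j, and composition is
    multiplication of scalars as long as the composite may be nonzero
    ([isom_End_tubes], [isom_EndK_tubes]). The values v = 0 and v = n give
    tilted algebras of type A_n, the others those of type A_v x A_(n - v).

    For the converse directions a noncrossing separating family is a binary
    tree: every tube has exactly one point outside its proper subtubes, its
    root, and what remains on each side of the root is a tube or empty
    ([tube_root]). Descending from the largest tube to the point i gives the
    coresolution of P_i by summands of the tilting module
    ([tube_coresolution]); the same recursion shows that cones of the
    complexes P_j -> P_i of the tubes produce every P_i ([tube_generation]). *)

(** * Incidence algebras of two chains *)

(** The points 0, ..., n other than v form two chains, below and above v;
    this is the order of their disjoint union. Its incidence algebra is of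
    type A_v x A_(n - v). Since v is not related to itself, it may stand for
    the index of a zero module; so may n + 1. *)
Definition block_le (n v p q : nat) : bool :=
  [&& p <= q, q <= n & ~~ (p <= v <= q)]%N.

Lemma block_le_trans n v p q w :
  block_le n v p q -> block_le n v q w -> block_le n v p w.
Proof. rewrite /block_le; lia. Qed.

(** An identification of H with the matrices, indexed by the points, that
    are supported on [block_le]. It is given by coordinates, so that path
    algebras of linear quivers and products of two of them can be handled by
    the same formulas. *)
Record incidence (k : fieldType) (H : falgType k) (n v : nat) := Incidence {
  crd : H -> nat -> nat -> k;
  elt : (nat -> nat -> k) -> H;
  crdD : forall a b p q, crd (a + b) p q = crd a p q + crd b p q;
  crdZ : forall c a p q, crd (c *: a) p q = c * crd a p q;
  crdM : forall a b p q,
    crd (a * b) p q = \sum_(w < n.+1) crd a p w * crd b w q;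
  crd1 : forall p q, crd 1 p q = (block_le n v p p && (p == q))%:R;
  crd_out : forall a p q, ~~ block_le n v p q -> crd a p q = 0;
  crd_elt : forall F p q,
    crd (elt F) p q = if block_le n v p q then F p q else 0;
  crd_inj : forall a b, (forall p q, crd a p q = crd b p q) -> a = b
}.

Definition linear_pack (R : nzRingType) (M N : lmodType R) (f : M -> N)
  (fL : linear f) : {linear M -> N} := HB.pack f (GRing.isLinear.Build R M N *:%R f fL).

Section Coordinates.
Variables (k : fieldType) (H : falgType k) (n v : nat) (inc : incidence H n v).
Local Notation rl := (block_le n v).
Local Notation "a ^( p , q )" := (crd inc a p q) (at level 1, left associativity, format "a ^( p ,  q )").

(** The right action x a, which is the left action of the opposite algebra. *)
Definition ract (M : lmodType H^c) (x : M) (a : H) : M := (a : H^c) *: x.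

Lemma ractM (M : lmodType H^c) (x : M) a b : ract (ract x a) b = ract x (a * b).
Proof. by rewrite /ract scalerA. Qed.
Lemma ract1 (M : lmodType H^c) (x : M) : ract x 1 = x.
Proof. exact: scale1r. Qed.
Lemma ractDr (M : lmodType H^c) (x : M) a b : ract x (a + b) = ract x a + ract x b.
Proof. exact: scalerDl. Qed.
Lemma ractDl (M : lmodType H^c) (x y : M) a : ract (x + y) a = ract x a + ract y a.
Proof. exact: scalerDr. Qed.
Lemma ractBl (M : lmodType H^c) (x y : M) a : ract (x - y) a = ract x a - ract y a.
Proof. exact: scalerBr. Qed.
Lemma ract0l (M : lmodType H^c) a : ract (0 : M) a = 0.
Proof. exact: scaler0. Qed.
Lemma ract0r (M : lmodType H^c) (x : M) : ract x 0 = 0.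
Proof. exact: scale0r. Qed.
Lemma ractNl (M : lmodType H^c) (x : M) a : ract (- x) a = - ract x a.
Proof. exact: scalerN. Qed.
Lemma ract_suml (M : lmodType H^c) (I : Type) (r : seq I) (P : pred I) (F : I -> M) a :
  ract (\sum_(i <- r | P i) F i) a = \sum_(i <- r | P i) ract (F i) a.
Proof. exact: scaler_sumr. Qed.
Lemma ract_sumr (M : lmodType H^c) (I : Type) (r : seq I) (P : pred I) (F : I -> H)
  (x : M) :
  ract x (\sum_(i <- r | P i) F i) = \sum_(i <- r | P i) ract x (F i).
Proof. exact: scaler_suml. Qed.
Lemma linear_ract (M N : lmodType H^c) (f : {linear M -> N}) x a :
  f (ract x a) = ract (f x) a.
Proof. exact: linearZ. Qed.

Lemma crd0 p q : (0 : H)^(p, q) = 0.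
Proof. by rewrite -[0](scale0r 0) crdZ mul0r. Qed.

Lemma crdN a p q : (- a)^(p, q) = - a^(p, q).
Proof. by rewrite -scaleN1r crdZ mulN1r. Qed.

Lemma crd_sum (I : Type) (r : seq I) (P : pred I) (F : I -> H) p q :
  (\sum_(i <- r | P i) F i)^(p, q) = \sum_(i <- r | P i) (F i)^(p, q).
Proof. by elim/big_rec2: _ => [|i y1 y2 _ <-]; rewrite ?crd0 ?crdD. Qed.

Lemma block_le_bound p q : rl p q -> (p < n.+1)%N && (q < n.+1)%N.
Proof. rewrite /block_le; lia. Qed.

Lemma block_le_refll p q : rl p q -> rl p p.
Proof. rewrite /block_le; lia. Qed.

Lemma block_le_reflr p q : rl p q -> rl q q.
Proof. rewrite /block_le; lia. Qed.

Lemma sum_point (F : nat -> k) w : (w <= n)%N -> (forall p, p != w -> F p = 0) ->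
  \sum_(p < n.+1) F p = F w.
Proof.
move=> lw F0; rewrite (bigD1 (Ordinal (lw : (w < n.+1)%N))) //= big1 ?addr0 // => i.
by move=> ne; apply: F0; apply: contraNneq ne => e; apply/eqP/val_inj.
Qed.

(** The matrix unit at (p, q); it is zero unless p and q are related. *)
Definition eps p q : H := elt inc (fun a b => ((a == p) && (b == q))%:R).

Lemma crd_eps p q a b : (eps p q)^(a, b) = [&& rl p q, a == p & b == q]%:R.
Proof.
rewrite crd_elt; case: (a =P p) => [->|_]; rewrite ?andbF ?if_same //=.
by case: (b =P q) => [->|_]; rewrite ?andbF ?if_same // andbT; case: (rl p q).
Qed.

Lemma eps_out p q : ~~ rl p q -> eps p q = 0.
Proof.
move=> npq; apply: (crd_inj (i:=inc)) => a b.
by rewrite crd0 crd_eps (negbTE npq).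
Qed.

Lemma epsM p q w : rl p q -> rl q w -> eps p q * eps q w = eps p w.
Proof.
move=> pq qw; apply: (crd_inj (i:=inc)) => a b; rewrite crdM.
have /andP[_ ltq] := block_le_bound pq.
rewrite (@sum_point (fun c => (eps p q)^(a, c) * (eps q w)^(c, b)) q) //.
  rewrite !crd_eps pq qw (block_le_trans pq qw) !eqxx /= andbT.
  by case: (a == p); rewrite ?mul1r ?mul0r.
by move=> c /negbTE ne; rewrite !crd_eps ne !andbF mul0r.
Qed.

Lemma eps_mull p q a b (h : H) :
  (eps p q * h)^(a, b) = if rl p q && (a == p) then h^(q, b) else 0.
Proof.
rewrite crdM; case: ifP => [/andP[pq /eqP->]|ne].
  rewrite (@sum_point (fun c => (eps p q)^(p, c) * h^(c, b)) q).
  - by rewrite crd_eps pq !eqxx mul1r.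
  - by have := block_le_bound pq; lia.
  - by move=> c /negbTE nc; rewrite crd_eps nc !andbF mul0r.
apply: big1 => c _; rewrite crd_eps.
by move: ne; case: (rl p q) => /= [->|_]; rewrite mul0r.
Qed.

Lemma eps_mulr p q a b (h : H) :
  (h * eps p q)^(a, b) = if rl p q && (b == q) then h^(a, p) else 0.
Proof.
rewrite crdM; case: ifP => [/andP[pq /eqP->]|ne].
  rewrite (@sum_point (fun c => h^(a, c) * (eps p q)^(c, q)) p).
  - by rewrite crd_eps pq !eqxx mulr1.
  - by have := block_le_bound pq; lia.
  - by move=> c /negbTE nc; rewrite crd_eps nc !andbF mulr0.
apply: big1 => c _; rewrite crd_eps.
by move: ne; case: (rl p q) => /= [->|_]; rewrite ?andbF mulr0.
Qed.

Lemma eps_cut p q (h : H) : eps p p * h * eps q q = h^(p, q) *: eps p q.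
Proof.
apply: (crd_inj (i:=inc)) => a b; rewrite eps_mulr crdZ crd_eps.
case: (boolP (rl p q)) => pq /=; last first.
  rewrite mulr0; case: ifP => // _; rewrite eps_mull; case: ifP => // _.
  by rewrite crd_out.
rewrite (block_le_reflr pq) /=; case: (b == q); last by rewrite andbF mulr0.
by rewrite eps_mull (block_le_refll pq) andbT; case: eqP; rewrite ?mulr1 ?mulr0.
Qed.

Lemma sum_eps : 1 = \sum_(p < n.+1) eps p p.
Proof.
apply: (crd_inj (i:=inc)) => a b; rewrite crd1 crd_sum.
case: (leqP a n) => [la|la]; last first.
  rewrite big1 => [|i _]; last first.
    by rewrite crd_eps (_ : (a == i) = false) ?andbF //; have := ltn_ord i; lia.
  by have -> : rl a a = false by rewrite /block_le; lia.
rewrite (@sum_point (fun p => (eps p p)^(a, b)) a) // => [|p ne].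
  by rewrite crd_eps eqxx eq_sym.
by rewrite crd_eps eq_sym (negbTE ne) andbF.
Qed.

(** * Modules in coordinates *)

(** An identification of M with the direct sum, over s, of the
    representation that has the field at the points of X s and identities
    between them. As for matrices, coordinates outside the support are zero
    and values prescribed there are ignored. *)
Record coords (M : lmodType H^c) (I : finType) (X : I -> nat -> bool) := Coord {
  co : M -> I -> nat -> k;
  mk : (I -> nat -> k) -> M;
  coD : forall x y s p, co (x + y) s p = co x s p + co y s p;
  coA : forall x h s q, X s q ->
    co (ract x h) s q = \sum_(p < n.+1) co x s p * h^(p, q);
  co_out : forall x s p, ~~ X s p -> co x s p = 0;
  co_mk : forall F s p, co (mk F) s p = if X s p then F s p else 0;
  co_inj : forall x y, (forall s p, X s p -> co x s p = co y s p) -> x = y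
}.

Definition live (X : nat -> bool) := forall p, X p -> rl p p.
Definition convex (X : nat -> bool) :=
  forall p q w, X p -> X w -> rl p q -> rl q w -> X q.

(** Condition for the scalar multiplication from the representation
    supported on X to the one supported on X' (zero at points outside
    either) to be linear: for p below q, with p in X and q in X', the two
    ways from p to q are nonzero when q is in X, respectively when p is in
    X'. *)
Definition admissible (X X' : nat -> bool) :=
  forall p q, rl p q -> X p -> X' q -> X q = X' p.

Section CoordTheory.
Variables (M : lmodType H^c) (I : finType) (X : I -> nat -> bool) (c : coords M X).

Lemma co0 s p : co c 0 s p = 0.
Proof.
have := coD c 0 0 s p; rewrite addr0 => /eqP.
by rewrite addrC -subr_eq subrr eq_sym => /eqP.
Qed.

Lemma coN x s p : co c (- x) s p = - co c x s p.
Proof. by apply/eqP; rewrite -addr_eq0 -coD addNr co0. Qed.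

Lemma coB x y s p : co c (x - y) s p = co c x s p - co c y s p.
Proof. by rewrite coD coN. Qed.

Lemma co_sum (J : Type) (r : seq J) (P : pred J) (F : J -> M) s p :
  co c (\sum_(i <- r | P i) F i) s p = \sum_(i <- r | P i) co c (F i) s p.
Proof. by elim/big_rec2: _ => [|i y1 y2 _ <-]; rewrite ?co0 ?coD. Qed.

Lemma co_scale x (a : k) s p : (forall s, live (X s)) ->
  co c (ract x a%:A) s p = a * co c x s p.
Proof.
move=> lX; case: (boolP (X s p)) => Xp; last by rewrite !co_out ?mulr0.
have rp := lX _ _ Xp; rewrite coA //.
rewrite (@sum_point (fun q => co c x s q * (a%:A)^(q, p)) p).
- by rewrite crdZ crd1 rp eqxx mulr1 mulrC.
- by have := block_le_bound rp; lia.
- by move=> q /negbTE ne; rewrite crdZ crd1 ne andbF !mulr0.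
Qed.

Lemma co_eps x p q s : X s q ->
  co c (ract x (eps p q)) s q = if rl p q then co c x s p else 0.
Proof.
move=> Xq; rewrite coA //; case: ifP => pq; last first.
  by apply: big1 => i _; rewrite crd_eps pq mulr0.
rewrite (@sum_point (fun w => co c x s w * (eps p q)^(w, q)) p).
- by rewrite crd_eps pq !eqxx mulr1.
- by have := block_le_bound pq; lia.
- by move=> w /negbTE ne; rewrite crd_eps ne andbF mulr0.
Qed.

Lemma co_eps_ne x p q s w : w != q -> co c (ract x (eps p q)) s w = 0.
Proof.
move=> /negbTE ne; case: (boolP (X s w)) => Xw; last by rewrite co_out.
by rewrite coA //; apply: big1 => i _; rewrite crd_eps ne !andbF mulr0.
Qed.

(** The basis vector of the summand s at the point p; it is 0 when p is not
    in X s. *)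
Definition gen (s : I) (p : nat) : M :=
  mk c (fun t q => ((t == s) && (q == p))%:R).

Lemma co_gen s p t q :
  co c (gen s p) t q = [&& X s p, t == s & q == p]%:R.
Proof.
rewrite co_mk; case: (t =P s) => [->|]; last by rewrite andbF; case: ifP.
by case: eqP => [->|]; rewrite ?andbF ?andbT /=; case: (X s _).
Qed.

Lemma ract_gen s p q : X s p -> convex (X s) -> live (X s) ->
   ract (gen s p) (eps p q) = if rl p q then gen s q else 0.
Proof.
move=> Xp cX lX; apply: (co_inj (c := c)) => t w Xw.
case: ifP => pq; last by rewrite eps_out ?pq // ract0r co0.
rewrite co_gen; case: (w =P q) Xw => [->|/eqP ne] Xw; last first.
  by rewrite co_eps_ne ?ne ?andbF.
rewrite co_eps // pq co_gen Xp eqxx andbT /=.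
by case: eqP Xw => [->|_ _]; rewrite ?andbF // => ->.
Qed.

End CoordTheory.

Section MatrixMap.
Variables (M M' : lmodType H^c) (I I' : finType).
Variables (X : I -> nat -> bool) (X' : I' -> nat -> bool).
Variables (c : coords M X) (c' : coords M' X').
Variable A : I -> I' -> k.
Hypothesis admA : forall s s', A s s' != 0 -> admissible (X s) (X' s').

Definition matrix_map_fun (x : M) : M' := mk c'
  (fun s' p => \sum_s co c x s p * A s s').

Lemma matrix_map_linear : linear matrix_map_fun.
Proof.
move=> a x y; apply: (co_inj (c := c')) => s' q Xq.
rewrite coD co_mk Xq -/(ract _ a) coA // co_mk Xq.
under eq_bigr do rewrite coD mulrDl.
rewrite big_split /=; congr (_ + _).
under [RHS]eq_bigr => p _ do rewrite co_mk.
transitivity (\sum_s \sum_(p < n.+1) co c x s p * A s s' * crd inc a p q *+ X' s' p).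
  apply: eq_bigr => s _.
  case: (A s s' =P 0) => [->|/eqP nA].
    by rewrite mulr0 big1 // => i _; rewrite mulr0 mul0r mul0rn.
  case: (boolP (X s q)) => Xsq.
    rewrite coA // mulr_suml; apply: eq_bigr => p _.
    case: (boolP (rl p q)) => [pq|/crd_out->]; last by rewrite !mulr0 mul0r mul0rn.
    case: (boolP (X s p)) => Xsp; last by rewrite co_out // !mul0r mul0rn.
    by rewrite -(admA nA pq Xsp Xq) Xsq mulr1n mulrAC.
  rewrite co_out // mul0r big1 // => p _.
  case: (boolP (rl p q)) => [pq|/crd_out->]; last by rewrite !mulr0 mul0rn.
  case: (boolP (X s p)) => Xsp; last by rewrite co_out // !mul0r mul0rn.
  by rewrite -(admA nA pq Xsp Xq) (negbTE Xsq).
rewrite exchange_big /=; apply: eq_bigr => p _.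
case: (X' s' p); last by rewrite mul0r big1.
by rewrite mulr_suml.
Qed.

Lemma matrix_map_subproof : {f : {linear M -> M'} | forall x s' p, co c' (f x) s' p =
  if X' s' p then \sum_s co c x s p * A s s' else 0}.
Proof. by exists (linear_pack matrix_map_linear) => x s' p; rewrite co_mk. Qed.

(** The linear map with matrix A with respect to the summands, kept behind
    its coordinate formula [co_matrix_map]. *)
Definition matrix_map : {linear M -> M'} := sval matrix_map_subproof.

Lemma co_matrix_map x s' p : co c' (matrix_map x) s' p =
  if X' s' p then \sum_s co c x s p * A s s' else 0.
Proof. exact: (svalP matrix_map_subproof). Qed.

End MatrixMap.

Section ProjShape.
Variables (M N : lmodType H^c) (I : finType) (tau : I -> nat).
Variables (c : coords M (fun s => rl (tau s))).
Variable m : I -> N.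
Hypothesis m_tau : forall s, ract (m s) (eps (tau s) (tau s)) = m s.

(** The element of e H, for e the idempotent at tau s, that has the
    coordinates of the component s of x. *)
Definition row_elt (s : I) (x : M) : H :=
  elt inc (fun p q => if p == tau s then co c x s q else 0).

Lemma crd_row s x q : crd inc (row_elt s x) (tau s) q = co c x s q.
Proof. by rewrite crd_elt eqxx; case: ifP => // nr; rewrite co_out ?nr. Qed.

Definition ext_fun (x : M) : N := \sum_s ract (m s) (row_elt s x).

Lemma ext_linear : linear ext_fun.
Proof.
move=> a x y; rewrite /ext_fun scaler_sumr -big_split; apply: eq_bigr => s _ /=.
rewrite -[a *: ract _ _]/(ract (ract _ _) a) ractM -ractDr.
rewrite -[m s]m_tau 2!ractM; congr (ract _ _).
apply: (crd_inj (i := inc)) => p q; rewrite !eps_mull; case: ifP => // /andP[rt _].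
rewrite crdD crdM !crd_row coD; congr (_ + _).
under eq_bigr do rewrite crd_row.
case: (boolP (rl (tau s) q)) => rtq; first by rewrite -coA.
rewrite co_out // big1 // => w _.
case: (boolP (rl (tau s) w)) => rw; last by rewrite co_out ?mul0r.
by rewrite crd_out ?mulr0 //; apply: contra rtq; apply: block_le_trans.
Qed.

(** A summand supported on the points above tau s is e H, for e the
    idempotent at tau s: it is generated by one element, which may be sent
    to any element fixed by e. *)
Definition ext : {linear M -> N} := linear_pack ext_linear.

Lemma ext_gen s : rl (tau s) (tau s) -> ext (gen c s (tau s)) = m s.
Proof.
move=> rs; rewrite [LHS](bigD1 s) //= [X in _ + X]big1 ?addr0 => [|t ne].
  rewrite -[RHS]m_tau; congr (ract _ _).
  apply: (crd_inj (i := inc)) => p q; rewrite crd_elt crd_eps rs co_gen rs eqxx /=.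
  case: (p =P tau s) => [->|_]; last by rewrite andFb if_same.
  by case: eqP => [->|_]; rewrite ?rs ?if_same.
rewrite (_ : row_elt t _ = 0) ?ract0r //; apply: (crd_inj (i := inc)) => p q.
by rewrite crd_elt co_gen (negbTE ne) andbF crd0 !if_same.
Qed.

End ProjShape.

Lemma gen_expand (M : lmodType H^c) (I : finType) (X : I -> nat -> bool)
  (c : coords M X)
   (lX : forall s, live (X s)) (x : M) :
  x = \sum_s \sum_(p < n.+1) ract (gen c s p) (co c x s p)%:A.
Proof.
apply: (co_inj (c := c)) => s p Xp; have rp := lX _ _ Xp.
rewrite co_sum (bigD1 s) //= [X in _ + X]big1 ?addr0 => [|t ne]; last first.
  by rewrite co_sum big1 // => q _; rewrite co_scale // co_gen eq_sym (negbTE ne)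
    andbF mulr0.
rewrite co_sum (@sum_point (fun q => co c (ract (gen c s q) (co c x s q)%:A) s p) p).
- by rewrite co_scale // co_gen Xp !eqxx mulr1.
- by have := block_le_bound rp; lia.
- by move=> q ne; rewrite co_scale // co_gen [p == q]eq_sym (negbTE ne) !andbF mulr0.
Qed.

(** When every summand has a least point tau s, the basis vector at p is the
    one at tau s times a matrix unit. *)
Lemma eq_on_gen (M N : lmodType H^c) (I : finType) (tau : I -> nat)
  (X : I -> nat -> bool)
  (c : coords M X) (cX : forall s, convex (X s)) (lX : forall s, live (X s))
  (tauX : forall s p, X s p -> X s (tau s) /\ rl (tau s) p)
  (f g : {linear M -> N}) :
  (forall s, X s (tau s) -> f (gen c s (tau s)) = g (gen c s (tau s))) -> f =1 g.
Proof.
move=> fg x; rewrite (gen_expand c lX x) !raddf_sum; apply: eq_bigr => s _.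
rewrite !raddf_sum; apply: eq_bigr => p _ /=; rewrite !linear_ract; congr (ract _ _).
case: (boolP (X s p)) => Xp; last first.
  rewrite (_ : gen c s p = 0) ?raddf0 //; apply: (co_inj (c := c)) => t q _.
  by rewrite co_gen (negbTE Xp) co0.
have [Xt rt] := tauX _ _ Xp.
have -> : gen c s p = ract (gen c s (tau s)) (eps (tau s) p) by rewrite ract_gen ?rt.
by rewrite !linear_ract fg.
Qed.

End Coordinates.

(** * Modules of functions *)

(** The families of supports for which the coordinate formulas define a
    module. *)
Record shape (n v : nat) (I : finType) := Shape {
  supp :> I -> nat -> bool;
  supp_live : forall s, live n v (supp s);
  supp_convex : forall s, convex n v (supp s)
}.

Section FunctionModule.
Variables (k : fieldType) (H : falgType k) (n v : nat) (inc : incidence H n v).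
Variables (I : finType) (S : shape n v I).
Local Notation rl := (block_le n v).

Definition fmod_basis := {sp : I * 'I_n.+1 | S sp.1 sp.2}.

(** The identification of H with matrices is kept in the type as a phantom
    parameter, because the module structure depends on it. *)
Definition fmod_of & incidence H n v : Type := {ffun fmod_basis -> k^o}.
Local Notation fmod := (fmod_of inc).

HB.instance Definition _ := GRing.Zmodule.copy fmod {ffun fmod_basis -> k^o}.

(** A sum with at most one term: it reads a function on a subtype at a pair
    that need not belong to it. *)
Definition fco (x : fmod) (s : I) (p : nat) : k :=
  \sum_(u : fmod_basis | ((val u).1 == s) && (val (val u).2 == p)) x u.

Definition fmk (F : I -> nat -> k) : fmod := [ffun u => F (val u).1 (val (val u).2)].

Lemma fcoE (x : fmod) (u : fmod_basis) : fco x (val u).1 (val (val u).2) = x u.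
Proof.
rewrite /fco (big_pred1 u) // => w /=; rewrite -[RHS]val_eqE.
Qed.

Lemma fco_out (x : fmod) s p : ~~ S s p -> fco x s p = 0.
Proof.
move=> nS; rewrite /fco big_pred0 // => u; apply/negP => /andP[/eqP e1 /eqP e2].
by have := valP u; rewrite /= e1; move: e2 => /= ->; rewrite (negbTE nS).
Qed.

Lemma fco_at s p : S s p -> exists u : fmod_basis, (val u).1 = s /\ val (val u).2 = p.
Proof.
move=> Sp; have := block_le_bound (supp_live Sp) => /andP[lp _].
have Sp' : S (s, Ordinal lp).1 (s, Ordinal lp).2 by [].
by exists (exist (fun sp : I * 'I_n.+1 => S sp.1 sp.2) _ Sp').
Qed.

Lemma fco_mk F s p : fco (fmk F) s p = if S s p then F s p else 0.
Proof.
case: ifP => [/fco_at[u [<- <-]]|nS]; last by rewrite fco_out ?nS.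
by rewrite fcoE ffunE.
Qed.

Lemma fco_inj x y : (forall s p, S s p -> fco x s p = fco y s p) -> x = y.
Proof. by move=> xy; apply/ffunP => u; rewrite -!fcoE; apply: xy; exact: (valP u). Qed.

Lemma fcoD x y s p : fco (x + y) s p = fco x s p + fco y s p.
Proof. by rewrite /fco -big_split; apply: eq_bigr => u _; rewrite ffunE. Qed.

Definition fscale (a : H^c) (x : fmod) : fmod :=
  fmk (fun s q => \sum_(p < n.+1) fco x s p * crd inc a p q).

Lemma fscaleA (a b : H^c) (x : fmod) : fscale a (fscale b x) = fscale (a * b) x.
Proof.
apply: fco_inj => s q Sq; rewrite !fco_mk Sq.
under [RHS]eq_bigr => p _ do rewrite (crdM inc (b : H) (a : H)) mulr_sumr.
rewrite exchange_big; apply: eq_bigr => w _ /=; rewrite fco_mk.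
case: (boolP (S s w)) => Sw.
  by rewrite mulr_suml; apply: eq_bigr => p _; rewrite mulrA.
rewrite mul0r big1 // => p _.
case: (boolP (S s p)) => Sp; last by rewrite fco_out ?mul0r.
case: (boolP (rl p w)) => pw; last by rewrite (crd_out inc b pw) mul0r mulr0.
case: (boolP (rl w q)) => wq; last by rewrite (crd_out inc a wq) !mulr0.
by rewrite (supp_convex Sp Sq pw wq) in Sw.
Qed.

Lemma fscale1 (x : fmod) : fscale 1 x = x.
Proof.
apply: fco_inj => s q Sq; rewrite fco_mk Sq.
have rq := supp_live Sq.
rewrite (@sum_point _ n (fun p => fco x s p * crd inc (1 : H) p q) q).
- by rewrite crd1 rq eqxx mulr1.
- by have := block_le_bound rq; lia.
- by move=> p /negbTE ne; rewrite crd1 ne andbF mulr0.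
Qed.

Lemma fscaleDr (a : H^c) (x y : fmod) : fscale a (x + y) = fscale a x + fscale a y.
Proof.
apply: fco_inj => s q Sq; rewrite fcoD !fco_mk Sq -big_split; apply: eq_bigr => p _ /=.
by rewrite fcoD mulrDl.
Qed.

Lemma fscaleDl (x : fmod) (a b : H^c) : fscale (a + b) x = fscale a x + fscale b x.
Proof.
apply: fco_inj => s q Sq; rewrite fcoD !fco_mk Sq -big_split; apply: eq_bigr => p _ /=.
by rewrite (crdD inc (a : H) (b : H)) mulrDr.
Qed.

HB.instance Definition _ := GRing.Zmodule_isLmodule.Build H^c fmod
  fscaleA fscale1 fscaleDr fscaleDl.

Lemma fco_act (x : fmod) (h : H) s q : S s q ->
  fco (ract x h) s q = \sum_(p < n.+1) fco x s p * crd inc h p q.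
Proof. by move=> Sq; rewrite fco_mk Sq. Qed.

Lemma fmod_coord : coords inc (fmod : lmodType H^c) S.
Proof. exact: (Coord fcoD fco_act fco_out fco_mk fco_inj). Qed.

End FunctionModule.

(** A tube (i, j) stands for the module P_i / P_j, or for the two-term
    complex P_j -> P_i. *)
Definition tube (ij : nat * nat) (p : nat) := (ij.1 <= p < ij.2)%N.

Section Shapes.
Variables (n v : nat).

Lemma proj_live i : live n v (block_le n v i).
Proof. by move=> p; apply: block_le_reflr. Qed.

Lemma proj_convex i : convex n v (block_le n v i).
Proof. by move=> p q w pp _ pq _; apply: block_le_trans pp pq. Qed.

Definition proj_shape (I : finType) (tau : I -> nat) : shape n v I :=
  Shape (fun s => @proj_live (tau s)) (fun s => @proj_convex (tau s)).

(** The support of the cokernel of a map P_j -> P_i. It is the tube (i, j)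
    if i and j bound an interval of one block, see [segE]. *)
Definition segment (ij : nat * nat) (p : nat) : bool :=
  block_le n v ij.1 p && (p < ij.2)%N.

Lemma segment_live ij : live n v (segment ij).
Proof. by move=> p /andP[/block_le_reflr]. Qed.

Lemma segment_convex ij : convex n v (segment ij).
Proof.
move=> p q w /andP[pp _] /andP[_ lw] pq qw.
rewrite /segment (block_le_trans pp pq) /=.
by move: qw; rewrite /block_le; lia.
Qed.

Definition seg_shape (I : finType) (ij : I -> nat * nat) : shape n v I :=
  Shape (fun s => @segment_live (ij s)) (fun s => @segment_convex (ij s)).

End Shapes.

Section RegularModule.
Variables (k : fieldType) (H : falgType k) (n v : nat) (inc : incidence H n v).
Local Notation rl := (block_le n v).

Definition free_co m (x : {ffun 'I_m -> (H^c)^o}) (s : 'I_m * 'I_n.+1) (q : nat) : k :=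
  crd inc (x s.1 : H) (val s.2) q.
Definition free_mk m (F : 'I_m * 'I_n.+1 -> nat -> k) : {ffun 'I_m -> (H^c)^o} :=
  [ffun i => elt inc (fun p q => F (i, inord p) q) : (H^c)^o].

(** The regular module is the sum of the projectives of all points,
    including the zero projective of v. *)
Definition free_coord (m : nat) :
  coords inc ({ffun 'I_m -> (H^c)^o} : lmodType H^c)
    (fun s : 'I_m * 'I_n.+1 => rl (val s.2)).
Proof.
exists (@free_co m) (@free_mk m); rewrite /free_co.
- by move=> x y s p; rewrite ffunE crdD.
- move=> x h s q rq; rewrite ffunE.
  by rewrite (_ : (h : H^c) *: (x s.1) = ((x s.1 : H) * h : H)) // crdM.
- by move=> x s p; apply: crd_out.
- by move=> F [i s] p /=; rewrite ffunE crd_elt inord_val.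
- move=> x y xy; apply/ffunP => i; apply: (crd_inj (i := inc)) => p q.
  case: (boolP (rl p q)) => pq; last by rewrite !crd_out.
  have /andP[lp _] := block_le_bound pq.
  exact: (xy (i, Ordinal lp) q).
Qed.

(** In the sum of the representations supported on the points above tau s,
    all maps between nonzero spaces from p to a larger q are identities. *)
Lemma free_tf (m : nat) (x : {ffun 'I_m -> (H^c)^o}) p q :
  rl p q -> ract x (eps inc p q) = 0 -> ract x (eps inc p p) = 0.
Proof.
move=> pq x0; apply: (co_inj (c := free_coord m)) => s w rw;
  rewrite (co0 (free_coord m)).
case: (w =P p) rw => [->|/eqP ne] rw; last by rewrite co_eps_ne.
rewrite co_eps // (block_le_refll pq).
have rq := block_le_trans rw pq.
by have := co_eps (free_coord m) x p (s := s) rq; rewrite pq x0 co0 => <-.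
Qed.
End RegularModule.

(** * Torsion-free modules *)

Section Families.
Variables (k : fieldType) (H : falgType k) (n v : nat) (inc : incidence H n v).
Local Notation rl := (block_le n v).
Local Notation crd := (crd inc).
Local Notation eps := (eps inc).

(** The maps from M e_p to M e_q are injective. For finitely generated
    modules over these algebras this is the same as being projective, but it
    passes to submodules at once. *)
Definition torsion_free (M : lmodType H^c) :=
  forall p q (x : M), rl p q -> ract x (eps p q) = 0 -> ract x (eps p p) = 0.

(** Generators of the submodule K that are homogeneous: m s is fixed by the
    idempotent at tau s. *)
Definition gen_family (M : lmodType H^c) (K : M -> Prop) (I : finType)
    (tau : I -> nat) (m : I -> M) : Prop :=
  [/\ forall s, ract (m s) (eps (tau s) (tau s)) = m s,
      forall s, K (m s)
    & forall x, K x -> exists h : I -> H, x = \sum_s ract (m s) (h s)].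

(** The coefficient h s acts on m s through its row tau s only. *)
Definition free_family (M : lmodType H^c) (I : finType)
    (tau : I -> nat) (m : I -> M) : Prop :=
  forall h : I -> H, \sum_s ract (m s) (h s) = 0 ->
    forall s q, crd (h s) (tau s) q = 0.

Lemma block_v p : ~~ rl v p.
Proof. by rewrite /block_le; lia. Qed.

Lemma block_le_linkl p p' q : rl p q -> rl p' q -> (p <= p')%N -> rl p p'.
Proof. by rewrite /block_le; lia. Qed.

(** In a relation between the generators, cut at a point q0, the generators
    with nonzero coefficients sit at points of one block below q0. As M is
    torsion free, the relation already holds at the largest of these points,
    and there the coefficient of the corresponding generator is a unit, so
    that this generator is a combination of the others. It is replaced by 0,
    placed at the dead point v, and the number of generators at other points
    drops. *)
Lemma minimal_family (M : lmodType H^c) (K : M -> Prop) (I : finType)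
    (tau : I -> nat) (m : I -> M) :
  torsion_free M -> K 0 -> gen_family K tau m ->
  exists tau' m', gen_family K tau' m' /\ free_family (I := I) tau' m'.
Proof.
move=> tfM K0; have [N] := ubnP #|[pred s | tau s != v]|.
elim: N => // N IHN in tau m *; rewrite ltnS => cN [m_tau m_K m_gen].
have [fr|nfr] := classic (free_family tau m).
  by exists tau, m.
have [h hnz] := not_all_ex_not _ _ nfr.
have [h0 nz] := imply_to_and _ _ hnz.
have [s0 /not_all_ex_not[q0 /eqP nz0]] := not_all_ex_not _ _ nz.
(* c s is the coefficient at q0 of the s-th term of the relation. *)
pose c s := crd (h s) (tau s) q0.
case: (@arg_maxnP _ s0 (fun s => c s != 0) tau) => // s1 c1 max1.
have rc s : c s != 0 -> rl (tau s) q0 by apply: contraNT => /crd_out; rewrite /c => ->.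
have r1 s : c s != 0 -> rl (tau s) (tau s1).
  by move=> cs; apply: (block_le_linkl (rc _ cs) (rc _ c1)); apply: max1.
have rr1 := r1 _ c1.
pose y := \sum_s ract (m s) (c s *: eps (tau s) (tau s1)).
have y0 : y = 0.
  have yy : ract y (eps (tau s1) (tau s1)) = y.
    rewrite ract_suml; apply: eq_bigr => s _; rewrite ractM -scalerAl.
    case: (c s =P 0) => [->|/eqP/r1 cs]; first by rewrite !scale0r.
    by rewrite epsM.
  rewrite -yy; apply: (tfM _ q0); first exact: rc.
  rewrite ract_suml.
  transitivity (ract (\sum_s ract (m s) (h s)) (eps q0 q0)); last by rewrite h0 ract0l.
  rewrite ract_suml; apply: eq_bigr => s _; rewrite -[in RHS](m_tau s) !ractM mulrA
    eps_cut -/(c s).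
  case: (c s =P 0) => [->|/eqP cs]; first by rewrite !scale0r mul0r.
  by rewrite -scalerAl epsM ?r1 ?rc.
(* The relation y = 0 solved for m s1. *)
pose g s := (- (c s1)^-1 * c s) *: eps (tau s) (tau s1).
have m1 : m s1 = \sum_(s | s != s1) ract (m s) (g s).
  have : ract y (- (c s1)^-1)%:A = 0 by rewrite y0 ract0l.
  rewrite ract_suml (bigD1 s1) //= ractM -scalerAr mulr1 scalerA mulNr mulVf //.
  rewrite scaleN1r /ract scaleNr -/(ract _ _) m_tau addrC => /eqP.
  rewrite subr_eq0 eq_sym => /eqP ->; apply: eq_bigr => s _.
  by rewrite -!/(ract _ _) ractM -scalerAr mulr1 scalerA.
apply: (IHN (fun s => if s == s1 then v else tau s)
  (fun s => if s == s1 then 0 else m s)).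
  apply: leq_trans cN; apply: proper_card; apply/properP; split.
    by apply/subsetP => s; rewrite !inE; case: (s =P s1) => // _; rewrite eqxx.
  exists s1; rewrite !inE ?eqxx //.
  by apply: contraTneq rr1 => ->; apply: block_v.
split=> [s|s|x /m_gen[h' ->]]; [by case: eqP; rewrite ?ract0l|by case: eqP|].
exists (fun s => h' s + g s * h' s1).
rewrite [LHS](bigD1 s1) //= [RHS](bigD1 s1) //= eqxx ract0l add0r m1 ract_suml
  -big_split.
apply: eq_bigr => s /negbTE ->; rewrite ractM.
by rewrite ractDr addrC.
Qed.

(** Freeness makes the rows of the coefficients of an element unique, so
    that they are coordinates. *)
Lemma family_coords (M : lmodType H^c) (I : finType) (tau : I -> nat) (m : I -> M) :
  gen_family (fun _ => True) tau m -> free_family tau m ->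
  exists c : coords inc M (fun s => rl (tau s)), True.
Proof.
case=> m_tau _ m_gen fr.
have gen x : {h : I -> H | x = \sum_s ract (m s) (h s)}.
  by apply: constructive_indefinite_description; apply: m_gen.
pose co x s p := crd (sval (gen x) s) (tau s) p.
have uniq x h : x = \sum_s ract (m s) (h s) -> forall s q,
  co x s q = crd (h s) (tau s) q.
  move=> xh s q; rewrite /co; case: (gen x) => h' xh' /=.
  have /fr/(_ s q) : \sum_s ract (m s) (h' s - h s) = 0.
    transitivity (x - x); last exact: subrr.
    rewrite {1}xh' xh -sumrB; apply: eq_bigr => t _.
    by rewrite ractDr; congr (_ + _); rewrite /ract scaleNr.
  by rewrite crdD crdN => /eqP; rewrite subr_eq0 => /eqP.
have expand x : x = \sum_s ract (m s) (elt inc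
  (fun p q => if p == tau s then co x s q else 0)).
  case: (gen x) (uniq x) => h xh /(_ h xh) cox.
  rewrite {1}xh; apply: eq_bigr => s _; rewrite -(m_tau s) !ractM; congr (ract _ _).
  apply: (crd_inj (i := inc)) => p q; rewrite !eps_mull; case: ifP => // _.
  by rewrite crd_elt eqxx cox; case: ifP => // /negbT /crd_out.
unshelve eexists.
  exists co (fun F => \sum_s ract (m s) (elt inc
    (fun p q => if p == tau s then F s q else 0))).
- move=> x y s p; rewrite (uniq _ (fun s => sval (gen x) s + sval (gen y) s)) ?crdD //.
  case: (gen x) (gen y) => h xh [h' yh] /=; rewrite xh yh -big_split.
  by apply: eq_bigr => t _; rewrite ractDr.
- move=> x h s q _; rewrite (uniq _ (fun s => sval (gen x) s * h)) ?crdM //.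
  case: (gen x) => h' xh /=; rewrite xh ract_suml.
  by apply: eq_bigr => t _; rewrite ractM.
- by move=> x s p; apply: crd_out.
- move=> F s p; rewrite (uniq _ _ erefl) crd_elt eqxx.
  by [].
- move=> x y xy; rewrite (expand x) (expand y); apply: eq_bigr => s _; congr (ract _ _).
  apply: (crd_inj (i := inc)) => p q; rewrite !crd_elt; case: ifP => // rpq.
  by case: eqP => // e; apply: xy; rewrite -e.
by [].
Qed.

(** For an arbitrary set of row vectors: as long as some member is outside
    the span of the rows found so far, adding it increases the rank. *)
Lemma spanning_rows d (K : 'rV[k]_d -> Prop) :
  exists m (B : 'M[k]_(m, d)), (forall i, K (row i B)) /\ forall r, K r -> (r <= B)%MS.
Proof.
suff gen e m (B : 'M[k]_(m, d)) : (forall i, K (row i B)) -> (d - \rank B <= e)%N ->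
    exists m (B : 'M[k]_(m, d)), (forall i, K (row i B)) /\ forall r, K r ->
      (r <= B)%MS.
  by apply: (gen d 0%N 0) => [[]|]; rewrite ?leq_subr.
elim: e m B => [|e IHe] m B KB re.
  exists m, B; split=> // r _; apply: submx_full;
    rewrite /row_full eqn_leq rank_leq_col.
  by rewrite -subn_eq0; move: re; rewrite leqn0.
have [sB|nB] := classic (forall r, K r -> (r <= B)%MS).
  by exists m, B.
have [r rB] := not_all_ex_not _ _ nB.
have [Kr /negP nr] := imply_to_and _ _ rB.
apply: (IHe _ (col_mx r B)) => [i|].
  by case: (split_ordP i) => j ->; rewrite ?rowKu ?rowKd // (ord1 j) row_id.
suff : (\rank B < \rank (col_mx r B))%N by lia.
rewrite -addsmxE; apply: rank_ltmx; rewrite ltmxE addsmxSr /=.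
by apply: contra nr; apply: submx_trans; rewrite addsmxSl.
Qed.

(** A submodule is a subspace of a finite-dimensional space, hence spanned
    by finitely many of its elements; multiplying them by the idempotents
    makes them homogeneous. *)
Lemma subspace_family (M : lmodType H^c) (I : finType) (X : I -> nat -> bool)
    (c : coords inc M X) (lX : forall s, live n v (X s)) (K : M -> Prop) :
  (forall x h, K x -> K (ract x h)) ->
  exists (J : finType) (tau : J -> nat) (m : J -> M), gen_family K tau m.
Proof.
move=> Kh.
pose V x := \row_(j < #|{: I * 'I_n.+1}|) co c x (enum_val j).1 (enum_val j).2.
have V_inj x y : V x = V y -> x = y.
  move=> /rowP Vxy; apply: (co_inj (c := c)) => s p /lX/block_le_bound/andP[lp _].
  by have := Vxy (enum_rank (s, Ordinal lp)); rewrite !mxE enum_rankK.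
have [m [B [KB sB]]] := spanning_rows (fun r => exists x, K x /\ V x = r).
have ch i : {x | K x /\ V x = row i B} by apply: constructive_indefinite_description.
pose b i := sval (ch i); have [Kb Vb] : (forall i, K (b i)) /\ forall i,
  V (b i) = row i B.
  by split=> i; case: (svalP (ch i)).
exists ('I_m * 'I_n.+1)%type, (fun ip : 'I_m * 'I_n.+1 => val ip.2),
  (fun ip : 'I_m * 'I_n.+1 => ract (b ip.1) (eps (val ip.2) (val ip.2))).
split=> [[i p]|[i p]|x Kx] /=.
- rewrite ractM; case: (boolP (rl p p)) => rp; first by rewrite epsM.
  by rewrite !eps_out ?mul0r.
- exact: Kh.
have /submxP[a Va] := sB _ (ex_intro _ x (conj Kx erefl)).
exists (fun ip => (a 0 ip.1)%:A).
rewrite -(pair_bigA _ (fun (i : 'I_m) (p : 'I_n.+1) =>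
  ract (ract (b i) (eps p p)) (a 0 i)%:A)) /=.
transitivity (\sum_i ract (b i) (a 0 i)%:A).
  apply: V_inj; rewrite Va mulmx_sum_row; apply/rowP => j; rewrite mxE summxE co_sum.
  by apply: eq_bigr => i _; rewrite mxE -Vb mxE co_scale.
apply: eq_bigr => i _; rewrite -{1}[b i]ract1 (sum_eps inc) ract_sumr ract_suml.
by [].
Qed.

End Families.

(** * Diagonal form of maps between projectives *)

Section NormalForm.
Variables (k : fieldType) (H : falgType k) (n v : nat) (inc : incidence H n v).
Local Notation rl := (block_le n v).

Lemma block_le_linkr p q q' : rl p q -> rl p q' -> (q <= q')%N -> rl q q'.
Proof. by rewrite /block_le; lia. Qed.

Lemma sum_delta (I : finType) (F : I -> k) s : \sum_r F r * (r == s)%:R = F s.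
Proof.
rewrite (bigD1 s) //= eqxx mulr1 big1 ?addr0 // => r /negbTE ->.
by rewrite mulr0.
Qed.

Section ChangeOfBasis.
Variables (M : lmodType H^c) (I : finType) (tau : I -> nat).
Variable c : coords inc M (fun s => rl (tau s)).

Lemma proj_coA x h s q :
  co c (ract x h) s q = \sum_(p < n.+1) co c x s p * crd inc h p q.
Proof.
case: (boolP (rl (tau s) q)) => rq; first exact: coA.
rewrite co_out // big1 // => p _.
case: (boolP (rl (tau s) p)) => rp; last by rewrite co_out ?mul0r.
by rewrite crd_out ?mulr0 //; apply: contra rq; apply: block_le_trans.
Qed.

(** Change of basis in a sum of projectives by mutually inverse matrices. An
    entry (r, s) is a map between the projectives at tau r and tau s, hence
    the conditions on U and V; the case r = s is apart because dead points
    are not related to themselves. *)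
Lemma coords_change (U V : I -> I -> k) :
    (forall s t, \sum_r U s r * V r t = (s == t)%:R) ->
    (forall s t, \sum_r V s r * U r t = (s == t)%:R) ->
    (forall r s, U r s != 0 -> r = s \/ rl (tau s) (tau r)) ->
    (forall r s, V r s != 0 -> r = s \/ rl (tau s) (tau r)) ->
  exists c' : coords inc M (fun s => rl (tau s)),
    (forall x s p, co c' x s p = \sum_r co c x r p * U r s) /\
    (forall x s p, co c x s p = \sum_r co c' x r p * V r s).
Proof.
move=> UV VU rU rV.
pose f (x : M) s p := \sum_r co c x r p * U r s.
have fK x s p : co c x s p = \sum_r f x r p * V r s.
  under eq_bigr do rewrite mulr_suml.
  rewrite exchange_big /=.
  under eq_bigr => r _ do under eq_bigr do rewrite -mulrA.
  by under eq_bigr => r _ do rewrite -mulr_sumr UV; rewrite sum_delta.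
have f0 x s p : ~~ rl (tau s) p -> f x s p = 0.
  move=> nr; apply: big1 => r _; case: (U r s =P 0) => [->|/eqP/rU rs];
    first by rewrite mulr0.
  rewrite co_out ?mul0r //; apply: contra nr => rp.
  by case: rs => [<- //|rs]; apply: block_le_trans rs rp.
unshelve eexists.
  exists f (fun F => mk c (fun s p => \sum_r (if rl (tau r) p then F r p else 0) * V r
    s)).
- by move=> x y s p; rewrite -big_split; apply: eq_bigr => r _; rewrite coD mulrDl.
- move=> x h s q _; rewrite /f; under eq_bigr do rewrite proj_coA mulr_suml.
  rewrite exchange_big; apply: eq_bigr => p _ /=; rewrite mulr_suml.
  by apply: eq_bigr => r _; rewrite mulrAC.
- exact: f0.
- move=> F s p; rewrite /f.
  transitivity (\sum_r \sum_r' (if rl (tau r') p then F r' p else 0) *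
    (V r' r * U r s)).
    apply: eq_bigr => r _; rewrite co_mk.
    under [RHS]eq_bigr do rewrite mulrA; rewrite -mulr_suml; congr (_ * _).
    case: ifP => // nr; rewrite big1 // => r' _.
    case: (V r' r =P 0) => [->|/eqP/rV rs]; first by rewrite mulr0.
    case: ifP => rp; last by rewrite mul0r.
    by case: rs => [e|rs]; [rewrite -e rp in nr|rewrite (block_le_trans rs rp) in nr].
  rewrite exchange_big /=.
  by under eq_bigr => r _ do rewrite -mulr_sumr VU; rewrite sum_delta.
- move=> x y xy; apply: (co_inj (c := c)) => s p _; rewrite !fK; apply: eq_bigr => r _.
  by case: (boolP (rl (tau r) p)) => rp; [rewrite xy|rewrite !f0].
by split.
Qed.

(** The basis element of index t is replaced by the sum of the a s b_s; this
    is admissible when tau t is the largest of the points involved. *)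
Lemma coords_pivot (a : I -> k) (t : I) : a t != 0 ->
    (forall s, a s != 0 -> rl (tau s) (tau t)) ->
  exists c' : coords inc M (fun s => rl (tau s)), forall x s p, co c' x s p =
    if s == t then co c x t p / a t else co c x s p - co c x t p / a t * a s.
Proof.
move=> at0 ra.
pose U r s : k := if r == t then (if s == t then (a t)^-1 else - (a s / a t)) else
  (r == s)%:R.
pose V r s : k := if r == t then a s else (r == s)%:R.
have sum0 (F : I -> k) w : \sum_(r | r != t) F r * (r == w)%:R = if w == t then 0 else
  F w.
  case: eqP => [->|/eqP ne]; first by apply: big1 => r /negbTE ->; rewrite mulr0.
  rewrite (bigD1 w) //= eqxx mulr1 big1 ?addr0 // => r /andP[_ /negbTE ->].
  by rewrite mulr0.
have row1 (W : I -> I -> k) s w : s != t -> W s w = (s == w)%:R ->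
   \sum_r (s == r)%:R * W r w = (s == w)%:R.
  move=> st <-; rewrite (bigD1 s) //= eqxx mul1r big1 ?addr0 // => r /negbTE ne.
  by rewrite eq_sym ne mul0r.
have [||||c' [E _]] := @coords_change U V.
- move=> s w; rewrite {1}/U; case: (s =P t) => [->|/eqP ne]; last first.
    by apply: row1 => //; rewrite /V (negbTE ne).
  rewrite (bigD1 t) //= eqxx.
  under eq_bigr => r /negbTE nr do rewrite nr /V nr -mulNr.
  rewrite sum0 /V eqxx [t == w]eq_sym; case: (w =P t) => [->|_].
    by rewrite addr0 mulVf.
  by rewrite mulNr mulrC subrr.
- move=> s w; rewrite {1}/V; case: (s =P t) => [->|/eqP ne]; last first.
    by apply: row1 => //; rewrite /U (negbTE ne).
  rewrite (bigD1 t) //=.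
  under eq_bigr => r /negbTE nr do rewrite /U nr.
  rewrite sum0 /U eqxx [t == w]eq_sym; case: (w =P t) => _.
    by rewrite addr0 mulfV.
  by rewrite mulrN mulrCA mulfV // mulr1 addNr.
- move=> r s; rewrite /U; case: (r =P t) => [->|_].
    case: (s =P t) => [->|_]; first by left.
    by rewrite oppr_eq0 mulf_eq0 negb_or => /andP[/ra]; right.
  by case: (r =P s) => [->|]; [left|rewrite eqxx].
- move=> r s; rewrite /V; case: (r =P t) => [->|_]; first by move/ra; right.
  by case: (r =P s) => [->|]; [left|rewrite eqxx].
exists c' => x s p; rewrite E (bigD1 t) //= /U eqxx.
case: eqP => [->|/eqP ne].
  by rewrite big1 ?addr0 // => r /negbTE ->; rewrite mulr0.
rewrite (bigD1 s) //= (negbTE ne) eqxx mulr1 big1 ?addr0 =>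
  [|r /andP[/negbTE -> /negbTE ->]]; last by rewrite mulr0.
by rewrite addrC mulrN mulrA mulrAC.
Qed.

(** Every basis element b_s is replaced by b_s - a s b_t; this is admissible
    when tau t is the smallest of the points involved. *)
Lemma coords_shear (a : I -> k) (t : I) : a t = 0 ->
    (forall s, a s != 0 -> rl (tau t) (tau s)) ->
  exists c' : coords inc M (fun s => rl (tau s)), forall x s p, co c x s p =
    co c' x s p - (s == t)%:R * \sum_r co c' x r p * a r.
Proof.
move=> at0 ra.
have inv b b' : b + b' = 0 -> forall s w, \sum_r
  ((s == r)%:R + b * ((r == t)%:R * a s)) *
    ((r == w)%:R + b' * ((w == t)%:R * a r)) = (s == w)%:R :> k.
  move=> bb s w.
  under eq_bigr do rewrite mulrDr.
  rewrite big_split /= sum_delta.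
  transitivity ((s == w)%:R + b * ((w == t)%:R * a s) + b' * ((w == t)%:R * a s));
    last first.
    by rewrite -addrA -mulrDl bb mul0r addr0.
  congr (_ + _); rewrite (bigD1 s) //= eqxx.
  rewrite big1 => [|r /negbTE ne].
    by rewrite addr0; case: (s =P t) => [->|_]; rewrite ?at0 ?mulr1n ?mulr0n; ring.
  by rewrite eq_sym ne add0r; case: (r =P t) => [->|_]; rewrite ?at0 ?mulr1n ?mulr0n;
    ring.
pose U b (r s : I) : k := (r == s)%:R + b * ((s == t)%:R * a r).
have rU b r s : U b r s != 0 -> r = s \/ rl (tau s) (tau r).
  rewrite /U; case: (r =P s) => [->|_]; first by left.
  rewrite add0r mulf_eq0 negb_or => /andP[_]; case: (s =P t) => [->|_];
    last by rewrite mul0r eqxx.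
  by rewrite mul1r => /ra; right.
have [||||c' [_ E]] := @coords_change (U 1) (U (-1)).
- by apply: inv; ring.
- by apply: inv; ring.
- exact: rU.
- exact: rU.
exists c' => x s p; rewrite E.
under eq_bigr do rewrite mulrDr.
rewrite big_split /= sum_delta; congr (_ + _); rewrite -mulrN -sumrN mulr_sumr.
by apply: eq_bigr => r _; ring.
Qed.
End ChangeOfBasis.

Section Matching.
Variables (M N : lmodType H^c) (J I : finType) (tau' : J -> nat) (tau : I -> nat).
Variable d : {linear M -> N}.

(** The invariant of the elimination. In suitable coordinates d has a matrix
    D, whose rows in B are zero or equal to a unit vector, different rows
    giving different unit vectors, and the columns of these unit vectors
    vanish in the rows outside B. *)
Definition partly_matched (B : {set J}) : Prop :=
  exists (cM : coords inc M (fun t => rl (tau' t)))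
         (cN : coords inc N (fun s => rl (tau s)))
         (D : J -> I -> k) (sigma : J -> option I),
  [/\ forall x s p, co cN (d x) s p = \sum_t co cM x t p * D t s,
      forall t s, D t s != 0 -> rl (tau s) (tau' t),
      forall t s, t \in B -> D t s = (sigma t == Some s)%:R,
      forall t t0 s, t \notin B -> t0 \in B -> sigma t0 = Some s -> D t s = 0
    & forall t t' s, t \in B -> t' \in B -> sigma t = Some s -> sigma t' = Some s ->
        t = t'].

(** A map from a sum of projectives is determined by the images of the
    generators. *)
Lemma proj_matrix (cM : coords inc M (fun t => rl (tau' t)))
    (cN : coords inc N (fun s => rl (tau s))) x s p :
  co cN (d x) s p = \sum_t co cM x t p * co cN (d (gen cM t (tau' t))) s (tau' t).
Proof.
have lM t : live n v (rl (tau' t)) by move=> q; apply: block_le_reflr.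
have lN t : live n v (rl (tau t)) by move=> q; apply: block_le_reflr.
have -> : d x = \sum_t \sum_(q < n.+1) ract (d (gen cM t q)) (co cM x t q)%:A.
  rewrite {1}(gen_expand cM lM x) raddf_sum; apply: eq_bigr => t _.
  by rewrite raddf_sum; apply: eq_bigr => q _; rewrite /= linear_ract.
rewrite co_sum; apply: eq_bigr => t _; rewrite co_sum.
have cx w : convex n v (rl w) by apply: proj_convex.
case: (boolP (rl (tau' t) p)) => rp; last first.
  rewrite [in RHS]co_out // mul0r big1 // => q _; rewrite co_scale //.
  case: (boolP (rl (tau' t) q)) => rq; last by rewrite co_out ?mul0r.
  rewrite (_ : gen cM t q = ract (gen cM t q) (eps inc q q)); last first.
    by rewrite ract_gen // (block_le_reflr rq).
  rewrite linear_ract co_eps_ne ?mulr0 //.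
  by apply: contraNneq rp => ->.
have rt := block_le_refll rp.
have g q : rl (tau' t) q -> gen cM t q = ract (gen cM t (tau' t)) (eps inc (tau' t) q).
  by move=> rq; rewrite ract_gen // rq.
rewrite (@sum_point _ n (fun q => co cN (ract (d (gen cM t q)) (co cM x t q)%:A) s p)
  p).
- rewrite co_scale // (g p) // linear_ract; congr (_ * _).
  case: (boolP (rl (tau s) p)) => rsp; first by rewrite co_eps // rp.
  by rewrite !co_out //; apply: contra rsp => rs; apply: block_le_trans rs rp.
- by have := block_le_bound rp; lia.
- move=> q ne; rewrite co_scale //.
  case: (boolP (rl (tau' t) q)) => rq; last by rewrite co_out ?mul0r.
  by rewrite (g q) // linear_ract co_eps_ne ?mulr0 // eq_sym.
Qed.

Lemma partly_matched0 (cM : coords inc M (fun t => rl (tau' t)))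
  (cN : coords inc N (fun s => rl (tau s))) : partly_matched set0.
Proof.
exists cM, cN, (fun t s => co cN (d (gen cM t (tau' t))) s (tau' t)), (fun _ => None).
split=> [x s p|t s nz|t s|t t0 s _|t t' s]; try by rewrite inE.
  exact: proj_matrix.
by apply: contraNT nz => nr; apply/eqP/(co_out cN).
Qed.

(** The next row t is one with tau' t minimal, and its pivot column s1 has
    tau s1 maximal among the nonzero entries. With these choices the column
    operations that clear the rest of row t and the row operations that
    clear the rest of column s1 are admissible changes of basis. *)
Lemma partly_matched_step (B : {set J}) : B != setT -> partly_matched B ->
  exists2 t, t \notin B & partly_matched (t |: B).
Proof.
rewrite -subTset => /subsetPn[t0 _ t0B] [cM [cN [D [sigma [Rel supp inB outB injB]]]]].
case: (@arg_minnP _ t0 (fun t => t \notin B) tau') => // t tB mint; exists t => //.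
have eqs (w : J) : w \in t |: B -> w != t -> w \in B.
  by rewrite !inE => /orP[->|].
case: (pickP (fun s => D t s != 0)) => [s0 Ds0|D0]; last first.
  exists cM, cN, D, (fun w => if w == t then None else sigma w); split=> //.
  - move=> w s wB; case: (w =P t) => [->|/eqP ne]; last by apply: inB; apply: eqs.
    by apply/eqP; have := D0 s => /= /negbFE.
  - move=> w w0 s; rewrite !inE negb_or => /andP[wt wB].
    by case: (w0 =P t) => //= _; apply: outB.
  - by move=> w w' s; rewrite !inE; do 2!case: eqP => //= _; apply: injB.
case: (@arg_maxnP _ s0 (fun s => D t s != 0) tau) => // s1 Ds1 max1.
have s1new w : w \in B -> sigma w != Some s1.
  by move=> wB; apply/eqP => sw; rewrite (outB t w s1) ?eqxx in Ds1.
have [s Ds|cN' EN] := @coords_pivot _ I tau cN (D t) s1 Ds1.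
  by apply: (block_le_linkl (supp _ _ Ds) (supp _ _ Ds1)); apply: max1.
(* The matrix after the column operations, with row t a unit vector. *)
pose D1 w s := if s == s1 then D w s1 / D t s1 else D w s - D w s1 / D t s1 * D t s.
have Rel1 x s p : co cN' (d x) s p = \sum_w co cM x w p * D1 w s.
  rewrite EN !Rel /D1; case: (s == s1); first by rewrite mulr_suml;
    apply: eq_bigr => w _; ring.
  by rewrite mulrAC !mulr_suml -sumrB; apply: eq_bigr => w _; ring.
have supp1 w s : D1 w s != 0 -> rl (tau s) (tau' w).
  rewrite /D1; case: (s =P s1) => [->|_].
    by rewrite mulf_eq0 negb_or => /andP[/supp].
  case: (D w s =P 0) => [->|/eqP/supp //].
  rewrite sub0r oppr_eq0 !mulf_eq0 !negb_or => /andP[/andP[r1 _] r2].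
  have r3 : rl (tau s) (tau s1).
    by apply: (block_le_linkl (supp _ _ r2) (supp _ _ Ds1)); apply: max1.
  exact: block_le_trans r3 (supp _ _ r1).
have D1t s : D1 t s = (s1 == s)%:R.
  rewrite /D1 eq_sym; case: eqP => _; first by rewrite mulfV.
  by rewrite mulfV // mul1r subrr.
have D1B w s : w \in B -> D1 w s = (sigma w == Some s)%:R.
  move=> wB; rewrite /D1 !(inB w) // (negbTE (s1new w wB)) !mul0r subr0.
  by case: (s =P s1) => [->|//]; rewrite (negbTE (s1new w wB)).
pose b w := if (w == t) || (w \in B) then 0 else D1 w s1.
have bt : b t = 0 by rewrite /b eqxx.
have [w|cM' EM] := @coords_shear _ J tau' cM b t bt.
  rewrite /b; case: ifP => [|]; first by rewrite eqxx.
  move=> /negbT; rewrite negb_or => /andP[_ wB] /supp1 r1.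
  by apply: (block_le_linkr (supp _ _ Ds1) r1); apply: mint.
(* The matrix after the row operations, with column s1 cleared outside B. *)
pose D2 w s := D1 w s - b w * D1 t s.
exists cM', cN', D2, (fun w => if w == t then Some s1 else sigma w).
have D2B w s : w \in B -> D2 w s = D1 w s by move=> wB;
  rewrite /D2 /b wB orbT mul0r subr0.
split=> //.
- move=> x s p; rewrite Rel1.
  under eq_bigr do rewrite EM mulrBl.
  rewrite sumrB.
  under [RHS]eq_bigr do rewrite mulrBr.
  rewrite [RHS]sumrB; congr (_ - _).
  rewrite (bigD1 t) //= eqxx mul1r [X in _ + X]big1 ?addr0 => [|w /negbTE ->];
    last by rewrite !mul0r.
  by rewrite mulr_suml; apply: eq_bigr => w _; rewrite mulrA.
- move=> w s; rewrite /D2 D1t.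
  case: (D1 w s =P 0) => [->|/eqP/supp1 //].
  rewrite sub0r oppr_eq0; case: (s1 =P s) => [<-|_]; last by rewrite mulr0 eqxx.
  rewrite mulr1 /b; case: ifP => [|_]; first by rewrite eqxx.
  exact: supp1.
- move=> w s; rewrite !inE; case: (w =P t) => [-> _|_ /= wB].
    by rewrite /D2 bt mul0r subr0 D1t.
  by rewrite D2B // D1B.
- move=> w w0 s; rewrite !inE negb_or => /andP[/negbTE wt wB].
  rewrite /D2 /b wt (negbTE wB) /= D1t.
  case: (w0 =P t) => [_ _ [<-]|_ /= w0B sw0]; first by rewrite eqxx mulr1 subrr.
  case: eqP => [e|_]; first by have := s1new w0 w0B; rewrite sw0 e eqxx.
  rewrite mulr0 subr0 /D1; case: eqP => [e|_]; first by have := s1new w0 w0B;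
    rewrite sw0 e eqxx.
  by rewrite (outB w w0 s) // (outB t w0 s) // mulr0 subrr.
- move=> w w' s; rewrite !inE.
  case: (w =P t) => [->|_] /=; case: (w' =P t) => [->|_] //=.
  + by move=> _ w'B [<-] e; have := s1new w' w'B; rewrite e eqxx.
  + by move=> wB _ e [es]; have := s1new w wB; rewrite e es eqxx.
  exact: injB.
Qed.

Lemma partial_matching (cM0 : coords inc M (fun t => rl (tau' t)))
  (cN0 : coords inc N (fun s => rl (tau s))) :
  exists (cM : coords inc M (fun t => rl (tau' t)))
         (cN : coords inc N (fun s => rl (tau s))) (sigma : J -> option I),
  [/\ forall t t' s, sigma t = Some s -> sigma t' = Some s -> t = t',
      forall x s p, co cN (d x) s p = \sum_t co cM x t p * (sigma t == Some s)%:R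
    & forall t s, sigma t = Some s -> rl (tau s) (tau' t)].
Proof.
have : partly_matched setT.
  suff: forall e (B : {set J}), (#|~: B| <= e)%N -> partly_matched B ->
    partly_matched setT.
    by apply; [exact: leqnn|exact: partly_matched0].
  elim=> [|e IHe] B.
    by rewrite leqn0 cards_eq0 => /eqP/(congr1 (@setC _)); rewrite setCK setC0 => ->.
  have [->//|BT le_e /(partly_matched_step BT)[t tB]] := eqVneq B setT.
  apply: IHe; rewrite -ltnS; apply: leq_trans le_e; apply: proper_card.
  rewrite setCU; apply/properP; split; first exact: subsetIr.
  by exists t; rewrite !inE ?eqxx.
case=> cM [cN [D [sigma [Rel supp inT _ injT]]]]; exists cM, cN, sigma; split.
- by move=> t t' s; apply: injT; rewrite inE.
- by move=> x s p; rewrite Rel; apply: eq_bigr => t _; rewrite inT ?inE.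
- by move=> t s st; apply: supp; rewrite inT ?inE // st eqxx oner_eq0.
Qed.

End Matching.

(** The end of the block of i. The projective at this point is zero, so that
    a cokernel of P_(block_end i) -> P_i is P_i itself. *)
Definition block_end (i : nat) : nat := if (i < v)%N then v else n.+1.

(** The two-term summands P_j -> P_i of a diagonal form, for (i, j): an
    identity, an inclusion, a map 0 -> P_i, and a map P_j -> 0. *)
Definition pair_ok (ij : nat * nat) : bool :=
  [|| (ij.1 == ij.2) && (ij.2 <= n.+1)%N, rl ij.1 ij.2,
    rl ij.1 ij.1 && (ij.2 == block_end ij.1)
    | (ij.1 == v) && rl ij.2 ij.2].

Lemma block_le_dead q p : ~~ rl q q -> rl q p = false.
Proof. by apply: contraNF => /block_le_refll. Qed.

Lemma block_le_v p : rl v p = false.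
Proof. by rewrite /block_le; lia. Qed.

Lemma block_le_last p : rl n.+1 p = false.
Proof. by rewrite /block_le; lia. Qed.

Lemma block_le_end i p : rl (block_end i) p = false.
Proof. by rewrite /block_end; case: ifP; rewrite ?block_le_v ?block_le_last. Qed.

(** Source and target are sums, over the same index set, of projectives P_j
    and P_i, and d is the sum of the canonical maps P_j -> P_i, which
    multiply each coordinate by 1. *)
Definition diagonal (M N : lmodType H^c) (d : {linear M -> N}) (K : finType)
   (ij : K -> nat * nat) (cM : coords inc M (fun s => rl (ij s).2))
   (cN : coords inc N (fun s => rl (ij s).1)) : Prop :=
  forall x s p, rl (ij s).1 p -> co cN (d x) s p = co cM x s p.

(** The rows t of the matched matrix index the summands P_(tau' t) -> P_(tau
    s) for s = sigma t, with target 0 if t is not matched; the columns s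
    that are not hit index the summands 0 -> P_(tau s). To have one index
    set, every row and every column is kept, superfluous ones becoming a
    pair of equal dead points. *)
Lemma diagonal_form (M N : lmodType H^c) (J I : finType) (tau' : J -> nat)
  (tau : I -> nat)
    (d : {linear M -> N})
    (cM0 : coords inc M (fun t => rl (tau' t)))
      (cN0 : coords inc N (fun s => rl (tau s))) :
    (v <= n)%N ->
  exists (K : finType) (ij : K -> nat * nat) (cM : coords inc M (fun s => rl (ij s).2))
     (cN : coords inc N (fun s => rl (ij s).1)),
   (forall s, pair_ok (ij s)) /\ diagonal d cM cN.
Proof.
move=> vn; have [cM [cN [sigma [injs Rel rs]]]] := partial_matching d cM0 cN0.
(* The columns that are matched. *)
pose hit s := [exists t, sigma t == Some s].
(* The pairs (v, v) and (n + 1, n + 1) are the superfluous ones. *)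
pose ij (x : J + I) := match x with
  | inl t => if rl (tau' t) (tau' t) then
      (if sigma t is Some s then tau s else v, tau' t) else (v, v)
  | inr s => if hit s || ~~ rl (tau s) (tau s) then (n.+1, n.+1) else
    (tau s, block_end (tau s))
  end.
have ij2l t p : rl (ij (inl t)).2 p = rl (tau' t) p.
  by rewrite /ij; case: ifP => //= /negbT/block_le_dead ->; rewrite block_le_v.
have ij2r s p : rl (ij (inr s)).2 p = false.
  by rewrite /ij; case: ifP => //= _; rewrite ?block_le_last ?block_le_end.
have ij1l t p : rl (ij (inl t)).1 p = if sigma t is Some s then rl (tau s) p else false.
  rewrite /ij; case es: (sigma t) => [s|]; last by case: ifP; rewrite /= block_le_v.
  by rewrite (block_le_reflr (rs _ _ es)).
have ij1r s p : rl (ij (inr s)).1 p = ~~ hit s && rl (tau s) p.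
  rewrite /ij; case: (hit s) => /=; first by rewrite block_le_last.
  by case: ifP => //= /block_le_dead ->; rewrite block_le_last.
unshelve eexists (J + I)%type, ij, _, _.
- exists (fun x a p => if a is inl t then co cM x t p else 0)
  (fun F => mk cM (fun t => F (inl t))).
  + by move=> x y [t|s] p; rewrite ?coD ?addr0.
  + by move=> x h [t|s] q; [rewrite ij2l => rq; rewrite coA|rewrite ij2r].
  + by move=> x [t|s] p //; rewrite ij2l => nr; rewrite co_out.
  + by move=> F [t|s] p; rewrite ?ij2l ?ij2r // co_mk.
  + move=> x y xy; apply: (co_inj (c := cM)) => t p rp.
    by apply: (xy (inl t)); rewrite ij2l.
- exists (fun x a p => match a with
            | inl t => if sigma t is Some s then co cN x s p else 0
            | inr s => if hit s then 0 else co cN x s p end)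
    (fun F => mk cN (fun s p => if [pick t | sigma t == Some s] is Some t then F
      (inl t) p
                               else F (inr s) p)).
  + by move=> x y [t|s] p; [case: (sigma t) => [s|]|case: ifP => _];
    rewrite ?coD ?addr0.
  + move=> x h [t|s] q; [rewrite ij1l; case: (sigma t) => [s|//]|rewrite ij1r;
    case: (hit s) => //=].
      by move=> rq; rewrite coA.
    by move=> rq; rewrite coA.
  + move=> x [t|s] p; [rewrite ij1l; case: (sigma t) => [s|//]|rewrite ij1r;
    case: (hit s) => //=].
      by apply: co_out.
    by apply: co_out.
  + move=> F [t|s] p; rewrite ?ij1l ?ij1r.
      case es: (sigma t) => [s|//]; rewrite co_mk; case: ifP => // _.
      case: pickP => [t' /eqP es'|/(_ t)]; last by rewrite es eqxx.
      by rewrite (injs _ _ _ es es').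
    case: (boolP (hit s)) => //= /existsPn nh; rewrite co_mk; case: ifP => // _.
    by case: pickP => // t'; rewrite (negbTE (nh t')).
  + move=> x y xy; apply: (co_inj (c := cN)) => s p rp.
    have := xy (inr s) p; rewrite ij1r rp andbT.
    case: (boolP (hit s)) => [/existsP[t /eqP es] _|_]; last by apply.
    by have := xy (inl t) p; rewrite ij1l es; apply.
split=> [[t|s]|x [t|s] p].
- rewrite /pair_ok /ij; case: ifP => [rt|_] /=; last by rewrite eqxx leqW.
  by case es: (sigma t) => [s|] /=; rewrite ?(rs _ _ es) ?rt ?eqxx ?orbT.
- rewrite /pair_ok /ij; case: ifP => [_|]; first by rewrite /= eqxx leqnn.
  by move=> /negbT; rewrite negb_or negbK => /andP[_ ->]; rewrite eqxx !orbT.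
- rewrite ij1l /=; case es: (sigma t) => [s|//] rp;
  rewrite Rel (bigD1 t) //= es eqxx mulr1.
  rewrite big1 ?addr0 // => t' ne; case: eqP => [es'|_]; last by rewrite mulr0.
  by rewrite (injs _ _ _ es' es) eqxx in ne.
- rewrite ij1r => /andP[/negbTE nh rp] /=; rewrite nh Rel big1 // => t _.
  by have /existsPn/(_ t)/negbTE -> := negbT nh; rewrite mulr0.
Qed.
End NormalForm.

(** * Modules are sums of segments *)

Section Decomposition.
Variables (k : fieldType) (H : falgType k) (n v : nat) (inc : incidence H n v).
Hypothesis vn : (v <= n)%N.
Local Notation rl := (block_le n v).
Local Notation eps := (eps inc).
Local Notation seg := (segment n v).

Lemma fin_gen_family (M : lmodType H^c) : fin_gen M ->
  exists (I : finType) (tau : I -> nat) (m : I -> M),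
    gen_family inc (fun _ => True) tau m.
Proof.
case=> r [f f_surj].
have [] := @subspace_family _ _ _ _ inc _ _ _ (free_coord inc r) _ (fun _ => True).
- by move=> s; apply: proj_live.
- by [].
move=> J [tau [m [mt _ mg]]]; exists J, tau, (fun s => f (m s)); split=> // [s|x _].
  by rewrite -linear_ract mt.
have [y <-] := f_surj x; have [h ->] := mg y I; exists h.
by rewrite raddf_sum; apply: eq_bigr => s _; rewrite /= linear_ract.
Qed.

Lemma torsion_free_coords (M : lmodType H^c) : fin_gen M -> torsion_free inc M ->
  exists (I : finType) (tau : I -> nat) (c : coords inc M (fun s => rl (tau s))), True.
Proof.
move=> fgM tfM; have [I [tau [m gm]]] := fin_gen_family fgM.
have [tau' [m' [gm' fr']]] := minimal_family tfM Logic.I gm.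
by have [c _] := family_coords gm' fr'; exists I, tau', c.
Qed.

(** A projective module embeds in a free one. *)
Lemma fg_projective_torsion_free (M : lmodType H^c) :
  fg_projective M -> torsion_free inc M.
Proof.
move=> [[r [f f_surj]] /(_ _ _ f idfun f_surj)[h fh]] p q x pq x0.
have := free_tf (inc := inc) (x := h x) pq; rewrite -!linear_ract x0 raddf0 =>
  /(_ erefl) h0.
by have := fh (ract x (eps p p)); rewrite h0 raddf0 /= => <-.
Qed.

(** The pairs of [pair_ok] that occur in a diagonal form of an injective
    map. *)
Definition seg_ok (ij : nat * nat) : bool :=
  [|| (ij.1 == ij.2) && (ij.2 <= n.+1)%N, rl ij.1 ij.2
    | rl ij.1 ij.1 && (ij.2 == block_end n v ij.1)].

Lemma seg_okP ij p : seg_ok ij -> rl ij.1 p -> (ij.2 <= p)%N -> rl ij.2 p.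
Proof.
case: ij => i j; rewrite /seg_ok /= => /or3P[/andP[/eqP -> _] //|ij
  ip|/andP[ii /eqP ->]].
  by apply: block_le_linkr ij ip.
by rewrite /block_end; case: ifP; rewrite /block_le; lia.
Qed.

(** The kernel of a free cover of T is torsion free, hence a sum of
    projectives. In a diagonal form of its inclusion, the cokernel is the
    sum of the cokernels of maps P_j -> P_i, which are segments. *)
Lemma segment_coords (T : lmodType H^c) : fin_gen T ->
  exists (K : finType) (ij : K -> nat * nat) (c : coords inc T (fun s => seg (ij s))),
    forall s, seg_ok (ij s).
Proof.
case=> r [f f_surj]; pose F : lmodType H^c := ({ffun 'I_r -> (H^c)^o} : lmodType H^c).
have tfF : torsion_free inc F by move=> p q x; apply: free_tf.
have [] := @subspace_family _ _ _ _ inc _ _ _ (free_coord inc r) _ (fun x => f x = 0).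
- by move=> s p; apply: block_le_reflr.
- by move=> x h fx0; rewrite linear_ract fx0 ract0l.
move=> J [tau0 [m0 gm0]].
have [tau' [m' [[mt mK mg] fr]]] := minimal_family tfF (raddf0 f) gm0.
pose c0 := fmod_coord inc (proj_shape n v tau').
pose d : {linear _ -> F} := ext c0 mt.
have d_inj x : d x = 0 -> x = 0.
  move=> dx0; apply: (co_inj (c := c0)) => s p rp; rewrite co0 -crd_row.
  exact: (fr _ dx0).
have d_ker x : f (d x) = 0.
  by rewrite raddf_sum big1 // => s _; rewrite /= linear_ract mK ract0l.
have [K [ij [cM [cN [ok diag]]]]] := diagonal_form d c0 (free_coord inc r) vn.
have ok' s : seg_ok (ij s).
  have := ok s; rewrite /pair_ok /seg_ok => /or4P[->|->|->|/andP[/eqP iv jj]] //;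
    rewrite ?orbT //.
  (* A summand P_j -> 0 is excluded by injectivity. *)
  have : gen cM s (ij s).2 = 0.
    apply: d_inj; apply: (co_inj (c := cN)) => s' p rp.
    rewrite co0 diag // co_gen; case: eqP rp => [->|]; last by rewrite andbF.
    by rewrite iv block_le_v.
  move/(congr1 (fun x => co cM x s (ij s).2)); rewrite co0 co_gen jj !eqxx => /eqP.
  by rewrite oner_eq0.
have ker x : f x = 0 <-> forall s p, seg (ij s) p -> co cN x s p = 0.
  split=> [fx0 s p /andP[ip pj]|x0].
    have [h xh] := mg x fx0.
    pose z : fmod_of (proj_shape n v tau') inc :=
      mk c0 (fun s q => crd inc (h s) (tau' s) q).
    have -> : x = d z.
      rewrite xh; apply: eq_bigr => t _; rewrite -(mt t) !ractM; congr (ract _ _).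
      apply: (crd_inj (i := inc)) => a b; rewrite !eps_mull; case: ifP => // _.
      rewrite crd_row (co_mk c0) /=; case: ifP => // /negbT.
      exact: crd_out.
    rewrite diag // co_out //; apply/negP; rewrite /block_le; lia.
  have -> : x = d (mk cM (co cN x)).
    apply: (co_inj (c := cN)) => s p ip; rewrite diag // co_mk;
      case: ifP => // /negbT jp.
    apply: x0; rewrite /segment ip ltnNge /=; apply: contra jp.
    exact: seg_okP.
  exact: d_ker.
have lift y : {x | f x = y} by apply: constructive_indefinite_description;
  apply: f_surj.
pose co' (y : T) s p := if seg (ij s) p then co cN (sval (lift y)) s p else 0.
have coE x s p : seg (ij s) p -> co' (f x) s p = co cN x s p.
  move=> sp; rewrite /co' sp; case: (lift _) => x' /= /eqP.
  rewrite -subr_eq0 -raddfB => /eqP/ker/(_ s p sp); rewrite coB => /eqP.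
  by rewrite subr_eq0 => /eqP.
have co'0 y s p : ~~ seg (ij s) p -> co' y s p = 0 by rewrite /co' => /negbTE ->.
unshelve eexists K, ij, _; last exact: ok'.
exists co' (fun F => f (mk cN F)).
- move=> y y' s p; rewrite -(svalP (lift y)) -(svalP (lift y')) /= -raddfD.
  by case: (boolP (seg (ij s) p)) => sp; [rewrite !coE // coD|rewrite !co'0 // addr0].
- move=> y h s q sq; rewrite -(svalP (lift y)) /= -linear_ract coE //.
  have /andP[iq qj] := sq; rewrite coA //; apply: eq_bigr => p _.
  case: (boolP (seg (ij s) p)) => [sp|nsp]; first by rewrite coE.
  rewrite co'0 // mul0r.
  case: (boolP (rl (ij s).1 p)) => ip; last by rewrite co_out ?mul0r.
  rewrite crd_out ?mulr0 //; apply: contra nsp => pq; rewrite /segment ip /=.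
  by move: pq; rewrite /block_le; lia.
- exact: co'0.
- move=> F0 s p; case: ifP => [sp|/negbT/co'0 -> //]; rewrite coE // co_mk.
  by have /andP[-> _] := sp.
- move=> y y' yy; rewrite -(svalP (lift y)) -(svalP (lift y')) /=.
  apply/eqP; rewrite -subr_eq0 -raddfB; apply/eqP/ker => s p sp.
  have := yy s p sp; rewrite /co' sp coB => ->; exact: subrr.
Qed.

End Decomposition.

(** * Combinatorics of tubings *)

Section Tubings.
Local Open Scope nat_scope.

(** For tubes (i, j) and (k, l) this reads i < k <= j < l; adjacent tubes
    cross as well. It is the case of a nonsplit extension of (i, j) by (k,
    l), with middle term the sum of (i, l) and (k, j). *)
Definition crossing (s t : nat * nat) := (s.1 < t.1) && (t.1 <= s.2 < t.2).

Section Family.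
Variables (n : nat) (T : nat -> nat -> bool).
Hypothesis T_le : forall i j, T i j -> j <= n.+1.
Hypothesis T_nc : forall i j k l, T i j -> T k l -> ~~ crossing (i, j) (k, l).
Hypothesis T_sep : forall p q, p < q <= n ->
  exists i j, T i j /\ tube (i, j) p != tube (i, j) q.

Definition sub_covered a b x := exists i j,
  [/\ T i j, a <= i, j <= b, (i, j) <> (a, b) & i <= x < j].

(** Otherwise let (a, j) be the largest proper subtube starting at a; a
    proper subtube containing the point j would cross it or be a larger one
    starting at a. *)
Lemma sub_covered_not_all a b : a < b -> exists2 x, a <= x < b & ~ sub_covered a b x.
Proof.
move=> ab; apply: NNPP => all_cov.
have cov x : a <= x < b -> sub_covered a b x.
  by move=> xab; apply: NNPP => nc; apply: all_cov; exists x.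
pose P j := T a j && (a < j < b).
have [|j Pj|j /andP[Taj /andP[aj jb]] jmax] := @ex_maxnP P b.
- have [|i [j [Tij ai jb ne ij]]] := cov a; first by lia.
  exists j; have e : i = a by lia.
  subst i; rewrite /P Tij /=; have : j <> b by move=> e; apply: ne; rewrite e.
  lia.
- by case/and3P: Pj => _ _ /ltnW.
have [|k [l [Tkl ak lb ne jl]]] := cov j; first by lia.
have := T_nc Taj Tkl; rewrite /crossing /= => nc.
have e : k = a by lia.
subst k; have lb' : l <> b by move=> e; apply: ne; rewrite e.
by have := jmax l; rewrite /P Tkl /=; lia.
Qed.

(** A tube separating x and y contains just one of them. It is not a proper
    subtube and does not contain (a, b), so that it would cross it. *)
Lemma sub_covered_unique a b x y : T a b -> a <= x < b -> a <= y < b -> b <= n.+1 ->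
  ~ sub_covered a b x -> ~ sub_covered a b y -> x = y.
Proof.
move=> Tab; wlog: x y / x < y => [W|xy xab yab bn ncx ncy].
  move=> xab yab bn ncx ncy; case: (ltngtP x y) => // xy; first exact: W.
  by apply/esym; apply: W.
have [|i [j [Tij ne]]] := @T_sep x y; first by lia.
case: ((i, j) =P (a, b)) => [[ei ej]|nab]; first by move: ne; rewrite ei ej /tube /=;
  lia.
have n1 := T_nc Tij Tab; have n2 := T_nc Tab Tij.
rewrite /crossing /= in n1 n2.
have nx : ~ (a <= i /\ j <= b /\ i <= x < j).
  by case=> ai [jb ijx]; apply: ncx; exists i, j.
have ny : ~ (a <= i /\ j <= b /\ i <= y < j).
  by case=> ai [jb ijy]; apply: ncy; exists i, j.
by move: ne nx ny n1 n2; rewrite /tube /=; lia.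
Qed.

(** The root r is the point in no proper subtube. The largest proper subtube
    starting at a ends at r, since otherwise the subtube containing its end
    would cross it; likewise on the right. *)
Lemma tube_root a b : T a b -> a < b -> exists2 r, a <= r < b &
  (a = r \/ T a r) /\ (r.+1 = b \/ T r.+1 b).
Proof.
move=> Tab ab; have bn := T_le Tab.
have [r rab ncr] := sub_covered_not_all ab; exists r => //.
have cov x : a <= x < b -> x <> r -> sub_covered a b x.
  by move=> xab xr; apply: NNPP => ncx; apply: xr; apply: (@sub_covered_unique a b).
have rout i j : T i j -> a <= i -> j <= b -> (i, j) <> (a, b) -> ~ (i <= r < j).
  by move=> Tij ai jb ne ijr; apply: ncr; exists i, j.
split.
- case: (ltngtP a r) => [ar|ra|->]; [right|lia|by left].
  pose P j := T a j && (a < j <= r).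
  have [|j Pj|j /andP[Taj /andP[aj jr]] jmax] := @ex_maxnP P b.
  + have [||i [j [Tij ai jb ne ij]]] := cov a; [lia|lia|].
    have e : i = a by lia.
    by subst i; exists j; rewrite /P Tij /=; have := rout _ _ Tij ai jb ne; lia.
  + by case/and3P: Pj => _ _ ?; lia.
  case: (ltngtP j r) => [jr'|rj|<- //]; last by lia.
  have [||k [l [Tkl ak lb ne jl]]] := cov j; [lia|lia|].
  have := T_nc Taj Tkl; rewrite /crossing /= => nc.
  have e : k = a by lia.
  by subst k; have := jmax l; rewrite /P Tkl /=; have := rout _ _ Tkl ak lb ne; lia.
- case: (ltngtP r.+1 b) => [rb|br|->]; [right|lia|by left].
  pose P i := T i b && (r < i).
  have [|i /andP[Tib ri] imin] := @ex_minnP P.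
    have [||i [j [Tij ai jb ne ij]]] := cov b.-1; [lia|lia|].
    have e : j = b by lia.
    by subst j; exists i; rewrite /P Tij /=; have := rout _ _ Tij ai jb ne; lia.
  have ib : i <= b.
    have [||i' [j [Tij ai jb ne ij]]] := cov b.-1; [lia|lia|].
    have e : j = b by lia.
    by subst j; have := imin i'; rewrite /P Tij /=; have := rout _ _ Tij ai jb ne; lia.
  case: (ltngtP i r.+1) => [ir|ir|<- //]; first by lia.
  have [||k [l [Tkl ak lb ne jl]]] := cov i.-1; [lia|lia|].
  have := T_nc Tkl Tib; rewrite /crossing /= => nc.
  have e : l = b by lia.
  by subst l; have := imin k; rewrite /P Tkl /=; have := rout _ _ Tkl ak lb ne; lia.
Qed.

Definition tube0 i j := (i == j) || T i j.

(** The descent to the point i in the binary tree of the tube (a, b): c 0, c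
    1, ... are the successive tubes containing i, followed by the empty
    interval (i, i). If the root is to the right of i the left end is kept,
    if it is to the left the right end is kept; in both cases, and when i is
    the root, the left end of c m and the right end of the next one bound a
    tube or an empty interval. *)
Lemma tube_chain a b i : T a b -> a <= i < b -> exists c : nat -> nat * nat,
  [/\ c 0 = (a, b),
      forall m, tube0 (c m).1 (c m).2 && tube0 (c m).1 (c m.+1).2,
      forall m, (c m).1 <= (c m.+1).1 <= i,
      forall m, i <= (c m.+1).2 <= (c m).2
    & forall m, b - a <= m -> c m = (i, i)].
Proof.
have [N] := ubnP (b - a); elim: N a b => // N IHN a b ltN Tab iab.
have [|r rab [left_r right_r]] := tube_root Tab; first by lia.
suff [c' [c'1 c'2 c'3 c'4 [c'5 c'6]]] : exists c' : nat -> nat * nat,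
  [/\ forall m, tube0 (c' m).1 (c' m).2 && tube0 (c' m).1 (c' m.+1).2,
      forall m, (c' m).1 <= (c' m.+1).1 <= i,
      forall m, i <= (c' m.+1).2 <= (c' m).2,
      forall m, (b - a).-1 <= m -> c' m = (i, i)
    & [/\ a <= (c' 0).1 <= i, i <= (c' 0).2 <= b & tube0 a (c' 0).2]].
  exists (fun m => if m is m'.+1 then c' m' else (a, b)).
  split=> // [[|m]|[|m]|[|m]|[|m]] //=; rewrite ?c'1 ?c'2 ?c'3 //.
  - by rewrite {1}/tube0 Tab orbT /=.
  - by lia.
  - by move=> lem; apply: c'4; lia.
case: (ltngtP i r) => [ir|ri|eir].
- have Tar : T a r by case: left_r => // e; lia.
  have [||c [c0 c1 c2 c3 c4]] := IHN a r _ Tar; [lia|lia|].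
  exists c; split=> //; first by move=> m lem; apply: c4; lia.
  by rewrite c0 /=; split; [lia|lia|rewrite /tube0 Tar orbT].
- have Trb : T r.+1 b by case: right_r => // e; lia.
  have [||c [c0 c1 c2 c3 c4]] := IHN r.+1 b _ Trb; [lia|lia|].
  exists c; split=> //; first by move=> m lem; apply: c4; lia.
  by rewrite c0 /=; split; [lia|lia|rewrite /tube0 Tab orbT].
- exists (fun=> (i, i)); split=> //= [m|m|m|]; rewrite ?leqnn /tube0 ?eqxx //.
  by split=> //; [lia|lia|]; rewrite eir; case: left_r => [->|->]; rewrite ?eqxx ?orbT.
Qed.

End Family.

Section Valid.
Variables (n v : nat) (K : finType) (ij : K -> nat * nat).

Definition noncrossing := forall s t, ~~ crossing (ij s) (ij t).
Definition separating :=
  forall p q, p < q <= n -> exists s, tube (ij s) p != tube (ij s) q.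

(** The tube does not contain v and has its ends in one block, v and n + 1
    being allowed as right ends. *)
Definition in_blocks (ij : nat * nat) :=
  (ij.1 <= ij.2) && ((ij.2 <= v) || (v < ij.1) && (ij.2 <= n.+1)).
Definition tubing := [/\ forall s, in_blocks (ij s), noncrossing & separating].

Definition tubes i j := [exists s, ij s == (i, j)].

Lemma tubesP i j : reflect (exists s, ij s = (i, j)) (tubes i j).
Proof. exact: 'exists_eqP. Qed.

Lemma tubes_nc : noncrossing -> forall i j k l, tubes i j -> tubes k l ->
  ~~ crossing (i, j) (k, l).
Proof. by move=> nc i j k l /tubesP[s <-] /tubesP[t <-]. Qed.

Lemma tubes_sep : separating -> forall p q, p < q <= n ->
  exists i j, tubes i j /\ tube (i, j) p != tube (i, j) q.
Proof.
move=> sep p q /sep[s ne]; exists (ij s).1, (ij s).2.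
by rewrite -surjective_pairing; split=> //; apply/tubesP; exists s;
  rewrite -surjective_pairing.
Qed.

Lemma tubing_covers : tubing -> v <= n -> forall p, p <= n -> p != v -> exists s,
  tube (ij s) p.
Proof.
move=> [rg nc sep] vn p pn pv.
have [s] : exists s, tube (ij s) p != tube (ij s) v.
  case: (ltngtP p v) pv => // pv _; first by apply: sep; lia.
  by have [|s ne] := sep v p; [lia|exists s; rewrite eq_sym].
by exists s; have := rg s; move: p0; rewrite /in_blocks /tube; lia.
Qed.

(** A tube must separate p from v, so that each nonempty block is covered by
    tubes. The longest tube starting at its left end is the whole block,
    since the tube containing its right end would cross it. *)
Lemma tubing_block : tubing -> v <= n -> forall p, p <= n -> p != v ->
  tubes (if p < v then 0 else v.+1) (if p < v then v else n.+1).
Proof.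
move=> tb vn p pn pv; have [rg nc sep] := tb.
set a := if p < v then _ else _; set b := if p < v then _ else _.
have ab : [/\ a < b, a <= n, a != v & (b <= v) = (a < v)] by rewrite /a /b; case: ifP;
  split; lia.
have [lab an av bv] := ab.
pose P j := tubes a j && (a < j).
have Pb j : P j -> j <= b.
  case/andP=> /tubesP[s es] aj; have := rg s; rewrite es /in_blocks /= /b.
  by move: aj; rewrite /a; case: ifP; lia.
have [|j Pj|j /andP[Taj aj] jmax] := @ex_maxnP P b; last first.
- have jb : j <= b by apply: Pb; rewrite /P Taj.
  case: (ltngtP j b) => [jb'|/ltn_geF|<- //]; last by rewrite jb.
  have [||s] := tubing_covers tb vn (p := j);
    [|by move: aj jb'; rewrite /a /b; case: ifP; lia|].
    by move: jb'; rewrite /b; case: ifP; lia.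
  have /tubesP[s0 e0] := Taj; have := nc s0 s; have := rg s; rewrite e0.
  case es: (ij s) => [k l]; rewrite /crossing /in_blocks /tube /= => rs ns js.
  have ek : k = a by move: rs ns js aj jb'; rewrite /a /b; case: ifP; lia.
  have := jmax l; rewrite /P -ek (_ : tubes k l); last by apply/tubesP; exists s.
  by lia.
- exact: Pb.
have [s] := tubing_covers tb vn an av.
have := rg s; case es: (ij s) => [k l]; rewrite /in_blocks /tube /= => rs js.
have ek : k = a by move: rs js; rewrite /a; case: ifP; lia.
by exists l; rewrite /P -ek (_ : tubes k l); [lia|apply/tubesP; exists s].
Qed.

End Valid.

(** Otherwise all points are covered, and the longest tube starting at 0
    would be (0, n + 1), by the argument of [tubing_block]. *)
Lemma tubing_split n (K : finType) (ij : K -> nat * nat) :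
  (forall s, (ij s).1 <= (ij s).2 <= n.+1) -> (forall s, ij s <> (0, n.+1)) ->
  noncrossing ij -> separating n ij -> exists2 v, v <= n & tubing n v ij.
Proof.
move=> rg nfull nc sep.
suff [v vn out] : exists2 v, v <= n & forall s, ~~ tube (ij s) v.
  exists v => //; split=> // s; have := rg s; have := out s.
  by rewrite /tube /in_blocks; lia.
apply: NNPP => all_cov.
have cov x : x <= n -> exists s, tube (ij s) x.
  move=> xn; apply: NNPP => nx; apply: all_cov; exists x => // s.
  by apply/negP => sx; apply: nx; exists s.
pose P j := tubes ij 0 j && (0 < j <= n).
have [|j Pj|j /andP[Taj aj] jmax] := @ex_maxnP P n.
- have [s s0] := cov 0 isT; exists (ij s).2.
  have e1 : (ij s).1 = 0 by move: s0; rewrite /tube; lia.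
  have e2 : (ij s).2 <> n.+1 by move=> e; apply: (nfull s);
    rewrite [ij s]surjective_pairing e1 e.
  rewrite /P (_ : tubes _ _ _); last by apply/tubesP; exists s;
    rewrite -e1 -surjective_pairing.
  by have := rg s; move: s0; rewrite /tube; lia.
- by case/and3P: Pj.
have [|s sj] := cov j; first by lia.
have /tubesP[s0 e0] := Taj; have := nc s0 s; rewrite e0 /crossing /= => n0.
have e1 : (ij s).1 = 0 by move: sj n0; rewrite /tube; lia.
have e2 : (ij s).2 <> n.+1 by move=> e; apply: (nfull s);
  rewrite [ij s]surjective_pairing e1 e.
have := jmax (ij s).2; rewrite /P (_ : tubes _ _ _); last by apply/tubesP; exists s;
  rewrite -e1 -surjective_pairing.
by have := rg s; move: sj; rewrite /tube; lia.
Qed.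

End Tubings.

(** * The algebra of a family of tubes *)

(** Both sides present an algebra as a set of representatives modulo a
    relation. A map L between representatives that is bijective on classes
    and compatible with the operations transfers the presentations, also
    where it has no inverse on representatives. *)
Lemma quotient_isom_transfer (k : fieldType) (A : falgType k)
    (E1 : Type) (eq1 : E1 -> E1 -> Prop) add1 mul1 sc1 one1
    (E2 : Type) (eq2 : E2 -> E2 -> Prop) add2 mul2 sc2 one2 (L : E1 -> E2) :
  (forall f, eq2 f f) -> (forall f g, eq2 f g -> eq2 g f) ->
  (forall f g h, eq2 f g -> eq2 g h -> eq2 f h) ->
  (forall f f' g g', eq2 f f' -> eq2 g g' -> eq2 (add2 f g) (add2 f' g')) ->
  (forall f f' g g', eq2 f f' -> eq2 g g' -> eq2 (mul2 f g) (mul2 f' g')) ->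
  (forall c f f', eq2 f f' -> eq2 (sc2 c f) (sc2 c f')) ->
  (forall a b, eq1 a b <-> eq2 (L a) (L b)) ->
  (forall f, exists a, eq2 f (L a)) ->
  (forall a b, eq2 (L (add1 a b)) (add2 (L a) (L b))) ->
  (forall a b, eq2 (L (mul1 a b)) (mul2 (L a) (L b))) ->
  (forall c a, eq2 (L (sc1 c a)) (sc2 c (L a))) ->
  eq2 (L one1) one2 ->
  quotient_isom A eq1 add1 mul1 sc1 one1 <-> quotient_isom A eq2 add2 mul2 sc2 one2.
Proof.
move=> refl2 sym2 trans2 addC mulC scC eqL surjL addL mulL scL oneL; split.
  case=> phi [phi_eq phi_surj phiD phiZ [phiM phi1]].
  have ch f : {a | eq2 f (L a)} by apply: constructive_indefinite_description.
  pose a f := sval (ch f); have La f : eq2 f (L (a f)) := svalP (ch f).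
  have key f b : eq2 f (L b) -> phi (a f) = phi b.
    by move=> fb; apply/phi_eq/eqL; apply: (trans2 _ _ _ _ fb); apply: sym2.
  exists (fun f => phi (a f)); split.
  - move=> f g; split=> [fg|/phi_eq/eqL ag]; first by apply: key;
    apply: (trans2 _ _ _ fg).
    by apply: (trans2 _ _ _ (La f)); apply: (trans2 _ _ _ ag); apply: sym2.
  - by move=> y; have [b <-] := phi_surj y; exists (L b); apply: key.
  - move=> f g; rewrite -phiD; apply: key; apply:
    (trans2 _ _ _ _ (sym2 _ _ (addL _ _))).
    exact: addC.
  - by move=> c f; rewrite -phiZ; apply: key;
    apply: (trans2 _ _ _ _ (sym2 _ _ (scL _ _))); apply: scC.
  - split; last by rewrite -phi1; apply: key; apply: sym2.
    by move=> f g; rewrite -phiM; apply: key;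
      apply: (trans2 _ _ _ _ (sym2 _ _ (mulL _ _))); apply: mulC.
case=> phi [phi_eq phi_surj phiD phiZ [phiM phi1]].
exists (fun a => phi (L a)); split.
- by move=> f g; rewrite -phi_eq; apply: eqL.
- move=> y; have [f <-] := phi_surj y; have [b fb] := surjL f.
  by exists b; apply/phi_eq; apply: sym2.
- by move=> f g; rewrite -phiD; apply/phi_eq.
- by move=> c f; rewrite -phiZ; apply/phi_eq.
- by split=> [f g|]; [rewrite -phiM; apply/phi_eq|rewrite -phi1; apply/phi_eq].
Qed.

Section TubeAlgebra.
Variables (k : fieldType) (K : finType) (ij : K -> nat * nat).

(** The condition k <= i < l <= j for a nonzero morphism from the tube (i,
    j) to the tube (k, l). *)
Definition tube_hom (s t : K) : bool :=
  ((ij t).1 <= (ij s).1 < (ij t).2)%N && ((ij t).2 <= (ij s).2)%N.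

(** Matrices of scalars over the tubes, of which only the entries allowed by
    [tube_hom] count. *)
Definition tmx := K -> K -> k.
Definition tmx_eq (a b : tmx) : Prop := forall s t, tube_hom s t -> a s t = b s t.
Definition tmx_add (a b : tmx) : tmx := fun s t => a s t + b s t.
Definition tmx_scale (c : k) (a : tmx) : tmx := fun s t => c * a s t.
Definition tmx_one : tmx := fun s t => (s == t)%:R.
Definition tmx_cut (a : tmx) : tmx := fun s t => if tube_hom s t then a s t else 0.

(** Only composites of existing morphisms are added up; as for maps, the
    right factor comes first. *)
Definition tmx_mul (a b : tmx) : tmx := fun s t =>
  \sum_r tmx_cut b s r * tmx_cut a r t.

(** The common description through which tilted and silted algebras are
    compared. *)
Definition isom_tubes (A : falgType k) : Prop :=
  quotient_isom A tmx_eq tmx_add tmx_mul tmx_scale tmx_one.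

End TubeAlgebra.

Section TubeModule.
Variables (k : fieldType) (H : falgType k) (n v : nat) (inc : incidence H n v).
Local Notation rl := (block_le n v).
Local Notation seg := (segment n v).
Local Notation eps := (eps inc).
Variables (T : lmodType H^c) (K : finType) (ij : K -> nat * nat).
Variable c : coords inc T (fun s => seg (ij s)).
Hypothesis vn : (v <= n)%N.
Hypothesis blk : forall s, in_blocks n v (ij s).

Lemma segE s p : seg (ij s) p = tube (ij s) p.
Proof. by have := blk s; rewrite /in_blocks /tube /segment /block_le; lia. Qed.

Let sl s : live n v (seg (ij s)).
Proof. by move=> p /andP[/block_le_reflr]. Qed.
Let sc s : convex n v (seg (ij s)).
Proof. exact: segment_convex. Qed.

Lemma tube_hom_adm s t : tube_hom ij s t -> admissible n v (seg (ij s)) (seg (ij t)).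
Proof.
rewrite /tube_hom => st p q pq; rewrite !segE.
by move: st pq; rewrite /tube /block_le; lia.
Qed.

Lemma tmx_cut_adm (a : tmx k K) s t : tmx_cut ij a s t != 0 ->
  admissible n v (seg (ij s)) (seg (ij t)).
Proof. by rewrite /tmx_cut; case: ifP => [/tube_hom_adm //|_]; rewrite eqxx. Qed.

Definition tube_end (a : tmx k K) : {linear T -> T} := matrix_map c c (@tmx_cut_adm a).

Lemma co_tube_end a x t p : co c (tube_end a x) t p =
  if seg (ij t) p then \sum_s co c x s p * tmx_cut ij a s t else 0.
Proof. exact: co_matrix_map. Qed.

Lemma tube_end_gen a s t : tube_hom ij s t ->
  co c (tube_end a (gen c s (ij s).1)) t (ij s).1 = a s t.
Proof.
move=> st; rewrite co_tube_end segE (_ : tube _ _); last by move: st;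
  rewrite /tube_hom /tube; lia.
rewrite (bigD1 s) //= [X in _ + X]big1 ?addr0 => [|r /negbTE ne].
  rewrite co_gen segE !eqxx (_ : tube _ _) ?mul1r ?/tmx_cut ?st //.
  by move: st; rewrite /tube_hom /tube; lia.
by rewrite co_gen ne andbF mul0r.
Qed.

(** An endomorphism is determined by the images of the generators of the
    segments. The generator of the segment (i, j) is killed by the matrix
    unit at (i, j), hence so is its image; when k <= i < l but j < l, this
    forces its component in the segment (k, l) to vanish. *)
Lemma tube_end_full (f : {linear T -> T}) : exists a, f =1 tube_end a.
Proof.
exists (fun s t => co c (f (gen c s (ij s).1)) t (ij s).1).
apply: (@eq_on_gen _ _ _ _ inc T T K (fun s => (ij s).1) _ c) => // [s p|s ss].
  by rewrite /= !segE => sp; have := sp; rewrite -segE => /andP[-> _]; move: sp;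
    rewrite /tube; lia.
have gg : gen c s (ij s).1 = ract (gen c s (ij s).1) (eps (ij s).1 (ij s).1).
  by rewrite ract_gen // (sl ss).
apply: (co_inj (c := c)) => t p tp.
case: (p =P (ij s).1) => [e|/eqP ne]; last by rewrite gg !linear_ract !co_eps_ne.
rewrite e; rewrite e in tp.
case: (boolP (tube_hom ij s t)) => [st|nst]; first by rewrite tube_end_gen.
have jl : ((ij s).2 < (ij t).2)%N.
  by move: nst tp; rewrite /tube_hom segE /tube; lia.
have rij : rl (ij s).1 (ij s).2.
  by have := blk s; have := blk t; move: jl tp ss;
    rewrite !segE /tube /in_blocks /block_le; lia.
have g0 : ract (gen c s (ij s).1) (eps (ij s).1 (ij s).2) = 0.
  rewrite ract_gen // rij; apply: (co_inj (c := c)) => r q _; rewrite co_gen co0.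
  by rewrite /segment ltnn andbF.
transitivity (0 : k); last first.
  rewrite co_tube_end tp (bigD1 s) //= [X in _ + X]big1 ?addr0 => [|r /negbTE ne].
    by rewrite /tmx_cut (negbTE nst) mulr0.
  by rewrite co_gen ne andbF mul0r.
have tj : seg (ij t) (ij s).2.
  by move: jl tp ss; rewrite !segE /tube; lia.
have := co_eps c (f (gen c s (ij s).1)) (ij s).1 tj.
by rewrite rij -linear_ract g0 raddf0 co0 => <-.
Qed.

Lemma isom_End_tubes (A : falgType k) : isom_tubes ij A <-> isom_End A T.
Proof.
apply: (@quotient_isom_transfer _ _ _ _ _ _ _ _ _ _ _ _ _ _ tube_end) => //.
- by move=> f g fg x; rewrite fg.
- by move=> f g h fg gh x; rewrite fg.
- by move=> f f' g g' ff gg x /=; rewrite ff gg.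
- by move=> f f' g g' ff gg x /=; rewrite ff gg.
- by move=> a f f' ff x /=; rewrite /hom_scale_fun ff.
- move=> a b; split=> [ab x|ab s t st].
    apply: (co_inj (c := c)) => t p tp; rewrite !co_tube_end tp; apply: eq_bigr => s _.
    by rewrite /tmx_cut; case: ifP => // /ab ->.
  by rewrite -(tube_end_gen a st) ab tube_end_gen.
- exact: tube_end_full.
- move=> a b x; apply: (co_inj (c := c)) => t p tp;
  rewrite coD !co_tube_end tp -big_split.
  by apply: eq_bigr => s _ /=; rewrite /tmx_cut /tmx_add; case: ifP => _;
    [rewrite mulrDr|rewrite !mulr0 addr0].
- move=> a b x; apply: (co_inj (c := c)) => t p tp; rewrite !co_tube_end tp.
  transitivity (\sum_s \sum_r co c x s p * (tmx_cut ij b s r * tmx_cut ij a r t)).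
    apply: eq_bigr => s _; rewrite -mulr_sumr.
    case: (boolP (seg (ij s) p)) => sp; last by rewrite co_out // !mul0r.
    congr (_ * _); rewrite {1}/tmx_cut; case: ifP => // st;
      rewrite /tmx_mul big1 // => r _.
    rewrite /tmx_cut; case: ifP => sr; last by rewrite mul0r.
    case: ifP => rt; last by rewrite mulr0.
    by move: st sr rt sp tp; rewrite /tube_hom !segE /tube; lia.
  rewrite exchange_big; apply: eq_bigr => r _ /=; rewrite co_tube_end.
  case: (boolP (seg (ij r) p)) => rp.
    by rewrite mulr_suml; apply: eq_bigr => s _; rewrite mulrA.
  rewrite mul0r big1 // => s _.
  case: (boolP (seg (ij s) p)) => sp; last by rewrite co_out // !mul0r.
  rewrite /tmx_cut; case: ifP => sr; last by rewrite mul0r mulr0.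
  case: ifP => rt; last by rewrite !mulr0.
  by move: rp sr rt sp tp; rewrite /tube_hom !segE /tube; lia.
- move=> a b x; apply: (co_inj (c := c)) => t p tp.
  rewrite /= /hom_scale_fun -/(ract _ _) co_scale // !co_tube_end tp mulr_sumr.
  by apply: eq_bigr => s _; rewrite /tmx_cut /tmx_scale; case: ifP => _; ring.
- move=> x; apply: (co_inj (c := c)) => t p tp; rewrite co_tube_end tp /=.
  rewrite (bigD1 t) //= [X in _ + X]big1 ?addr0 => [|s /negbTE ne].
    rewrite /tmx_cut /tmx_one eqxx (_ : tube_hom ij t t) ?mulr1 //.
    by move: tp; rewrite segE /tube /tube_hom; lia.
  by rewrite /tmx_cut /tmx_one ne if_same mulr0.
Qed.

End TubeModule.

(** * Tilting modules give tubings *)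

Section Twist.
Variables (k : fieldType) (H : falgType k) (T : lmodType H^c).
Variable delta : T -> H -> T.
Hypothesis deltaD : forall y z h, delta (y + z) h = delta y h + delta z h.
Hypothesis deltaDr : forall y h h', delta y (h + h') = delta y h + delta y h'.
Hypothesis delta1 : forall y, delta y 1 = 0.
Hypothesis deltaM : forall y h h',
  delta y (h * h') = ract (delta y h) h' + delta (ract y h) h'.

(** The set T x T, to carry the extension of T by itself with cocycle delta. *)
Definition twist & (T -> H -> T) : Type := (T * T)%type.
Local Notation tw := (twist delta).
HB.instance Definition _ := GRing.Zmodule.copy tw (T * T)%type.

Definition twist_scale (a : H^c) (x : tw) : tw :=
  (ract x.1 (a : H) + delta x.2 (a : H), ract x.2 (a : H)).

Lemma twist_scaleA (a b : H^c) (x : tw) :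
  twist_scale a (twist_scale b x) = twist_scale (a * b) x.
Proof.
apply: (congr2 pair) => /=; last by rewrite ractM.
by rewrite ractDl ractM [in RHS](deltaM x.2 (b : H) (a : H)) addrA.
Qed.

Lemma twist_scale1 (x : tw) : twist_scale 1 x = x.
Proof.
case: x => x y; apply: (congr2 pair) => /=; last exact: ract1.
by rewrite [delta _ _]delta1 addr0 [LHS]ract1.
Qed.

Lemma twist_scaleDr (a : H^c) (x y : tw) :
  twist_scale a (x + y) = twist_scale a x + twist_scale a y.
Proof.
by apply: (congr2 pair) => /=; rewrite ractDl // deltaD addrACA.
Qed.

Lemma twist_scaleDl (x : tw) (a b : H^c) :
  twist_scale (a + b) x = twist_scale a x + twist_scale b x.
Proof.
apply: (congr2 pair) => /=; rewrite [ract _ _]ractDr // [delta _ _]deltaDr.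
by rewrite addrACA.
Qed.

HB.instance Definition _ := GRing.Zmodule_isLmodule.Build H^c tw
  twist_scaleA twist_scale1 twist_scaleDr twist_scaleDl.

(** A section of the extension writes the cocycle as a coboundary. *)
Lemma twist_split : ext1_vanishes T T ->
  exists theta : T -> T, theta 0 = 0 /\
    forall y h, theta (ract y h) = ract (theta y) h + delta y h.
Proof.
have delta0 h : delta 0 h = 0.
  by apply: (addrI (delta 0 h)); rewrite -deltaD !addr0.
have incl_linear : linear ((fun x => (x, 0)) : T -> tw).
  move=> a x y; apply: (congr2 pair) => /=; last by rewrite ract0l addr0.
  by rewrite delta0 addr0.
have proj_linear : linear ((fun x => x.2) : tw -> T) by [].
move=> /(_ tw (linear_pack incl_linear) (linear_pack proj_linear))[].
  split=> [x y [//]|[x y]|y]; last by exists (0, y).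
  split=> [/= ->|[x' [_ <-]] //]; by exists x.
move=> s sK; exists (fun y => (s y).1); split; first by rewrite raddf0.
move=> y h; have sy2 : (s y).2 = y := sK y.
by rewrite linear_ract /= sy2.
Qed.

End Twist.

Section TiltingTubes.
Variables (k : fieldType) (H : falgType k) (n v : nat) (inc : incidence H n v).
Hypothesis vn : (v <= n)%N.
Local Notation rl := (block_le n v).
Local Notation seg := (segment n v).
Local Notation eps := (eps inc).
Local Notation crd := (crd inc).

Section Module.
Variables (T : lmodType H^c) (K : finType) (ij : K -> nat * nat).
Variable c : coords inc T (fun s => seg (ij s)).
Hypothesis blk : forall s, in_blocks n v (ij s).
Let segt := segE vn blk.

(** If the tubes s and t cross, the cocycle that carries the coordinate of y
    in s across the end j of s into the summand t is not a coboundary: the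
    matrix unit at (i, j) kills the generator of the segment s but the
    cocycle takes the value 1 on this pair. *)
Lemma ext1_noncrossing : ext1_vanishes T T -> noncrossing ij.
Proof.
move=> ext0 s t; apply/negP => cr.
set i := (ij s).1; set j := (ij s).2.
(* The coordinate at q in the summand s of the action of h, without the
   truncation at the end j of s. *)
pose sm (y : T) h q := \sum_(p < n.+1) co c y s p * crd h p q.
pose delta (y : T) (h : H) : T := mk c (fun r q =>
  (r == t)%:R * ((j <= q)%N%:R * sm y h q)).
have smD y z h q : sm (y + z) h q = sm y h q + sm z h q.
  by rewrite -big_split; apply: eq_bigr => p _; rewrite coD mulrDl.
have co_delta y h r q : co c (delta y h) r q =
   if seg (ij r) q then (r == t)%:R * ((j <= q)%N%:R * sm y h q) else 0 by rewrite
     co_mk.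
have [||||theta [theta0 thetaM]] := @twist_split _ _ _ delta _ _ _ _ ext0.
- move=> y z h; apply: (co_inj (c := c)) => r q rq; rewrite coD !co_delta rq smD; ring.
- move=> y h h'; apply: (co_inj (c := c)) => r q rq; rewrite coD !co_delta rq.
  have -> : sm y (h + h') q = sm y h q + sm y h' q.
    by rewrite -big_split; apply: eq_bigr => p _; rewrite crdD mulrDr.
  by ring.
- move=> y; apply: (co_inj (c := c)) => r q rq; rewrite co0 co_delta rq.
  case: leqP => jq; last by rewrite mul0r mulr0.
  rewrite [sm _ _ _]big1 ?mulr0 // => p _; rewrite crd1.
  case: (nat_of_ord p =P q) => [->|_]; last by rewrite andbF mulr0.
  by rewrite co_out ?mul0r // segt /tube; move: jq; rewrite /j; lia.
- move=> y h h'; apply: (co_inj (c := c)) => r q rq; rewrite coD coA // !co_delta rq.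
  under eq_bigr => w _ do rewrite co_delta.
  case: (r =P t) => [e|_]; last first.
    rewrite !mul0r addr0 big1 // => w _; rewrite mul0r; case: ifP; by rewrite mul0r.
  rewrite {r}e in rq *; rewrite !mul1r.
  case: (leqP j q) => jq; last first.
    rewrite !mul0r addr0 big1 // => w _.
    case: (leqP j w) => jw; last by rewrite mulr0n mul0r mulr0 if_same mul0r.
    by rewrite crd_out ?mulr0 // /block_le; lia.
  rewrite !mul1r /sm -big_split /=.
  under eq_bigr do rewrite crdM mulr_sumr.
  rewrite exchange_big; apply: eq_bigr => w _ /=.
  transitivity (sm y h w * crd h' w q).
    by rewrite mulr_suml; apply: eq_bigr => p _; rewrite mulrA.
  rewrite -/(sm y h w) mul1r.
  case: (boolP (rl w q)) => wq; last by rewrite !(crd_out inc h' wq) !mulr0 addr0.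
  have [sm0|[p iw]] : sm y h w = 0 \/ exists p, tube (ij s) p && rl p w.
    case: (classic (exists p, tube (ij s) p && rl p w)); first by right.
    move=> nex; left; apply: big1 => p _.
    case: (boolP (tube (ij s) p)) => sp; last by rewrite co_out ?mul0r // segt.
    rewrite crd_out ?mulr0 //; apply/negP => pw; apply: nex; exists p.
    by rewrite sp pw.
  - rewrite sm0 !mul0r !mulr0 if_same mul0r add0r.
    case: (boolP (seg (ij s) w)) => sw; last by rewrite co_out ?mul0r.
    by rewrite coA // -/(sm y h w) sm0 mul0r.
  - rewrite !segt; case: (boolP (tube (ij s) w)) => sw.
      rewrite (_ : (j <= w)%N = false); last by move: sw; rewrite /tube /j; lia.
      rewrite mul0r if_same mul0r add0r coA ?segt //.
    rewrite (_ : tube (ij t) w); last first.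
      by move: rq cr iw sw wq; rewrite segt /tube /crossing /block_le; lia.
    rewrite (_ : (j <= w)%N); last first.
      by move: rq cr iw sw wq; rewrite segt /tube /crossing /block_le /j; lia.
    by rewrite !mul1r [co c _ s w]co_out ?segt // mul0r addr0.
have tj : seg (ij t) j by move: cr; rewrite segt /crossing /tube /j; lia.
have si : seg (ij s) i by move: cr; rewrite segt /crossing /tube /i; lia.
have rij : rl i j.
  have := blk s; have := blk t; move: cr.
  by rewrite /crossing /in_blocks /block_le /i /j; lia.
have := thetaM (gen c s i) (eps i j).
have -> : ract (gen c s i) (eps i j) = 0.
  rewrite ract_gen //.
  + rewrite rij; apply: (co_inj (c := c)) => r q _; rewrite co_gen co0.
    by rewrite segt /tube ltnn andbF.
  + exact: segment_convex.
  + exact: segment_live.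
move/(congr1 (fun x => co c x t j)); rewrite theta0 co0 coD co_eps // rij co_delta tj.
rewrite [co c _ t i]co_out; last by rewrite segt; move: cr;
  rewrite /crossing /tube /i; lia.
rewrite eqxx leqnn !mul1r add0r /sm.
rewrite (@sum_point _ n (fun p => co c (gen c s i) s p * crd (eps i j) p j) i).
- by rewrite co_gen crd_eps si rij !eqxx mul1r => /eqP; rewrite eq_sym oner_eq0.
- by have := block_le_bound rij; lia.
- by move=> p /negbTE ne; rewrite co_gen ne !andbF mul0r.
Qed.

End Module.

(** When e' = e e' f, multiplication by e' is a bijection from M e to M f. *)
Definition bij_mul (e e' f : H) (M : lmodType H^c) : Prop :=
  (forall x : M, ract x e' = 0 -> ract x e = 0) /\
  (forall y : M, exists x : M, ract y f = ract x e').

Lemma bij_mul_add e e' f (T T' : lmodType H^c) :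
  bij_mul e e' f T -> in_add T T' -> bij_mul e e' f T'.
Proof.
move=> [injT surjT] [m [i [p ip]]]; split=> [x x0|y].
  apply: (can_inj ip); rewrite linear_ract raddf0; apply/ffunP => a; rewrite !ffunE.
  apply: injT; have : ract (i x) e' = 0 by rewrite -linear_ract x0 raddf0.
  by move/ffunP/(_ a); rewrite !ffunE.
have ch a : {x | ract (i y a) f = ract x e'} by apply:
  constructive_indefinite_description.
exists (p [ffun a => sval (ch a)]); rewrite -{1}(ip y) -!linear_ract; congr (p _).
by apply/ffunP => a; rewrite linear_ract; have := svalP (ch a); rewrite /ract !ffunE.
Qed.

(** Diagram chase: surjectivity passes to the kernel of T0 -> T1 because
    multiplication by e' is injective on T1. *)
Lemma bij_mul_kernel e e' f (M T0 T1 : lmodType H^c) (F : {linear M -> T0})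
    (G : {linear T0 -> T1}) : e * e' = e' -> short_exact F G ->
  bij_mul e e' f T0 -> bij_mul e e' f T1 ->
  forall y : M, exists x : M, ract y f = ract x e'.
Proof.
move=> ee [F_inj ker_G _] [_ surj0] [inj1 _] y.
have [x xE] := surj0 (F y).
have : ract (G x) e = 0.
  apply: inj1; rewrite -linear_ract -xE -linear_ract.
  by apply/ker_G; exists (ract y f).
rewrite -linear_ract => /ker_G[x' x'E]; exists x'; apply: F_inj.
by rewrite !linear_ract xE x'E ractM ee.
Qed.

(** If p < q are in the same tubes, the matrix unit e' at (p, q) is
    bijective from T e_p to T e_q, hence surjective from H e_p to H e_q by
    the coresolution of H; but e_q is not in H e'. If p and q are not
    related, one of them is not v and is in no tube, so that its idempotent
    kills T and hence H; this is the case e = e' = 0. *)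
Lemma tilting_separating (T : lmodType H^c) (K : finType) (ij : K -> nat * nat)
    (c : coords inc T (fun s => seg (ij s))) :
  (forall s, in_blocks n v (ij s)) -> tilting T -> separating n ij.
Proof.
move=> blk [_ _ _ [T0 [T1 [F [G [addT0 addT1 FG]]]]]] p q pq.
apply: NNPP => nsep.
have same s : tube (ij s) p = tube (ij s) q.
  by apply/eqP; apply: contraT => ne; case: nsep; exists s.
have perp e e' f : e * e' = e' -> bij_mul e e' f T -> exists h, f = h * e'.
  move=> ee bT.
  have [x xE] := bij_mul_kernel ee FG (bij_mul_add bT addT0) (bij_mul_add bT addT1)
     (1 : H).
  by exists x; rewrite -[LHS]mul1r.
case: (boolP (rl p q)) => rpq.
  have [||h hE] := perp (eps p p) (eps p q) (eps q q).
  - by rewrite epsM // (block_le_refll rpq).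
  - split=> [x x0|y].
      apply: (co_inj (c := c)) => s w sw; rewrite co0.
      case: (w =P p) sw => [->|/eqP ne] sw; last by rewrite co_eps_ne.
      have sq : seg (ij s) q by move: sw; rewrite !(segE vn blk) same.
      rewrite co_eps // (block_le_refll rpq).
      by have := co_eps c x p sq; rewrite x0 rpq co0.
    exists (mk c (fun s w => if w == p then co c y s q else 0)).
    apply: (co_inj (c := c)) => s w sw.
    case: (w =P q) sw => [->|/eqP ne] sw; last by rewrite !co_eps_ne.
    rewrite !co_eps // rpq (block_le_reflr rpq) co_mk eqxx.
    by move: sw; rewrite !(segE vn blk) same => ->.
  have := congr1 (fun h => crd h q q) hE.
  rewrite crd_eps eps_mulr (block_le_reflr rpq) rpq !eqxx /= crd_out.
    by move/eqP; rewrite oner_eq0.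
  by move: pq; rewrite /block_le; lia.
have out s w : tube (ij s) w -> (w == p) || (w == q) -> False.
  move=> sw wpq; have := same s; have := blk s; move: sw wpq rpq.
  by rewrite /tube /in_blocks /block_le; lia.
have kill w : rl w w -> (w == p) || (w == q) -> False.
  move=> rw wpq; have [||h] := perp 0 0 (eps w w).
  - by rewrite mul0r.
  - split=> [x _|y]; first by rewrite ract0r.
    exists 0; rewrite ract0l; apply: (co_inj (c := c)) => s r sr; rewrite co0.
    case: (r =P w) sr => [->|/eqP ne] sr; last by rewrite co_eps_ne.
    by case: (out s w) => //; rewrite -(segE vn blk).
  rewrite mulr0 => /(congr1 (fun h => crd h w w)); rewrite crd_eps crd0 rw !eqxx.
  by move/eqP; rewrite oner_eq0.
case: (p =P v) => [pv|/eqP pv].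
  by apply: (kill q); rewrite ?eqxx ?orbT //; move: pq; rewrite /block_le; lia.
by apply: (kill p); rewrite ?eqxx //; move: pq pv; rewrite /block_le; lia.
Qed.

Theorem tilted_tubing (A : falgType k) : tilted H A ->
  exists (K : finType) (ij : K -> nat * nat), tubing n v ij /\ isom_tubes ij A.
Proof.
case=> T [tT endT]; have [fgT _ extT _] := tT.
have [K [ij [c ok]]] := segment_coords inc vn fgT; exists K, ij.
have blk s : in_blocks n v (ij s).
  by have := ok s; rewrite /seg_ok /in_blocks /block_le /block_end; case: ifP; lia.
split; last by apply/(isom_End_tubes c vn blk).
split=> //; last exact: (tilting_separating c blk tT).
exact: (ext1_noncrossing c blk extT).
Qed.

End TiltingTubes.

(** * Tubings give tilting modules *)

Lemma descend (R : nzRingType) (M N E : lmodType R) (g : {linear M -> N})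
    (h : {linear M -> E}) : surj g -> (forall x, g x = 0 -> h x = 0) ->
  exists h' : {linear N -> E}, forall x, h' (g x) = h x.
Proof.
move=> g_surj ker.
have ch y : {x | g x = y} by apply: constructive_indefinite_description.
have key x : h (sval (ch (g x))) = h x.
  case: (ch (g x)) => x' /= gx; apply/eqP; rewrite -subr_eq0 -raddfB.
  by apply/eqP/ker; rewrite raddfB /= gx subrr.
have lin : linear (fun y => h (sval (ch y))).
  move=> a y z; rewrite -(svalP (ch y)) -(svalP (ch z)) /= -linearP !key.
  by rewrite linearP.
by exists (linear_pack lin).
Qed.

Lemma in_add_family (R : nzRingType) (T T' : lmodType R) (I : finType)
    (a : I -> {linear T' -> T}) (b : I -> {linear T -> T'}) :
  (forall x, \sum_r b r (a r x) = x) -> in_add T T'.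
Proof.
move=> ab.
have la : linear (fun x => [ffun i : 'I_#|I| => a (enum_val i) x] :
  {ffun 'I_#|I| -> T}).
  by move=> c x y; apply/ffunP => i; rewrite !ffunE linearP.
have lb : linear (fun f : {ffun 'I_#|I| -> T} => \sum_i b (enum_val i) (f i)).
  move=> c x y; rewrite scaler_sumr -big_split; apply: eq_bigr => i _ /=.
  by rewrite !ffunE linearP.
exists #|I|, (linear_pack la), (linear_pack lb) => x /=.
rewrite -[RHS]ab (reindex (fun i : 'I_#|I| => enum_val i)) /=.
  by apply: eq_bigr => i _; rewrite ffunE.
by exists (@enum_rank _) => i _; rewrite ?enum_valK ?enum_rankK.
Qed.

Section Modules.
Variables (k : fieldType) (H : falgType k) (n v : nat) (inc : incidence H n v).
Hypothesis vn : (v <= n)%N.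
Local Notation rl := (block_le n v).
Local Notation seg := (segment n v).
Local Notation eps := (eps inc).
Local Notation crd := (crd inc).

Lemma coords_fin_gen (M : lmodType H^c) (I : finType) (X : I -> nat -> bool)
   (c : coords inc M X) : (forall s, live n v (X s)) -> fin_gen M.
Proof.
move=> lX; pose J := (I * 'I_n.+1)%type.
pose m (j : J) := gen c j.1 (val j.2).
have lin : linear (fun f : {ffun 'I_#|{: J}| -> (H^c)^o} =>
    \sum_a ract (m (enum_val a)) (f a : H)).
  move=> h f g; rewrite scaler_sumr -big_split; apply: eq_bigr => a _ /=.
  rewrite !ffunE ractDr; congr (_ + _).
  by rewrite -[RHS]/(ract (ract _ _) (h : H)) ractM.
exists #|{: J}|, (linear_pack lin) => x.
exists [ffun a => (co c x (enum_val a).1 (val (enum_val a).2))%:A : (H^c)^o].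
rewrite /= [RHS](gen_expand c lX x) pair_bigA /=.
rewrite [RHS](reindex (fun a : 'I_#|{: J}| => enum_val a)) /=.
  by apply: eq_bigr => a _; rewrite ffunE.
by exists (@enum_rank _) => i _; rewrite ?enum_valK ?enum_rankK.
Qed.

Section Projective.
Variables (M : lmodType H^c) (I : finType) (tau : I -> nat).
Variable c : coords inc M (fun s => rl (tau s)).

Lemma eq_on_proj (N : lmodType H^c) (f g : {linear M -> N}) :
  (forall s, rl (tau s) (tau s) -> f (gen c s (tau s)) = g (gen c s (tau s))) -> f =1 g.
Proof.
apply: (@eq_on_gen _ _ _ _ inc M N I tau _ c) => s.
- exact: proj_convex.
- exact: proj_live.
- by move=> p sp; rewrite (block_le_refll sp).
Qed.

Lemma coords_projective : projective M.
Proof.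
move=> M' N g f g_surj.
have ch s : {y | g y = f (gen c s (tau s))} by apply:
  constructive_indefinite_description.
pose m s := ract (sval (ch s)) (eps (tau s) (tau s)).
have mt s : ract (m s) (eps (tau s) (tau s)) = m s.
  rewrite ractM; case: (boolP (rl (tau s) (tau s))) => ts; first by rewrite epsM.
  by rewrite /m !eps_out ?mul0r.
exists (ext c mt) => x; apply: (eq_on_proj (f := g \o ext c mt)) => s ts.
rewrite -[LHS]/(g (ext c mt (gen c s (tau s)))).
rewrite ext_gen // /m linear_ract (svalP (ch s)) -linear_ract ract_gen ?ts //.
  exact: proj_convex.
exact: proj_live.
Qed.

Lemma coords_fg_projective : fg_projective M.
Proof.
split; last exact: coords_projective.
by apply: (coords_fin_gen c) => s; apply: proj_live.
Qed.
End Projective.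

Section Diag.
Variables (M N : lmodType H^c) (I : finType) (X Y : I -> nat -> bool).
Variables (c : coords inc M X) (c' : coords inc N Y).
Hypothesis aXY : forall s, admissible n v (X s) (Y s).

Definition diag_map_fun (s t : I) : k := (s == t)%:R.
Lemma diag_map_admissible s t : diag_map_fun s t != 0 -> admissible n v (X s) (Y t).
Proof. by rewrite /diag_map_fun; case: (s =P t) => [<- _|_];
  [apply: aXY|rewrite eqxx]. Qed.

(** The map with identity matrix between modules with a common index set of
    summands. *)
Definition diag_map : {linear M -> N} := matrix_map c c' diag_map_admissible.
Lemma co_diag_map x s p : co c' (diag_map x) s p = if Y s p then co c x s p else 0.
Proof. by rewrite co_matrix_map; case: ifP => // _; rewrite /diag_map_fun sum_delta.
  Qed.
End Diag.

Section TubeTilting.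
Variables (K : finType) (ij : K -> nat * nat).
Hypothesis blk : forall s, in_blocks n v (ij s).
Let P1 := fmod_of (proj_shape n v (fun s => (ij s).2)) inc.
Let P0 := fmod_of (proj_shape n v (fun s => (ij s).1)) inc.
Let T := fmod_of (seg_shape n v ij) inc.
Let c1 : coords inc P1 (fun s => rl (ij s).2) :=
  fmod_coord inc (proj_shape n v (fun s => (ij s).2)).
Let c0 : coords inc P0 (fun s => rl (ij s).1) :=
  fmod_coord inc (proj_shape n v (fun s => (ij s).1)).
Let c : coords inc T (fun s => seg (ij s)) := fmod_coord inc (seg_shape n v ij).

Lemma incl_adm s : admissible n v (rl (ij s).2) (rl (ij s).1).
Proof. by have := blk s; move=> b p q; move: b; rewrite /in_blocks /block_le; lia. Qed.
Lemma quot_adm s : admissible n v (rl (ij s).1) (seg (ij s)).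
Proof. by move=> p q; rewrite /segment /block_le; lia. Qed.

Definition tube_incl : {linear P1 -> P0} := diag_map c1 c0 incl_adm.
Definition tube_quot : {linear P0 -> T} := diag_map c0 c quot_adm.

Lemma tube_incl_quot_exact : short_exact tube_incl tube_quot.
Proof.
split=> [x y xy|y|y].
- apply: (co_inj (c := c1)) => s p sp.
  have := congr1 (fun z => co c0 z s p) xy; rewrite !(co_diag_map c1 c0).
  case: ifP => // /negP[]; have := blk s; move: sp => /=.
  by rewrite /in_blocks /block_le; lia.
- split=> [y0|[x <-]].
    exists (mk c1 (co c0 y)); apply: (co_inj (c := c0)) => s p sp.
    rewrite (co_diag_map c1 c0) sp co_mk; case: ifP => // /negbT np.
    have := congr1 (fun z => co c z s p) y0; rewrite (co_diag_map c0 c) co0.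
    case: ifP => // /negP[]; have := blk s; move: sp np => /=.
    by rewrite /segment /in_blocks /block_le; lia.
  apply: (co_inj (c := c)) => s p sp; rewrite (co_diag_map c0 c) sp co0
    (co_diag_map c1 c0).
  case: ifP => // _; rewrite co_out //=; move: sp; rewrite /segment /block_le; lia.
- exists (mk c0 (co c y)); apply: (co_inj (c := c)) => s p sp.
  by rewrite (co_diag_map c0 c) sp co_mk; case: ifP => // /negP[]; case/andP: sp.
Qed.

Lemma tube_proj_dim : proj_dim_le1 T.
Proof.
exists P1, P0, tube_incl, tube_quot; split; last exact: tube_incl_quot_exact.
  exact: (coords_projective c1).
exact: (coords_projective c0).
Qed.

Hypothesis nc : noncrossing ij.

(** The generator of the tube (i, j) lifts to an element e0 of the
    extension, and e0 e_(i, j) comes from an element of T e_j. Since no tube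
    crosses (i, j), every tube containing j contains i, so that this element
    is divisible by e_(i, j) and the lift can be corrected to be killed by
    it. *)
Lemma tube_ext1 : ext1_vanishes T T.
Proof.
move=> E f g [f_inj ker_g g_surj].
have lift s : exists m : E, [/\ ract m (eps (ij s).1 (ij s).1) = m,
    g m = tube_quot (gen c0 s (ij s).1) &
    rl (ij s).1 (ij s).2 -> ract m (eps (ij s).1 (ij s).2) = 0].
  case: (boolP (rl (ij s).1 (ij s).1)) => rs; last first.
    exists 0; split; rewrite ?ract0l // raddf0 (_ : gen _ _ _ = 0) ?raddf0 //.
    apply: (co_inj (c := c0)) => r p _; rewrite co_gen co0 /= (negbTE rs) //.
  have g0i : ract (gen c0 s (ij s).1) (eps (ij s).1 (ij s).1) = gen c0 s (ij s).1.
    rewrite ract_gen ?rs //; first exact: proj_convex.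
    exact: proj_live.
  have [e0 ge0] := g_surj (tube_quot (gen c0 s (ij s).1)).
  set i := (ij s).1 in rs g0i ge0 *; set j := (ij s).2.
  case: (boolP (rl i j)) => rij; last first.
    exists (ract e0 (eps i i)); split=> //; first by rewrite ractM epsM.
    by rewrite linear_ract ge0 -linear_ract g0i.
  have : g (ract e0 (eps i j)) = 0.
    rewrite linear_ract ge0; apply: (co_inj (c := c)) => r p rp; rewrite co0.
    case: (p =P j) rp => [->|/eqP ne] rp; last by rewrite co_eps_ne.
    rewrite co_eps // rij (co_diag_map c0 c); case: ifP => // _.
    rewrite co_gen; case: (r =P s) rp => [->|]; last by rewrite andbF.
    by rewrite /segment ltnn andbF.
  move=> /ker_g[x fx].
  (* The element with z e_(i, j) = x e_j. *)
  pose z := mk c (fun r p => if p == i then co c x r j else 0).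
  have zx : ract z (eps i j) = ract x (eps j j).
    apply: (co_inj (c := c)) => r p rp.
    case: (p =P j) rp => [->|/eqP ne] rp; last by rewrite !co_eps_ne.
    rewrite !co_eps // rij (block_le_reflr rij) co_mk eqxx (_ : seg _ _) //.
    have := nc s r; have := blk r; move: rp rij rs; rewrite (segE vn blk).
    by rewrite /segment /crossing /tube /in_blocks /block_le -/i -/j; lia.
  exists (ract e0 (eps i i) - f (ract z (eps i i))); split.
  - by rewrite ractBl -!linear_ract !ractM epsM.
  - rewrite raddfB /= linear_ract ge0 -linear_ract g0i (_ : g (f _) = 0) ?subr0 //.
    by apply/ker_g; eexists.
  - move=> _; rewrite ractBl -linear_ract !ractM epsM // zx linear_ract fx ractM.
    by rewrite epsM ?subrr // (block_le_reflr rij).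
have ch s := constructive_indefinite_description _ (lift s).
pose m s := sval (ch s).
have mt s : ract (m s) (eps (ij s).1 (ij s).1) = m s by case: (svalP (ch s)).
have mg s : g (m s) = tube_quot (gen c0 s (ij s).1) by case: (svalP (ch s)).
have mj s : rl (ij s).1 (ij s).2 -> ract (m s) (eps (ij s).1 (ij s).2) = 0.
  by case: (svalP (ch s)).
have [inc_inj ker_quot quot_surj] := tube_incl_quot_exact.
have [|h hE] := @descend _ _ _ _ tube_quot (ext c0 mt) quot_surj.
  move=> x /ker_quot[y <-].
  apply: (eq_on_proj (c := c1) (f := ext c0 mt \o tube_incl) (g := \0)) => s rs.
  rewrite -[LHS]/(ext c0 mt (tube_incl (gen c1 s (ij s).2))).
  have rij : rl (ij s).1 (ij s).2.
    by have := blk s; move: rs; rewrite /in_blocks /block_le; lia.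
  have -> : tube_incl (gen c1 s (ij s).2) =
      ract (gen c0 s (ij s).1) (eps (ij s).1 (ij s).2).
    apply: (co_inj (c := c0)) => r p rp; rewrite (co_diag_map c1 c0) rp co_gen.
    case: (p =P (ij s).2) rp => [->|/eqP ne] rp; last by rewrite co_eps_ne // !andbF.
    by rewrite co_eps // rij co_gen rs (block_le_refll rij) !eqxx !andbT.
  by rewrite linear_ract ext_gen ?mj // (block_le_refll rij).
exists h => y; have [x <-] := quot_surj y; rewrite hE.
apply: (eq_on_proj (c := c0) (f := g \o ext c0 mt)) => s rs.
rewrite -[LHS]/(g (ext c0 mt (gen c0 s (ij s).1))).
by rewrite ext_gen // mg.
Qed.

End TubeTilting.
End Modules.

Section Coresolution.
Variables (k : fieldType) (H : falgType k) (n v : nat) (inc : incidence H n v).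
Hypothesis vn : (v <= n)%N.
Local Notation rl := (block_le n v).
Local Notation seg := (segment n v).
Local Notation eps := (eps inc).
Local Notation crd := (crd inc).

Definition reg_co (x : (H^c)^o) (s : 'I_n.+1) (q : nat) : k := crd (x : H) s q.
Definition reg_mk (F : 'I_n.+1 -> nat -> k) : (H^c)^o :=
  elt inc (fun p q => F (inord p) q).

Lemma reg_coords : exists c : coords inc ((H^c)^o : lmodType H^c)
    (fun s : 'I_n.+1 => rl s), True.
Proof.
unshelve eexists; last by [].
exists reg_co reg_mk; rewrite /reg_co.
- by move=> x y s p; rewrite crdD.
- by move=> x h s q rq; rewrite (_ : ract x h = ((x : H) * h : H)) // crdM.
- by move=> x s p; apply: crd_out.
- by move=> F s p /=; rewrite crd_elt inord_val.
- move=> x y xy; apply: (crd_inj (i := inc)) => p q.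
  case: (boolP (rl p q)) => pq; last by rewrite !crd_out.
  have /andP[lp _] := block_le_bound pq.
  exact: (xy (Ordinal lp) q).
Qed.

Variables (K : finType) (ij : K -> nat * nat).
Hypothesis tb : tubing n v ij.
Let blk : forall s, in_blocks n v (ij s) := let: And3 b _ _ := tb in b.
Let nc : noncrossing ij := let: And3 _ b _ := tb in b.
Let sep : separating n ij := let: And3 _ _ b := tb in b.
Let T := fmod_of (seg_shape n v ij) inc.
Let c : coords inc T (fun s => seg (ij s)) := fmod_coord inc (seg_shape n v ij).

Definition tube_or_empty (p : nat * nat) : bool := tube0 (tubes ij) p.1 p.2.

Lemma tubes_in_add (I : finType) (d : I -> nat * nat) :
  (forall r, tube_or_empty (d r)) -> in_add T (fmod_of (seg_shape n v d) inc).
Proof.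
move=> dT; set T' := fmod_of _ _.
pose c' : coords inc T' (fun r => seg (d r)) := fmod_coord inc (seg_shape n v d).
have ch r : {o : option K | if o is Some s then ij s = d r else (d r).1 = (d r).2}.
  apply: constructive_indefinite_description; have := dT r.
  rewrite /tube_or_empty /tube0 => /orP[/eqP e|/tubesP[s es]]; first by exists None.
  by exists (Some s); rewrite es -surjective_pairing.
pose sl r : option K := sval (ch r).
have slE r s : sl r = Some s -> ij s = d r by rewrite /sl; case: (ch r) => o /= + e;
  rewrite e.
have slN r : sl r = None -> (d r).1 = (d r).2 by rewrite /sl;
  case: (ch r) => o /= + e; rewrite e.
pose A r r' s : k := ((r' == r) && (sl r == Some s))%:R.
pose B r s r' : k := ((r' == r) && (sl r == Some s))%:R.
have adm1 w : admissible n v (seg w) (seg w) by move=> p q;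
  rewrite /segment /block_le; lia.
have admA r r' s : A r r' s != 0 -> admissible n v (seg (d r')) (seg (ij s)).
  rewrite /A; case: (r' =P r) => [->|_] /=; last by rewrite eqxx.
  by case: (sl r =P Some s) => [/slE -> _|_]; [apply: adm1|rewrite eqxx].
have admB r s r' : B r s r' != 0 -> admissible n v (seg (ij s)) (seg (d r')).
  rewrite /B; case: (r' =P r) => [->|_] /=; last by rewrite eqxx.
  by case: (sl r =P Some s) => [/slE -> _|_]; [apply: adm1|rewrite eqxx].
apply: (@in_add_family _ T T' I (fun r => matrix_map c' c (@admA r))
  (fun r => matrix_map c c' (@admB r))).
move=> x; apply: (co_inj (c := c')) => r p rp; rewrite co_sum (bigD1 r) //=.
rewrite [X in _ + X]big1 ?addr0 => [|r' /negbTE ne]; last first.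
  rewrite co_matrix_map rp big1 // => s _.
  by rewrite /B eq_sym ne mulr0.
rewrite co_matrix_map rp.
case es: (sl r) => [s|]; last by move: rp; rewrite /segment (slN _ es) /block_le; lia.
rewrite (bigD1 s) //= [X in _ + X]big1 ?addr0 => [|t /negbTE ne]; last first.
  by rewrite /B es eqxx -[Some s == _]/(s == t) eq_sym ne mulr0.
rewrite co_matrix_map (slE _ _ es) rp /B es !eqxx mulr1.
rewrite (bigD1 r) //= [X in _ + X]big1 ?addr0 => [|t /negbTE ne]; last first.
  by rewrite /A ne mulr0.
by rewrite /A es !eqxx mulr1.
Qed.

(** The chain of tubes of [tube_chain] from the block of i down to i; for
    the dead point v it consists of empty intervals. Its length is at most n
    + 1. *)
Lemma point_chain (i : 'I_n.+1) : exists d : nat -> nat * nat,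
  [/\ i != v :> nat -> d 0%N = (if (i < v)%N then 0%N else v.+1,
    if (i < v)%N then v else n.+1),
      forall m, tube_or_empty (d m) && tube_or_empty ((d m).1, (d m.+1).2),
      forall m, ((d m).1 <= (d m.+1).1 <= i)%N && (i <= (d m.+1).2 <= (d m).2)%N,
      ((d 0%N).2 <= n.+1)%N
    & forall m, (n < m)%N -> d m = (i : nat, i : nat)].
Proof.
have lei : (i <= n)%N by rewrite -ltnS.
case: (nat_of_ord i =P v) => [iv|/eqP iv].
  exists (fun=> (v, v)); rewrite iv /tube_or_empty /tube0 /=; split=> // *;
    rewrite ?eqxx ?leqnn //.
  exact: leqW.
have [||d [d0 d1 d2 d3 d4]] := tube_chain (i := i) _ (tubes_nc nc) (tubes_sep sep)
  (tubing_block tb vn lei iv).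
- by move=> a b /tubesP[s es]; have := blk s; rewrite es /in_blocks /=; lia.
- by case: ifP; lia.
exists d; split=> // [m||m nm].
- by rewrite d2 d3.
- by rewrite d0 /=; case: ifP => //; lia.
- by apply: d4; case: ifP => _; lia.
Qed.

(** For a point i with chain of tubes (k_0, l_0), (k_1, l_1), ... descending
    to i, the projective P_i is the kernel of the surjective map from the
    sum of the segments (k_m, l_m) to the sum of the segments (k_m, l_(m +
    1)) that sends y to the differences y_m - y_(m + 1): the first tube
    contains all points of the block from i on. The chains are padded with
    empty intervals to the common length n + 1. *)
Lemma tube_coresolution : exists (T0 T1 : lmodType H^c)
    (f : {linear (H^c)^o -> T0}) (g : {linear T0 -> T1}),
  [/\ in_add T T0, in_add T T1 & short_exact f g].
Proof.
have [cR _] := reg_coords.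
have ch i := constructive_indefinite_description _ (point_chain i).
pose d i : nat -> nat * nat := sval (ch i).
have d0 (i : 'I_n.+1) : i != v :> nat -> d i 0%N =
  (if (i < v)%N then 0%N else v.+1, if (i < v)%N then v else n.+1).
  by case: (svalP (ch i)).
have d1 i m : tube_or_empty (d i m) by case: (svalP (ch i)) => _ /(_ m)/andP[].
have d1' i m : tube_or_empty ((d i m).1, (d i m.+1).2).
  by case: (svalP (ch i)) => _ /(_ m)/andP[].
have d2 i m : ((d i m).1 <= (d i m.+1).1)%N by case: (svalP (ch i)) => _ _ /(_ m);
  rewrite /d; lia.
have d2' (i : 'I_n.+1) m : ((d i m).1 <= i)%N.
  by case: (svalP (ch i)) => _ _ /(_ m); rewrite /d; lia.
have d3 i m : ((d i m.+1).2 <= (d i m).2)%N by case: (svalP (ch i)) => _ _ /(_ m);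
  rewrite /d; lia.
have d3' (i : 'I_n.+1) m : (i <= (d i m.+1).2)%N.
  by case: (svalP (ch i)) => _ _ /(_ m); rewrite /d; lia.
have d5 i m : ((d i m).2 <= n.+1)%N.
  elim: m => [|m IHm]; first by case: (svalP (ch i)).
  exact: leq_trans (d3 i m) IHm.
have d4 (i : 'I_n.+1) m : (n < m)%N -> d i m = (i : nat, i : nat).
  by case: (svalP (ch i)) => _ _ _ _; apply.
have toe_blk p : tube_or_empty p -> (p.2 <= n.+1)%N -> in_blocks n v p.
  rewrite /tube_or_empty /tube0 => /orP[/eqP e|/tubesP[s es]] pn.
    by rewrite /in_blocks e leqnn pn /= andbT; lia.
  by rewrite [p]surjective_pairing -es.
pose I := ('I_n.+1 * 'I_n.+1)%type.
(* Indices are pairs of a point and a place in its chain. *)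
pose e0 (r : I) := d r.1 (val r.2).
pose e1 (r : I) := ((d r.1 (val r.2)).1, (d r.1 (val r.2).+1).2).
have b0 r : in_blocks n v (e0 r) by apply: toe_blk; [apply: d1|apply: d5].
have b1 r : in_blocks n v (e1 r) by apply: toe_blk; [apply: d1'|apply: d5].
pose T0 := fmod_of (seg_shape n v e0) inc; pose T1 := fmod_of (seg_shape n v e1) inc.
pose c0 : coords inc T0 (fun r => seg (e0 r)) := fmod_coord inc (seg_shape n v e0).
pose c1 : coords inc T1 (fun r => seg (e1 r)) := fmod_coord inc (seg_shape n v e1).
have s0 r p : seg (e0 r) p = tube (e0 r) p by apply: segE.
have s1 r p : seg (e1 r) p = tube (e1 r) p by apply: segE.
pose A (i : 'I_n.+1) (r : I) : k := (i == r.1)%:R.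
have admA i r : A i r != 0 -> admissible n v (rl i) (seg (e0 r)).
  rewrite /A; case: (i =P r.1) => [->|_]; last by rewrite eqxx.
  move=> _ p q pq ip sq; rewrite (block_le_trans ip pq) s0; move: sq pq ip.
  have := d2' r.1 (val r.2).
  by rewrite s0 /tube /block_le /e0; lia.
pose B (r r' : I) : k := (r.1 == r'.1)%:R * ((val r.2 == val r'.2)%:R -
  (val r.2 == (val r'.2).+1)%:R).
have admB r r' : B r r' != 0 -> admissible n v (seg (e0 r)) (seg (e1 r')).
  rewrite /B; case: (r.1 =P r'.1) => [e|_]; last by rewrite mul0r eqxx.
  move=> nz p q pq; rewrite !s0 !s1.
  have [em|em] : val r.2 = val r'.2 \/ val r.2 = (val r'.2).+1.
    case: (val r.2 =P val r'.2) nz => [-> _|_]; first by left.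
    case: (val r.2 =P (val r'.2).+1) => [-> _|_]; first by right.
    by rewrite subrr mulr0 eqxx.
  - have := d3 r'.1 (val r'.2); rewrite /tube /e0 /e1 e em /= => ?.
    by move: pq; rewrite /block_le; lia.
  - have := d3 r'.1 (val r'.2); have := d2 r'.1 (val r'.2);
    rewrite /tube /e0 /e1 e em /= => ? ?.
    by move: pq; rewrite /block_le; lia.
pose f : {linear _ -> T0} := matrix_map cR c0 admA.
pose g : {linear T0 -> T1} := matrix_map c0 c1 admB.
(* The coordinate of index (i, m), zero beyond the last m. *)
pose y' (y : T0) i m p := if insub m is Some m' then co c0 y (i, m') p else 0.
have coF x r p : co c0 (f x) r p = if tube (e0 r) p then co cR x r.1 p else 0.
  rewrite co_matrix_map s0; case: ifP => // _; exact: sum_delta.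
have coG y r p : co c1 (g y) r p =
    if tube (e1 r) p then y' y r.1 (val r.2) p - y' y r.1 (val r.2).+1 p else 0.
  rewrite co_matrix_map s1; case: ifP => // _.
  transitivity (\sum_(i < n.+1) \sum_(m < n.+1) co c0 y (i, m) p * B (i, m) r).
    by rewrite pair_bigA; apply: eq_bigr => -[].
  rewrite (bigD1 r.1) //=.
  rewrite [X in _ + X]big1 ?addr0 => [|i /negbTE ne]; last first.
    by apply: big1 => m _; rewrite /B /= ne mul0r mulr0.
  under eq_bigr => m _ do rewrite /B /= eqxx mul1r mulrBr.
  rewrite sumrB; congr (_ - _).
    have -> : y' y r.1 (val r.2) p = co c0 y (r.1, r.2) p by rewrite /y' valK.
    rewrite (bigD1 r.2) //= eqxx mulr1 big1 ?addr0 // => m ne.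
    by rewrite -val_eqE in ne; rewrite (negbTE ne) mulr0.
  rewrite /y'; case: insubP => [m' _ em'|nm].
    rewrite (bigD1 m') //= em' eqxx mulr1 big1 ?addr0 // => m ne.
    by rewrite -em' val_eqE (negbTE ne) mulr0.
  apply: big1 => m _; case: eqP => [em|_]; last by rewrite mulr0.
  by rewrite -em ltn_ord in nm.
have y'_out y i m p : ~~ tube (d i m) p -> y' y i m p = 0.
  rewrite /y'; case: insubP => // m' _ em' np; rewrite co_out // s0 /e0 /=.
  by rewrite -[val m']/(nat_of_ord m') em'.
have y'_far y i m p : (n < m)%N -> y' y i m p = 0.
  by move=> nm; rewrite /y' insubF // ltnS leqNgt nm.
exists T0, T1, f, g; split.
- by apply: tubes_in_add => r; apply: d1.
- by apply: tubes_in_add => r; apply: d1'.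
have first_tube (i : 'I_n.+1) p : rl i p -> tube (d i 0%N) p.
  move=> ip; have iv : i != v :> nat by move: ip; rewrite /block_le; lia.
  by rewrite d0 // /tube /=; move: ip; rewrite /block_le; case: ifP; lia.
split=> [x x' xx|y|z].
- apply: (co_inj (c := cR)) => i p ip.
  have := congr1 (fun y => co c0 y (i, ord0) p) xx; rewrite !coF /e0 /=.
  by rewrite first_tube.
- split=> [gy0|[x <-]]; last first.
    apply: (co_inj (c := c1)) => r p rp; rewrite co0 coG; case: ifP => // tp.
    have yE i m : tube (d i m) p -> (m <= n)%N -> y' (f x) i m p = co cR x i p.
      move=> tm mn; rewrite /y'; case: insubP => [m' _ em'|]; last by rewrite ltnS mn.
      by rewrite coF /e0 /= -[val m']/(nat_of_ord m') em' tm.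
    rewrite /e1 /tube /= in tp.
    have := d2 r.1 (val r.2); have := d3 r.1 (val r.2); have := d2' r.1 (val r.2).+1.
    have := d3' r.1 (val r.2) => /= l1 l2 l3 l4.
    case: (leqP r.1 p) => ip; last first.
      have -> q : y' (f x) r.1 q p = 0.
        rewrite /y'; case: insubP => // m' _ _; rewrite coF; case: ifP => // _ /=.
        rewrite co_out //; move: ip; rewrite /block_le /=; lia.
      have -> q : y' (f x) r.1 q p = 0.
        rewrite /y'; case: insubP => // m' _ _; rewrite coF; case: ifP => // _ /=.
        rewrite co_out //; move: ip; rewrite /block_le /=; lia.
      by rewrite subr0.
    have rn := ltn_ord r.2.
    have mn : (r.2.+1 <= n)%N.
      by rewrite leqNgt; apply/negP => nm; move: tp;
        rewrite (d4 r.1 _ nm) /= ltnNge ip andbF.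
    have /andP[t1 t2] := tp.
    by rewrite !yE ?subrr // /tube /= ?t1 ?(leq_trans t2 l3) ?(leq_trans l2 ip) // ltnW.
  have step i m p : tube ((d i m).1, (d i m.+1).2) p -> y' y i m p = y' y i m.+1 p.
    move=> tp; case: (leqP m n) => mn; last first.
      by rewrite !y'_far // ltnW.
    have lm : (m < n.+1)%N by [].
    have := congr1 (fun z => co c1 z (i, Ordinal lm) p) gy0; rewrite coG co0 /e1 /= tp.
    by move/eqP; rewrite subr_eq0 => /eqP.
  exists (mk cR (fun i p => y' y i 0%N p)); apply: (co_inj (c := c0)) => -[i m] p.
  rewrite s0 coF /e0 /= => tp; rewrite tp co_mk.
  have -> : co c0 y (i, m) p = y' y i (val m) p by rewrite /y' valK.
  case: (leqP i p) => ip.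
    have -> : rl i p.
      have := b0 (i, m); move: tp; have := d2' i m.
      by rewrite /e0 /in_blocks /block_le /tube /=; lia.
    rewrite -[val m]/(nat_of_ord m); elim: (nat_of_ord m) tp => // m' IHm;
      rewrite /tube => tp.
    have := d3 i m'; have := d2 i m'; have := d2' i m' => l1 l2 l3.
    rewrite IHm; last by rewrite /tube; lia.
    by apply: step; rewrite /tube /=; lia.
  case: ifP => [|_]; first by rewrite /block_le; lia.
  (* Below the point i the successive coordinates are equal, and the last one
     is zero. *)
  have all0 w m' : (n.+1 - m' <= w)%N -> y' y i m' p = 0.
    elim: w m' => [|w IHw] m' lw; first by apply: y'_far; lia.
    case: (boolP (tube (d i m') p)) => tm; last exact: y'_out.
    rewrite step; first by apply: IHw; lia.
    by move: tm; rewrite /tube /=; have := d3' i m'; lia.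
  by rewrite (all0 _ _ (leqnn _)).
- pose z' i m p := if insub m is Some m' then co c1 z (i, m') p else 0.
  have z'_out i m p : ~~ tube ((d i m).1, (d i m.+1).2) p -> z' i m p = 0.
    rewrite /z'; case: insubP => // m' _ em' np; rewrite co_out // s1 /e1 /=.
    by rewrite -[val m']/(nat_of_ord m') em'.
  (* A preimage is given by the sums of the coordinates from m on. *)
  pose sz i m p := \sum_(m <= q < n.+1) z' i q p.
  exists (mk c0 (fun r p => sz r.1 (val r.2) p)); set y := mk _ _.
  have yE i m p : tube (d i m) p -> y' y i m p = sz i m p.
    move=> tm; case: (leqP m n) => mn; last first.
      by rewrite y'_far // /sz big_geq.
    rewrite /y' (insubT (fun m => m < n.+1)%N mn) /= co_mk s0 /e0 /=.
    by rewrite tm.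
  apply: (co_inj (c := c1)) => -[i m] p; rewrite s1 coG => tp; rewrite tp /=.
  have tp' := tp; rewrite /e1 /tube /= in tp'.
  have -> : co c1 z (i, m) p = z' i (val m) p by rewrite /z' valK.
  rewrite yE; last by rewrite /tube; have := d3 i m; lia.
  rewrite {1}/sz big_ltn //; rewrite -/(sz i (val m).+1 p).
  case: (boolP (tube (d i m.+1) p)) => tm; first by rewrite yE // addrK.
  rewrite y'_out // subr0 [sz _ _ _]big_nat_cond big1 ?addr0 // =>
    q /andP[/andP[mq _] _].
  apply: z'_out; have : ((d i m.+1).1 <= (d i q).1)%N.
    elim: q mq => // q IHq; rewrite leq_eqVlt => /orP[/eqP <- //|mq].
    by apply: leq_trans (d2 i q); apply: IHq.
  by move: tm; rewrite /tube /=; have := d3 i m; lia.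
Qed.

Theorem tubing_tilted (A : falgType k) : isom_tubes ij A -> tilted H A.
Proof.
move=> isoA; exists T; split; last by apply/(isom_End_tubes c vn blk).
split.
- by apply: (coords_fin_gen c) => s; apply: segment_live.
- exact: tube_proj_dim.
- exact: tube_ext1.
- exact: tube_coresolution.
Qed.

End Coresolution.

(** * Two-term complexes *)

Section TwoTermMaps.
Variable R : nzRingType.

Section Maps.
Variables (X Y : complex R).
Hypotheses (X2 : two_term X) (Y2 : two_term Y).

Lemma two_term_eq0 (Z : complex R) : two_term Z ->
  forall (i : int) (x : Z i), (i != -1) && (i != 0) -> x = 0.
Proof. by move=> Z2 i x /andP[n1 n0]; apply: Z2. Qed.

Definition two_term_comp (f1 : {linear X (-1) -> Y (-1)}) (f0 : {linear X 0 -> Y 0})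
    (i : int) : {linear X i -> Y i} :=
  match i return {linear X i -> Y i} with
  | Negz 0 => f1
  | Posz 0 => f0
  | _ => \0
  end.

Lemma two_term_comp_diff (f1 : {linear X (-1) -> Y (-1)}) (f0 : {linear X 0 -> Y 0}) :
  (forall x : X (-1), f0 (diff X (-1) x) = diff Y (-1) (f1 x)) ->
  forall i (x : X i), two_term_comp f1 f0 (i + 1) (diff X i x) =
    diff Y i (two_term_comp f1 f0 i x).
Proof.
move=> comm [[|m]|[|m]] x; last 2 first.
- exact: comm.
- by rewrite (two_term_eq0 X2 x) ?raddf0 //.
- by rewrite (two_term_eq0 Y2 (diff Y 0 _)) // (two_term_eq0 X2 (diff X 0 x)) ?raddf0.
- by rewrite (two_term_eq0 X2 x) ?raddf0 //.
Qed.

Definition two_term_map f1 f0 comm : chain_map X Y :=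
  ChainMap (@two_term_comp_diff f1 f0 comm).

(** Only one component of a homotopy can be nonzero. *)
Lemma two_term_homotopic (f g : chain_map X Y) :
  homotopic f g <-> exists h : {linear X 0 -> Y (-1)},
    (forall x : X 0, f 0 x - g 0 x = diff Y (-1) (h x)) /\
    (forall x : X (-1), f (-1) x - g (-1) x = h (diff X (-1) x)).
Proof.
split=> [[h hE]|[h [h0 h1]]].
  exists (h (-1)); split=> x.
    have := hE (-1) x; rewrite (two_term_eq0 X2 (diff X (-1 + 1) x)) // raddf0 addr0.
    exact: id.
  have := hE (-2) x; rewrite (two_term_eq0 Y2 (h (-2) x)) // raddf0 add0r.
  exact: id.
exists (fun i => match i return {linear X (i + 1) -> Y i} with
                 | Negz 0 => h | _ => \0 end).
case=> [m|[|[|m]]] x.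
- by rewrite (two_term_eq0 X2 x) ?raddf0 ?subrr ?addr0 //; lia.
- rewrite (two_term_eq0 X2 (diff X (Negz 0 + 1) x)) // raddf0 addr0.
  exact: h0.
- rewrite raddf0 add0r; exact: h1.
- by rewrite (two_term_eq0 X2 x) ?raddf0 ?subrr ?addr0 //; lia.
Qed.
End Maps.

Section Endomorphisms.
Variables (X : complex R) (X2 : two_term X).
Local Notation "f ~ g" := (@homotopic R X X f g) (at level 70).

Lemma two_term_homotopic_refl f : f ~ f.
Proof. by apply/two_term_homotopic => //; exists \0; split=> x; rewrite subrr ?raddf0.
  Qed.

Lemma two_term_homotopic_sym f g : f ~ g -> g ~ f.
Proof.
move/(two_term_homotopic X2 X2) => [h [h0 h1]]; apply/two_term_homotopic => //.
by exists (\- h); split=> x; rewrite -opprB ?h0 ?h1 /= ?raddfN.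
Qed.

Lemma two_term_homotopic_trans f g e : f ~ g -> g ~ e -> f ~ e.
Proof.
move=> /(two_term_homotopic X2 X2)[h [h0 h1]] /(two_term_homotopic X2 X2)[h' [h0' h1']].
apply/two_term_homotopic => //; exists (h \+ h'); split=> x /=.
  transitivity ((f 0 x - g 0 x) + (g 0 x - e 0 x)); first by rewrite addrA subrK.
  by rewrite h0 h0'; apply/esym/raddfD.
by rewrite -h1 -h1' addrA subrK.
Qed.

Lemma two_term_homotopic_add f f' g g' : f ~ f' -> g ~ g' -> cadd f g ~ cadd f' g'.
Proof.
move=> /(two_term_homotopic X2 X2)[h [h0 h1]] /(two_term_homotopic X2 X2)[h' [h0' h1']].
apply/two_term_homotopic => //; exists (h \+ h'); split=> x /=.
  transitivity ((f 0 x - f' 0 x) + (g 0 x - g' 0 x)); first by rewrite opprD addrACA.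
  by rewrite h0 h0'; apply/esym/raddfD.
by rewrite -h1 -h1' opprD addrACA.
Qed.

Lemma two_term_homotopic_comp f f' g g' : f ~ f' -> g ~ g' -> ccomp f g ~ ccomp f' g'.
Proof.
move=> /(two_term_homotopic X2 X2)[h [h0 h1]] /(two_term_homotopic X2 X2)[h' [h0' h1']].
apply/two_term_homotopic => //; exists ((f (-1) \o h') \+ (h \o g' 0)); split=> x.
  transitivity (f 0 (g 0 x - g' 0 x) + (f 0 (g' 0 x) - f' 0 (g' 0 x))).
    by rewrite raddfB addrA subrK.
  by rewrite h0' h0 -[f 0 _]/(f (-1 + 1) _) cmap_diff; apply/esym/raddfD.
transitivity (f (-1) (g (-1) x - g' (-1) x) +
  (f (-1) (g' (-1) x) - f' (-1) (g' (-1) x))).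
  by rewrite raddfB addrA subrK.
by rewrite h1' h1 -cmap_diff.
Qed.

End Endomorphisms.

Section Presilting.
Variables (X : complex R) (X2 : two_term X).

(** The map phi is a chain map to the shift, and a homotopy to 0 is a pair
    (a, b). *)
Lemma presilting_factor : presilting X -> forall phi : {linear X (-1) -> X 0},
  exists (a : {linear X (-1) -> X (-1)}) (b : {linear X 0 -> X 0}),
    forall x, phi x = diff X (-1) (a x) + b (diff X (-1) x).
Proof.
case=> _ pre phi.
pose f (i : int) := match i return {linear X i -> shift X i} with
  | Negz 0 => phi | _ => \0 end.
have fd i (x : X i) : f (i + 1) (diff X i x) = diff (shift X) i (f i x).
  case: i x => [m|[|[|m]]] x.
  - by rewrite !raddf0.
  - by rewrite [LHS]/=; apply/esym/(two_term_eq0 X2 _).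
  - by rewrite (two_term_eq0 X2 x) ?raddf0.
  - by rewrite (two_term_eq0 X2 x) ?raddf0.
have [h hE] := pre 1%N (ChainMap fd) isT.
exists (\- h (-2)), (h (-1)) => x.
have := hE (-2) x; rewrite subr0 => E.
by apply: etrans E _; rewrite /= raddfN.
Qed.

Lemma iter_shift_eq0 (r : nat) (i : int) (x : iter r (@shift R) X i) :
  (i + r%:Z != -1) && (i + r%:Z != 0) -> x = 0.
Proof.
elim: r i x => [|r IHr] i x; first by rewrite addr0; apply: two_term_eq0.
move=> ir; apply: (IHr (i + 1)); move: ir; lia.
Qed.

(** Maps to the shift by 2 or more vanish for degree reasons. *)
Lemma factor_presilting : bounded_proj X ->
  (forall phi : {linear X (-1) -> X 0},
    exists (a : {linear X (-1) -> X (-1)}) (b : {linear X 0 -> X 0}),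
    forall x, phi x = diff X (-1) (a x) + b (diff X (-1) x)) -> presilting X.
Proof.
move=> bX fac; split=> // -[//|[|r]] f _.
  have [a [b ab]] := fac (f (-1)).
  exists (fun i => match i return {linear X (i + 1) -> shift X i} with
    | Negz 0 => b | Negz 1 => \- a | _ => \0 end).
  case=> [m|[|[|m]]] x.
  - by rewrite (two_term_eq0 X2 x) ?raddf0 ?subrr ?addr0 //; lia.
  - have X1 (u w : X 1) : u = w by rewrite (two_term_eq0 X2 u) // (two_term_eq0 X2 w).
    exact: X1.
  - rewrite subr0; apply: etrans (ab x) _.
    by rewrite /= raddfN opprK.
  - by rewrite (two_term_eq0 X2 x) ?raddf0 ?subrr ?addr0 //; lia.
exists (fun i => \0) => i x.
suff fx : f (i + 1) x = 0.
  by rewrite fx; apply: etrans (subr0 _) _; apply/esym;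
    apply: etrans (addr0 _) (raddf0 _).
case: (boolP ((i + 1 != -1) && (i + 1 != 0))) => ni.
  by rewrite (two_term_eq0 X2 x) ?raddf0.
by apply: iter_shift_eq0; lia.
Qed.

End Presilting.
End TwoTermMaps.

Section TwoTermComplex.
Variables (R : nzRingType) (M N : lmodType R) (d : {linear M -> N}).

Definition zero_mod : lmodType R := {ffun 'I_0 -> R^o}.

Lemma zero_modP (x : zero_mod) : x = 0.
Proof. by apply/ffunP => -[]. Qed.

Definition tt_obj (i : int) : lmodType R :=
  match i with Negz 0 => M | Posz 0 => N | _ => zero_mod end.

Definition tt_diff (i : int) : {linear tt_obj i -> tt_obj (i + 1)} :=
  match i return {linear tt_obj i -> tt_obj (i + 1)} with
  | Negz 0 => d | _ => \0 end.

Lemma tt_diffK i (x : tt_obj i) : tt_diff (i + 1) (tt_diff i x) = 0.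
Proof. by case: i x => [m|[|[|m]]] x //; rewrite [tt_diff _ x]/= raddf0. Qed.

Definition two_term_complex : complex R := Complex tt_diffK.

Lemma two_term_complexP : two_term two_term_complex.
Proof. by case=> [[|m]|[|m]] // _ _ x; apply: zero_modP. Qed.

End TwoTermComplex.

(** * Endomorphisms of a diagonal two-term complex *)

Section TubeComplex.
Variables (k : fieldType) (H : falgType k) (n : nat) (inc : incidence H n 0).
Local Notation rl := (block_le n 0).
Local Notation eps := (eps inc).
Variables (P : complex H^c) (P2 : two_term P).
Variables (K : finType) (ij : K -> nat * nat).
Variable cM : coords inc (P (-1)) (fun s => rl (ij s).2).
Variable cN : coords inc (P 0) (fun s => rl (ij s).1).
Let d : {linear P (-1) -> P 0} := diff P (-1).
Hypothesis diag : diagonal d cM cN.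
Hypothesis rng : forall s, ((ij s).1 <= (ij s).2 <= n.+1)%N.

Lemma co_diff x s p : co cN (d x) s p = if rl (ij s).1 p then co cM x s p else 0.
Proof. by case: ifP => [/(diag x) //|/negbT np]; apply: (co_out cN). Qed.

Lemma diff_gen s : rl (ij s).2 (ij s).2 ->
  d (gen cM s (ij s).2) = ract (gen cN s (ij s).1) (eps (ij s).1 (ij s).2).
Proof.
move=> rj; apply: (co_inj (c := cN)) => t p tp; rewrite co_diff tp co_gen rj /=.
case: (p =P (ij s).2) tp => [->|/eqP ne] tp; last by rewrite co_eps_ne // andbF.
rewrite co_eps // co_gen; case: (t =P s) tp => [->|_] tp;
  last by rewrite !andbF if_same.
by rewrite tp (block_le_refll tp) eqxx.
Qed.

Lemma tmx_cut_admM (a : tmx k K) s t : tmx_cut ij a s t != 0 ->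
  admissible n 0 (rl (ij s).2) (rl (ij t).2).
Proof.
rewrite /tmx_cut; case: ifP => [st _ p q|_]; last by rewrite eqxx.
by move: st; rewrite /tube_hom /block_le; lia.
Qed.

Lemma tmx_cut_admN (a : tmx k K) s t : tmx_cut ij a s t != 0 ->
  admissible n 0 (rl (ij s).1) (rl (ij t).1).
Proof.
rewrite /tmx_cut; case: ifP => [st _ p q|_]; last by rewrite eqxx.
by move: st; rewrite /tube_hom /block_le; lia.
Qed.

Definition tube_map1 a : {linear P (-1) -> P (-1)} :=
  matrix_map cM cM (@tmx_cut_admM a).
Definition tube_map0 a : {linear P 0 -> P 0} := matrix_map cN cN (@tmx_cut_admN a).

Lemma tube_map_comm a (x : P (-1)) : tube_map0 a (d x) = d (tube_map1 a x).
Proof.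
apply: (co_inj (c := cN)) => t p tp; rewrite co_diff tp !co_matrix_map tp.
transitivity (\sum_s co cM x s p * tmx_cut ij a s t).
  apply: eq_bigr => s _; rewrite co_diff; case: ifP => // /negbT sp.
  case: (boolP (rl (ij s).2 p)) => jp; last by rewrite co_out ?mul0r.
  rewrite /tmx_cut; case: ifP => st; last by rewrite !mulr0.
  by have := rng s; move: sp jp st tp; rewrite /tube_hom /block_le; lia.
case: ifP => // /negbT np; apply: big1 => s _.
case: (boolP (rl (ij s).2 p)) => jp; last by rewrite co_out ?mul0r.
rewrite /tmx_cut; case: ifP => st; last by rewrite !mulr0.
by move: np jp st tp; rewrite /tube_hom /block_le; lia.
Qed.

Definition tube_map (a : tmx k K) : chain_map P P :=
  two_term_map P2 P2 (tube_map_comm a).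

Lemma co_tube_map1 a x t p : rl (ij t).2 p ->
  co cM (tube_map a (-1) x) t p = \sum_s co cM x s p * tmx_cut ij a s t.
Proof. by move=> tp; rewrite [LHS]co_matrix_map tp. Qed.

Lemma co_tube_map0 a x t p : rl (ij t).1 p ->
  co cN (tube_map a 0 x) t p = \sum_s co cN x s p * tmx_cut ij a s t.
Proof. by move=> tp; rewrite [LHS]co_matrix_map tp. Qed.

(** A matrix D which describes f - g in both degrees and whose entries are
    maps from P_i to P_l, for tubes (i, j) and (k, l) with l <= i, is the
    matrix of a homotopy. *)
Lemma null_homotopic (f g : chain_map P P) (D : K -> K -> k) :
  (forall s t, D s t != 0 -> ((ij t).2 <= (ij s).1)%N) ->
  (forall x t p, rl (ij t).2 p -> co cM (f (-1) x) t p - co cM (g (-1) x) t p =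
     \sum_s co cM x s p * D s t) ->
  (forall x t p, rl (ij t).1 p -> co cN (f 0 x) t p - co cN (g 0 x) t p =
     \sum_s co cN x s p * D s t) ->
  homotopic f g.
Proof.
move=> Dle f1 f0; apply/two_term_homotopic => //.
have admD s t : D s t != 0 -> admissible n 0 (rl (ij s).1) (rl (ij t).2).
  by move/Dle => le p q; rewrite /block_le; lia.
exists (matrix_map cN cM admD); split=> x.
  apply: (co_inj (c := cN)) => t p tp; rewrite coB f0 //.
  rewrite -/d [RHS]co_diff tp co_matrix_map; case: ifP => // /negbT np.
  apply: big1 => s _.
  case: (boolP (rl (ij s).1 p)) => sp; last by rewrite co_out ?mul0r.
  case: (D s t =P 0) => [->|/eqP/Dle le]; first by rewrite mulr0.
  by have := rng t; move: sp np tp le; rewrite /block_le; lia.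
apply: (co_inj (c := cM)) => t p tp; rewrite coB f1 //.
rewrite -/d [RHS]co_matrix_map tp; apply: eq_bigr => s _; rewrite co_diff.
case: ifP => // /negbT np.
case: (boolP (rl (ij s).2 p)) => sp; last by rewrite co_out ?mul0r.
case: (D s t =P 0) => [->|/eqP/Dle le]; first by rewrite !mulr0.
by have := rng s; move: sp np tp le; rewrite /block_le; lia.
Qed.

(** Let C1 and C0 be the matrices of f in degrees -1 and 0. Commutation with
    the differential makes them agree where both are relevant; take C1 where
    P_j is nonzero and C0 elsewhere. Entries that are not allowed by
    [tube_hom] and nonzero belong to tubes with l <= i, so that they are
    null-homotopic. *)
Lemma homotopic_full (f : chain_map P P) : exists a, homotopic f (tube_map a).
Proof.
pose C1 s t := co cM (f (-1) (gen cM s (ij s).2)) t (ij s).2.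
pose C0 s t := co cN (f 0 (gen cN s (ij s).1)) t (ij s).1.
have f1E x t p : co cM (f (-1) x) t p = \sum_s co cM x s p * C1 s t by apply:
  proj_matrix.
have f0E x t p : co cN (f 0 x) t p = \sum_s co cN x s p * C0 s t by apply: proj_matrix.
have C1le s t : C1 s t != 0 -> rl (ij t).2 (ij s).2.
  by apply: contraNT => np; apply/eqP/(co_out cM).
have C0le s t : C0 s t != 0 -> rl (ij t).1 (ij s).1.
  by apply: contraNT => np; apply/eqP/(co_out cN).
have C10 s t : rl (ij s).2 (ij s).2 -> rl (ij t).1 (ij s).2 ->
    C1 s t = if rl (ij s).1 (ij s).2 then C0 s t else 0.
  move=> rj tj; have := cmap_diff f (gen cM s (ij s).2).
  move/(congr1 (fun y : P 0 => co cN y t (ij s).2)).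
  rewrite -/d -[f (-1 + 1) _]/(f 0 _) diff_gen // => E.
  transitivity (co cN (d (f (-1) (gen cM s (ij s).2))) t (ij s).2).
    by rewrite co_diff tj.
  apply: etrans (esym E) _; rewrite linear_ract co_eps //.
exists (fun s t => if rl (ij s).2 (ij s).2 then C1 s t else C0 s t).
set a := fun s t => if _ then _ else _.
pose D s t := if ((ij t).2 <= (ij s).1)%N then a s t else 0.
apply: (@null_homotopic _ _ D).
- by move=> s t; rewrite /D; case: ifP; rewrite // eqxx.
- move=> x t p tp; rewrite f1E [co cM (tube_map a _ _) _ _]co_matrix_map tp -sumrB.
  apply: eq_bigr => s _; rewrite -mulrBr.
  case: (boolP (rl (ij s).2 p)) => sp; last by rewrite co_out ?mul0r.
  congr (_ * _); rewrite /D /tmx_cut /a (block_le_refll sp).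
  case: ifP => [st|nst].
    by rewrite subrr; case: ifP => //; move: st; rewrite /tube_hom; lia.
  rewrite subr0; case: ifP => // /negbT il.
  have := rng s; have := rng t => rt rs.
  apply/eqP; apply: contraT => nz; have := C1le _ _ nz => lj.
  have kj : rl (ij t).1 (ij s).2 by move: nst lj il rt rs;
    rewrite /tube_hom /block_le; lia.
  move: nz; rewrite C10 ?(block_le_refll sp) //; case: ifP => [ij0 /C0le ki|_];
    last by rewrite eqxx.
  by move: nst lj il rt rs ki; rewrite /tube_hom /block_le; lia.
- move=> x t p tp; rewrite f0E [co cN (tube_map a _ _) _ _]co_matrix_map tp -sumrB.
  apply: eq_bigr => s _; rewrite -mulrBr.
  case: (boolP (rl (ij s).1 p)) => sp; last by rewrite co_out ?mul0r.
  congr (_ * _); rewrite /D /tmx_cut.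
  have := rng s; have := rng t => rt rs.
  have aC : a s t = C0 s t.
    rewrite /a; case: ifP => // rj.
    case: (boolP (rl (ij t).1 (ij s).2)) => kj.
      rewrite C10 // (_ : rl (ij s).1 _) //; move: rj sp rs; rewrite /block_le; lia.
    case: (C1 s t =P 0) => [->|/eqP/C1le]; last by move: kj rj rt tp;
      rewrite /block_le; lia.
    case: (C0 s t =P 0) => [->|/eqP/C0le] //; move: kj rj rs; rewrite /block_le; lia.
  rewrite aC; case: ifP => [st|nst].
    by rewrite subrr; case: ifP => //; move: st; rewrite /tube_hom; lia.
  rewrite subr0; case: ifP => // /negbT il.
  apply/eqP; apply: contraT => nz; have := C0le _ _ nz => ki.
  have jn : ((ij s).2 < (ij t).2)%N by move: nst ki il; rewrite /tube_hom /block_le;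
    lia.
  have rj : rl (ij s).2 (ij s).2 by move: ki jn rs rt; rewrite /block_le; lia.
  by move: aC nz; rewrite /a rj => <- /C1le; move: jn; rewrite /block_le; lia.
Qed.

(** The two sides differ by composites that are maps between the terms but
    with l <= i, hence null-homotopic. *)
Lemma tube_map_mul a b : homotopic (tube_map (tmx_mul ij a b))
  (ccomp (tube_map a) (tube_map b)).
Proof.
have E (M : lmodType H^c) (Y : K -> nat -> bool) (c : coords inc M Y) x t p :
    (forall s r, Y s p -> Y t p -> tube_hom ij s r -> tube_hom ij r t -> Y r p) ->
    Y t p ->
    \sum_r (if Y r p then \sum_s co c x s p * tmx_cut ij b s r else 0) * tmx_cut ij a
      r t
      = \sum_s co c x s p * tmx_mul ij a b s t.
  move=> Yr tp; under [RHS]eq_bigr do rewrite mulr_sumr.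
  rewrite exchange_big; apply: eq_bigr => r _ /=.
  case: ifP => rp; first by rewrite mulr_suml; apply: eq_bigr => s _; rewrite mulrA.
  rewrite mul0r big1 // => s _.
  case: (boolP (Y s p)) => sp; last by rewrite co_out ?mul0r.
  rewrite /tmx_cut; case: ifP => sr; last by rewrite mul0r mulr0.
  case: ifP => rt; last by rewrite !mulr0.
  by rewrite (Yr s r) in rp.
pose D s t : k := if ((ij t).2 <= (ij s).1)%N then - tmx_mul ij a b s t else 0.
have DE s t : tmx_cut ij (tmx_mul ij a b) s t - tmx_mul ij a b s t = D s t.
  rewrite /D {1}/tmx_cut; case: ifP => [st|nst].
    by rewrite subrr; case: ifP => //; move: st; rewrite /tube_hom; lia.
  rewrite sub0r; case: ifP => // /negbT il.
  rewrite (_ : tmx_mul _ _ _ _ _ = 0) ?oppr0 //; apply: big1 => r _.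
  rewrite /tmx_cut; case: ifP => sr; last by rewrite mul0r.
  case: ifP => rt; last by rewrite mulr0.
  by move: nst il sr rt; rewrite /tube_hom; lia.
apply: (@null_homotopic _ _ D).
- by move=> s t; rewrite /D; case: ifP; rewrite // eqxx.
- move=> x t p tp.
  have -> : co cM (ccomp (tube_map a) (tube_map b) (-1) x) t p =
      co cM (tube_map1 a (tube_map1 b x)) t p by [].
  rewrite [co cM (tube_map _ _ _) _ _]co_matrix_map
    [co cM (tube_map1 _ _) _ _]co_matrix_map tp.
  under [X in _ - X]eq_bigr do rewrite co_matrix_map.
  rewrite (E _ _ cM) //; last first.
    by move=> s r sp _; move: sp tp; rewrite /tube_hom /block_le; lia.
  by rewrite -sumrB; apply: eq_bigr => s _; rewrite -mulrBr DE.
- move=> x t p tp.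
  have -> : co cN (ccomp (tube_map a) (tube_map b) 0 x) t p =
      co cN (tube_map0 a (tube_map0 b x)) t p by [].
  rewrite [co cN (tube_map _ _ _) _ _]co_matrix_map
    [co cN (tube_map0 _ _) _ _]co_matrix_map tp.
  under [X in _ - X]eq_bigr do rewrite co_matrix_map.
  rewrite (E _ _ cN) //; last first.
    by move=> s r sp _; move: sp tp; rewrite /tube_hom /block_le; lia.
  by rewrite -sumrB; apply: eq_bigr => s _; rewrite -mulrBr DE.
Qed.

Variable v : nat.
Hypothesis vn : (v <= n)%N.
Hypothesis blk : forall s, in_blocks n v (ij s).

(** The entry (s, t) is read off in degree -1 at the point j when P_j is
    nonzero, and in degree 0 at the point i otherwise. A homotopy, being a
    map from P_i to P_l with i < l, contributes nothing. *)
Lemma tube_map_faithful a b : tmx_eq ij a b <-> homotopic (tube_map a) (tube_map b).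
Proof.
split=> [ab|/(two_term_homotopic P2 P2)[h [h0 h1]] s t st].
  apply: (@null_homotopic _ _ (fun _ _ => 0)) => [s t|x t p tp|x t p tp].
  - by rewrite eqxx.
  - rewrite !co_tube_map1 // -sumrB; apply: eq_bigr => s _; rewrite mulr0 -mulrBr.
    by rewrite /tmx_cut; case: ifP => [/ab ->|_]; rewrite subrr mulr0.
  - rewrite !co_tube_map0 // -sumrB; apply: eq_bigr => s _; rewrite mulr0 -mulrBr.
    by rewrite /tmx_cut; case: ifP => [/ab ->|_]; rewrite subrr mulr0.
have pick (M : lmodType H^c) (Y : K -> nat -> bool) (c : coords inc M Y) (e : tmx k K)
  p :
    Y s p -> \sum_r co c (gen c s p) r p * tmx_cut ij e r t = e s t.
  move=> sp; rewrite (bigD1 s) //= co_gen sp !eqxx mul1r /tmx_cut st.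
  by rewrite big1 ?addr0 // => r /negbTE ne; rewrite co_gen ne andbF mul0r.
have := rng s; have := rng t; have := blk s; have := blk t => bt bs rt rs.
apply/eqP; rewrite -subr_eq0; apply/eqP.
case: (boolP (rl (ij s).2 (ij s).2)) => rj.
  have lj : rl (ij t).2 (ij s).2 by move: st rj; rewrite /tube_hom /block_le; lia.
  have := congr1 (fun y => co cM y t (ij s).2) (h1 (gen cM s (ij s).2)).
  rewrite coB !co_tube_map1 // !pick // => ->.
  rewrite -/d diff_gen // linear_ract co_eps //; case: ifP => // rij.
  by rewrite co_out //; move: st; rewrite /tube_hom /block_le; lia.
have ki : rl (ij t).1 (ij s).1 by move: st rj bt bs rt rs;
  rewrite /tube_hom /in_blocks /block_le; lia.
have := congr1 (fun y => co cN y t (ij s).1) (h0 (gen cN s (ij s).1)).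
rewrite coB !co_tube_map0 // !pick ?(block_le_reflr ki) // => ->.
rewrite -/d [LHS]co_diff ki co_out //; move: st; rewrite /tube_hom /block_le; lia.
Qed.

Lemma isom_EndK_tubes (A : falgType k) : isom_tubes ij A <-> isom_EndK A P.
Proof.
have same (f g : chain_map P P) :
   (forall x t p, rl (ij t).2 p -> co cM (f (-1) x) t p = co cM (g (-1) x) t p) ->
   (forall x t p, rl (ij t).1 p -> co cN (f 0 x) t p = co cN (g 0 x) t p) ->
     homotopic f g.
  move=> f1 f0; apply: (@null_homotopic _ _ (fun _ _ => 0)) => [s t|x t p tp|x t p tp].
  - by rewrite eqxx.
  - by rewrite f1 // subrr big1 // => s _; rewrite mulr0.
  - by rewrite f0 // subrr big1 // => s _; rewrite mulr0.
apply: (@quotient_isom_transfer _ _ _ _ _ _ _ _ _ _ _ _ _ _ tube_map).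
- exact: two_term_homotopic_refl.
- exact: two_term_homotopic_sym.
- exact: two_term_homotopic_trans.
- exact: two_term_homotopic_add.
- exact: two_term_homotopic_comp.
- move=> e f f' /(two_term_homotopic P2 P2)[h [h0 h1]]; apply/two_term_homotopic => //.
  exists (hom_scale e h); split=> x.
    rewrite -/d /= /hom_scale_fun -scalerBr h0 -/d; apply/esym; exact: linearZ.
  by rewrite /= /hom_scale_fun -scalerBr h1.
- exact: tube_map_faithful.
- exact: homotopic_full.
- move=> a b; apply: same => x t p tp.
    rewrite [RHS]coD !co_tube_map1 // -big_split; apply: eq_bigr => s _ /=.
    by rewrite /tmx_cut /tmx_add; case: ifP => _; rewrite ?mulr0 ?addr0 ?mulrDr.
  rewrite [RHS]coD !co_tube_map0 // -big_split; apply: eq_bigr => s _ /=.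
  by rewrite /tmx_cut /tmx_add; case: ifP => _; rewrite ?mulr0 ?addr0 ?mulrDr.
- exact: tube_map_mul.
- move=> e a; apply: same => x t p tp.
    transitivity (e * co cM (tube_map a (-1) x) t p).
      rewrite !co_tube_map1 // mulr_sumr.
      by apply: eq_bigr => s _; rewrite /tmx_cut /tmx_scale; case: ifP => _; ring.
    by apply/esym/co_scale => s q; apply: block_le_reflr.
  transitivity (e * co cN (tube_map a 0 x) t p).
    rewrite !co_tube_map0 // mulr_sumr.
    by apply: eq_bigr => s _; rewrite /tmx_cut /tmx_scale; case: ifP => _; ring.
  by apply/esym/co_scale => s q; apply: block_le_reflr.
(* The identity matrix differs from its truncation at the empty tubes, whose
   complexes are contractible. *)
- pose D (s t : K) : k := if (ij t).1 == (ij t).2 then - (s == t)%:R else 0.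
  have DE s t : tmx_cut ij (@tmx_one k K) s t - (s == t)%:R = D s t.
    rewrite /tmx_cut /tmx_one /D; case: (s =P t) => [->|_];
      last by rewrite !mulr0n oppr0 !if_same addr0.
    rewrite /tube_hom; have := rng t.
    case: ((ij t).1 =P (ij t).2) => [->|/eqP ne] rt; first by rewrite ltnn andbF sub0r.
    by rewrite (_ : _ && _) ?subrr //; lia.
  apply: (@null_homotopic _ _ D).
  + move=> s t; rewrite /D; case: ifP => [/eqP e|_]; last by rewrite eqxx.
    rewrite oppr_eq0; case: (s =P t) => [->|_]; last by rewrite eqxx.
    by rewrite e.
  + move=> x t p tp; rewrite co_tube_map1 //.
    have -> : co cM (cid P (-1) x) t p = \sum_s co cM x s p * (s == t)%:R by rewrite
      sum_delta.
    by rewrite -sumrB; apply: eq_bigr => s _; rewrite -mulrBr DE.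
  + move=> x t p tp; rewrite co_tube_map0 //.
    have -> : co cN (cid P 0 x) t p = \sum_s co cN x s p * (s == t)%:R by rewrite
      sum_delta.
    by rewrite -sumrB; apply: eq_bigr => s _; rewrite -mulrBr DE.
Qed.

End TubeComplex.

(** * Complexes on which a multiplication is a quasi-isomorphism *)

Lemma zero_fg_projective (R : nzRingType) (M : lmodType R) :
  zero_module M -> fg_projective M.
Proof.
move=> M0; split; first by exists 0%N, \0 => y; exists 0; rewrite (M0 y).
by move=> M' N g f _; exists \0 => x; rewrite (M0 x) !raddf0.
Qed.

Lemma two_term_bounded (R : nzRingType) (M N : lmodType R) (d : {linear M -> N}) :
  fg_projective M -> fg_projective N -> bounded_proj (two_term_complex d).
Proof.
move=> pM pN; split.
  by case=> [[|m]|[|m]] //=; apply/zero_fg_projective/zero_modP.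
exists (-1), 0; case=> [[|m]|[|m]] // _ x; exact: zero_modP.
Qed.

Section Perpendicular.
Variables (k : fieldType) (H : falgType k).
Variables (e e' f : H).
Hypotheses (ee : e * e = e) (ee' : e * e' = e') (e'f : e' * f = e') (ff : f * f = f).

(** The cone of the multiplication by e' from X e to X f is acyclic. The
    condition is that X is orthogonal to all shifts of the cone of the map
    from f H to e H given by e', and it passes to thick subcategories. *)
Definition acyclic_mul (X : complex H^c) : Prop :=
  forall i (x : X (i + 1 + 1)) (y : X (i + 1)),
    ract x e = x -> ract y f = y -> diff X _ x = 0 -> ract x e' + diff X _ y = 0 ->
  exists (x' : X (i + 1)) (y' : X i),
    [/\ ract x' e = x', ract y' f = y', x = - diff X _ x'
      & y = ract x' e' + diff X _ y'].

Lemma acyclic_mul_shift X : acyclic_mul X -> acyclic_mul (shift X).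
Proof.
move=> QX i x y xe yf dx xy.
have [|||x' [y' [x'e y'f xE yE]]] := QX (i + 1) x (- y) xe.
- by rewrite ractNl yf.
- by apply: oppr_inj; rewrite oppr0.
- by rewrite raddfN.
exists (- x'), y'; split=> //; first by rewrite ractNl x'e.
  by rewrite {1}xE /= opprK raddfN.
by apply: oppr_inj; rewrite yE /= opprD opprK ractNl opprK.
Qed.

Lemma acyclic_mul_unshift X : acyclic_mul (shift X) -> acyclic_mul X.
Proof.
move=> QX i; rewrite -[i](subrK 1); move: (i - 1) => j x y xe yf dx xy.
have [|||x' [y' [x'e y'f xE yE]]] := QX j x (- y) xe.
- by rewrite ractNl yf.
- by rewrite /= dx oppr0.
- by rewrite /= raddfN /= opprK.
exists (- x'), y'; split=> //; first by rewrite ractNl x'e.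
  by rewrite {1}xE /= [diff X _ (- x')]raddfN.
by apply: oppr_inj; rewrite yE /= opprD ractNl opprK.
Qed.

Lemma acyclic_mul_cone X Y (phi : chain_map X Y) :
  acyclic_mul X -> acyclic_mul Y -> acyclic_mul (cone phi).
Proof.
move=> QX QY i [x1 x2] [y1 y2] [xe1 xe2] [yf1 yf2] [dx1 dx2] [xy1 xy2].
have {}dx1 : diff X _ x1 = 0 by apply: oppr_inj; rewrite oppr0.
have [||a [b [ae bf aE bE]]] := QX (i + 1) x1 (- y1) xe1 _ dx1.
- by rewrite ractNl; congr (- _).
- by rewrite raddfN.
have [||||a' [b' [ae' bf' aE' bE']]] := QY i (x2 - phi _ a) (y2 - phi _ b).
- by rewrite ractBl -linear_ract ae; congr (_ - _).
- by rewrite ractBl -linear_ract bf; congr (_ - _).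
- rewrite raddfB /= -cmap_diff; move: dx2; rewrite aE raddfN => /= dx2.
  by rewrite -dx2; apply: addrC.
- rewrite ractBl raddfB /= -!linear_ract -!cmap_diff addrACA -opprD -raddfD -bE.
  rewrite raddfN opprK; apply: etrans xy2; rewrite -!addrA; congr (_ + _); exact: addrC.
have E1 : x1 = - - diff X _ (- a) by rewrite opprK raddfN.
have E2 : x2 = - (phi _ (- a) + diff Y _ a').
  rewrite raddfN opprD opprK -aE'; apply/esym; apply: etrans (addrC _ _) _.
  by rewrite subrK.
have F1 : y1 = ract (- a) e' + - diff X _ b.
  by apply: oppr_inj; rewrite bE opprD opprK ractNl opprK.
have F2 : y2 = ract a' e' + (phi _ b + diff Y _ b').
  apply/esym; apply: etrans (addrCA _ _ _) _; rewrite -bE'.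
  by apply: etrans (addrC _ _) _; rewrite subrK.
have G1 : ract (- a) e = - a by rewrite ractNl ae.
exists ((- a, a') : cone_obj X Y (i + 1)), ((b, b') : cone_obj X Y i); split.
- exact: (congr2 pair G1 ae').
- exact: (congr2 pair bf bf').
- exact: (congr2 pair E1 E2).
- exact: (congr2 pair F1 F2).
Qed.

Lemma acyclic_mul_summand X Y (u : chain_map X Y) (w : chain_map Y X) :
  homotopic (ccomp w u) (cid X) -> acyclic_mul Y -> acyclic_mul X.
Proof.
case=> h hE QY i x y xe yf dx xy.
have [||||a [b [ae bf aE bE]]] := QY i (u _ x) (u _ y).
- by rewrite -linear_ract xe.
- by rewrite -linear_ract yf.
- by rewrite -cmap_diff dx raddf0.
- by rewrite -cmap_diff -linear_ract -raddfD xy raddf0.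
exists (w _ a + h _ x), (w _ b - ract (h _ y) f); split.
- by rewrite ractDl -!linear_ract ae xe.
- by rewrite ractBl -linear_ract bf ractM ff.
- have := hE _ x; rewrite /= aE dx raddf0 addr0 raddfN /= cmap_diff => E.
  rewrite raddfD /= -E; apply/esym; rewrite opprD opprB.
  by apply: etrans (addrCA _ _ _) _; rewrite subrr addr0.
- have dy : diff X _ y = - ract x e' by apply/eqP; rewrite -addr_eq0;
  apply/eqP/(etrans _ xy)/addrC.
  have E : y = ract (w _ a) e' + diff X _ (w _ b) -
    (diff X _ (h _ y) - ract (h _ x) e').
    have := hE _ y; rewrite /= bE dy raddfD /= cmap_diff linear_ract raddfN /=
      linear_ract => <-.
    by apply/esym; rewrite opprB; apply: etrans (addrCA _ _ _) _; rewrite subrr addr0.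
  have db : ract (diff X _ (w _ b)) f = diff X _ (w _ b) by rewrite -!linear_ract bf.
  have dh : ract (diff X _ (h _ y)) f = diff X _ (ract (h _ y) f) by rewrite
    linear_ract.
  rewrite -{1}yf {1}E ractBl ractDl ractBl !ractM e'f db dh [in RHS]ractDl.
  rewrite [in RHS]raddfB /= opprB addrACA; congr (_ + _); exact: addrC.
Qed.

End Perpendicular.

(** * Silting complexes give tubings *)

Lemma acyclic_mul_thick (k : fieldType) (H : falgType k) (e e' f : H)
    (P X : complex H^c) : e * e = e -> e * e' = e' -> e' * f = e' -> f * f = f ->
  acyclic_mul e e' f P -> thick P X -> acyclic_mul e e' f X.
Proof.
move=> ee ee' e'f ff QP; elim=> {X} //.
- by move=> X _; apply: acyclic_mul_shift.
- by move=> X _; apply: acyclic_mul_unshift.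
- by move=> X Y phi _ QX _ QY; apply: acyclic_mul_cone.
- by move=> X Y u w _ wu _; apply: acyclic_mul_summand wu.
Qed.

Section SiltingTubes.
Variables (k : fieldType) (H : falgType k) (n : nat) (inc : incidence H n 0).
Local Notation rl := (block_le n 0).
Local Notation eps := (eps inc).
Local Notation crd := (crd inc).

Section Complex.
Variables (P : complex H^c) (P2 : two_term P).
Variables (K : finType) (ij : K -> nat * nat).
Variable cM : coords inc (P (-1)) (fun s => rl (ij s).2).
Variable cN : coords inc (P 0) (fun s => rl (ij s).1).
Let d : {linear P (-1) -> P 0} := diff P (-1).
Hypothesis diag : diagonal d cM cN.
Hypothesis rng : forall s, ((ij s).1 <= (ij s).2 <= n.+1)%N.

(** If the tubes (i, j) and (k, l) cross, the inclusion of P_j in P_k is a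
    map from degree -1 to degree 0 that factors neither through P_j -> P_i
    nor through P_l -> P_k. *)
Lemma presilting_noncrossing : presilting P -> noncrossing ij.
Proof.
move=> pre s t; apply/negP => cr.
have adm_phi s' t' : (((s' == s) && (t' == t))%:R : k) != 0 ->
    admissible n 0 (rl (ij s').2) (rl (ij t').1).
  case: (s' =P s) => [->|_]; last by rewrite eqxx.
  case: (t' =P t) => [->|_]; last by rewrite eqxx.
  by move=> _ p q; move: cr; rewrite /crossing /block_le; lia.
have [a [b ab]] := presilting_factor P2 pre (matrix_map cM cN adm_phi).
have := rng s; have := rng t => rt rs.
have jj : rl (ij s).2 (ij s).2 by move: cr; rewrite /crossing /block_le; lia.
have kj : rl (ij t).1 (ij s).2 by move: cr; rewrite /crossing /block_le; lia.
have := congr1 (fun y : P 0 => co cN y t (ij s).2) (ab (gen cM s (ij s).2)).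
rewrite co_matrix_map kj (bigD1 s) //= [X in _ + X]big1 ?addr0 => [|r /negbTE ne];
  last first.
  by rewrite ne mulr0.
rewrite co_gen jj !eqxx mulr1 => E; have {E} := esym E; apply/eqP.
rewrite eq_sym.
have -> : co cN (diff P (-1) (a (gen cM s (ij s).2)) + b
  (diff P (-1) (gen cM s (ij s).2))) t (ij s).2
  = co cN (d (a (gen cM s (ij s).2))) t (ij s).2 + co cN (b (d (gen cM s (ij s).2))) t
    (ij s).2.
  exact: coD.
rewrite (co_diff diag) kj co_out ?add0r; last by move: cr;
  rewrite /crossing /block_le; lia.
rewrite (diff_gen diag) // linear_ract co_eps //; case: ifP => rij.
  by rewrite co_out ?oner_eq0 //; move: cr; rewrite /crossing /block_le; lia.
by rewrite oner_eq0.
Qed.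

(** If p < q are in the same tubes, the multiplication by the matrix unit at
    (p, q) is a quasi-isomorphism from P e_p to P e_q, by inspection of each
    summand. It would then be one on the stalk complex of H, but e_q is not
    in H e_(p, q). For p = 0 the idempotent e_p is zero, and the statement
    is that P e_q is acyclic. *)
Lemma generating_separating : (forall X, bounded_proj X -> thick P X) ->
  separating n ij.
Proof.
move=> gen_all p q pq; apply: NNPP => nsep.
have same s : tube (ij s) p = tube (ij s) q.
  by apply/eqP; apply: contraT => ne; case: nsep; exists s.
have epsE a b c : (a == 0%N) || (a <= b <= c)%N && (c <= n)%N ->
   eps a b * eps b c = eps a c.
  case: (posnP a) => [->|a0] abc.
    by rewrite !(@eps_out _ _ _ _ inc 0) ?mul0r // /block_le; lia.
  by rewrite epsM //; move: abc; rewrite /block_le; lia.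
have [ee ee' e'f ff] : [/\ eps p p * eps p p = eps p p, eps p p * eps p q = eps p q,
   eps p q * eps q q = eps p q & eps q q * eps q q = eps q q].
  by split; apply: epsE; lia.
have qq : rl q q by rewrite /block_le; lia.
have cut (Y : K -> nat -> bool) (M : lmodType H^c) (c : coords inc M Y) x w s r :
    ract x (eps w w) = x -> r != w -> co c x s r = 0.
  by move=> <- ne; rewrite co_eps_ne.
have QP : acyclic_mul (eps p p) (eps p q) (eps q q) P.
  move=> i; case: i => [m|[|[|[|m]]]] x y xe yf dx xy.
  - exists 0, 0; rewrite !raddf0 !ract0l ?oppr0 ?addr0.
    have X0 : x = 0 by apply: (two_term_eq0 P2); lia.
    have Y0 : y = 0 by apply: (two_term_eq0 P2); lia.
    by split.
  - have X0 : x = 0 by apply: (two_term_eq0 P2).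
    change (P 0 : Type) in y.
    pose x' : P 0 := mk cN (fun s w => if (w == p) && (q < (ij s).2)%N then co cN y s
      q else 0).
    pose y' : P (-1) := mk cM (fun s w => if w == q then co cM (mk cM (co cN y)) s q
      else 0).
    exists x', y'.
    have x'E s w : co cN x' s w = if rl (ij s).1 w && ((w == p) && (q < (ij s).2)%N)
      then co cN y s q else 0.
      by rewrite co_mk; case: (rl _ w).
    have y'E s w : co cM y' s w = if rl (ij s).2 w && (w == q) then co cN y s q else 0.
      by rewrite co_mk; case: ifP => //= sw; case: eqP => // e; rewrite co_mk -e sw.
    split.
    + apply: (co_inj (c := cN)) => s w sw; case: (w =P p) sw => [->|/eqP ne] sw.
        by rewrite co_eps // (block_le_reflr sw).
      by rewrite co_eps_ne // x'E (negbTE ne) andbF.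
    + apply: (co_inj (c := cM)) => s w sw; case: (w =P q) sw => [->|/eqP ne] sw.
        by rewrite co_eps // qq.
      by rewrite co_eps_ne // y'E (negbTE ne) andbF.
    + rewrite X0; apply/esym/eqP; rewrite oppr_eq0; apply/eqP.
      exact: (two_term_eq0 P2).
    + change (y = ract x' (eps p q) + d y').
      apply: (co_inj (c := cN)) => s w sw; rewrite coD (co_diff diag) sw y'E.
      case: (w =P q) sw => [->|/eqP ne] sw; last first.
        by rewrite co_eps_ne // andbF addr0 (cut _ _ cN y q).
      rewrite co_eps // x'E eqxx andbT /=.
      have := same s; have := rng s; rewrite /tube => rs sm.
      case: (leqP (ij s).2 q) => jq.
        rewrite !andbF if_same add0r (_ : rl _ _) //.
        by move: jq sw rs; rewrite /block_le; lia.
      rewrite (_ : rl (ij s).2 q = false) ?addr0; last by rewrite /block_le; lia.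
      rewrite andbT (_ : rl (ij s).1 p); last by move: jq sw rs sm; rewrite /block_le;
        lia.
      by rewrite (_ : rl p q) //; move: jq sw rs sm; rewrite /block_le; lia.
  - change (P 0 : Type) in x; change (P (-1) : Type) in y;
    change (ract x (eps p q) + d y = 0) in xy.
    pose x' : P (-1) := mk cM (fun s w => if w == p then co cM y s q else 0).
    have x'E s w : co cM x' s w = if rl (ij s).2 w && (w == p) then co cM y s q else 0.
      by rewrite co_mk; case: (rl _ w).
    have key s : rl (ij s).1 q -> (if rl p q then co cN x s p else 0) + co cM y s q = 0.
      move=> iq; have := congr1 (fun z : P 0 => co cN z s q) xy.
      by rewrite coD co0 co_eps // (co_diff diag) iq.
    exists x', 0; rewrite ract0l raddf0 addr0; split=> //.
    + apply: (co_inj (c := cM)) => s w sw; case: (w =P p) sw => [->|/eqP ne] sw.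
        by rewrite co_eps // (block_le_reflr sw).
      by rewrite co_eps_ne // x'E (negbTE ne) andbF.
    + change (x = - d x'); apply: (co_inj (c := cN)) => s w sw.
      rewrite coN (co_diff diag) sw x'E.
      case: (w =P p) sw => [->|/eqP ne] sw; last first.
        by rewrite andbF oppr0 (cut _ _ cN x p).
      rewrite andbT.
      have iq : rl (ij s).1 q by move: sw; rewrite /block_le; lia.
      have rpq : rl p q by move: sw; rewrite /block_le; lia.
      have := key s iq; rewrite rpq => /eqP; rewrite addr_eq0 => /eqP ->.
      case: ifP => // /negbT np; rewrite co_out //.
      by have := same s; have := rng s; move: np sw; rewrite /tube /block_le; lia.
    + change (y = ract x' (eps p q)); apply: (co_inj (c := cM)) => s w sw.
      case: (w =P q) sw => [->|/eqP ne] sw; last first.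
        by rewrite co_eps_ne // (cut _ _ cM y q).
      rewrite co_eps // x'E eqxx andbT.
      case: (boolP (rl p q && rl (ij s).2 p)) => [/andP[-> ->] //|npj].
      transitivity (0 : k); last by case: ifP npj => //= _ /negbTE ->.
      have := same s; have := rng s => rs sm.
      case: (boolP (rl (ij s).1 q)) => iq.
        have := key s iq; rewrite (@co_out _ _ _ _ _ _ _ _ cN);
          first by rewrite if_same add0r.
        by move: npj sm rs sw iq; rewrite /tube /block_le; lia.
      by move: npj sm rs sw iq; rewrite /tube /block_le; lia.
  - have Y0 : y = 0 by apply: (two_term_eq0 P2).
    exists 0, 0; rewrite !raddf0 !ract0l ?oppr0 ?addr0; split=> //.
    change (P (-1) : Type) in x; change (ract x (eps p q) + diff P (-2) y = 0) in xy.
    apply: (co_inj (c := cM)) => s w sw; rewrite co0.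
    case: (w =P p) sw => [->|/eqP ne] sw; last exact: (cut _ _ cM x p).
    have jq : rl (ij s).2 q by move: sw; rewrite /block_le; lia.
    have rpq : rl p q by move: sw; rewrite /block_le; lia.
    have := congr1 (fun z : P (-1) => co cM z s q) xy.
    by rewrite Y0 raddf0 addr0 co_eps // rpq co0.
  - exists 0, 0; rewrite !raddf0 !ract0l ?oppr0 ?addr0.
    have X0 : x = 0 by apply: (two_term_eq0 P2); lia.
    have Y0 : y = 0 by apply: (two_term_eq0 P2); lia.
    by split.
(* The regular module as a complex. *)
pose S := two_term_complex (\0 : {linear zero_mod H^c -> (H^c)^o}).
have bS : bounded_proj S.
  apply: two_term_bounded; first exact/zero_fg_projective/zero_modP.
  by have [cR _] := reg_coords inc; apply: (coords_fg_projective cR).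
have QS := acyclic_mul_thick ee ee' e'f ff QP (gen_all S bS).
have [|||x' [y' [_ _ _ E]]] := QS (-1) (0 : zero_mod H^c) (eps q q) _ ff.
- exact: ract0l.
- exact: raddf0.
- by rewrite ract0l; apply: etrans (add0r _) _.
have {E} : eps q q = (x' : H) * eps p q by apply: etrans E (addr0 _).
move/(congr1 (fun h : H => crd h q q)); rewrite crd_eps qq !eqxx eps_mulr eqxx andbT.
rewrite crd_out ?if_same; first by move/eqP; rewrite oner_eq0.
by rewrite /block_le; lia.
Qed.

End Complex.

Theorem silted_tubing (A : falgType k) : silted H A ->
  exists (v : nat) (K : finType) (ij : K -> nat * nat),
    [/\ (v <= n)%N, tubing n v ij & isom_tubes ij A].
Proof.
case=> P [P2 [pre gen_all] isoA].
have [[/(_ (-1)) pM _] _] := pre; have [[/(_ 0) pN _] _] := pre.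
have [J [tau' [cM0 _]]] := torsion_free_coords (proj1 pM)
  (@fg_projective_torsion_free _ _ _ _ inc _ pM).
have [I [tau [cN0 _]]] := torsion_free_coords (proj1 pN)
  (@fg_projective_torsion_free _ _ _ _ inc _ pN).
pose d : {linear P (-1) -> P 0} := diff P (-1).
have [K [ij [cM [cN [ok diag]]]]] := diagonal_form d cM0 cN0 (leq0n n).
have rng s : ((ij s).1 <= (ij s).2 <= n.+1)%N.
  by have := ok s; rewrite /pair_ok /block_end /block_le ltn0; lia.
have nfull s : ij s <> (0%N, n.+1).
  by have := ok s => + e; rewrite e /pair_ok /block_end /block_le ltn0 /=; lia.
have nc := presilting_noncrossing P2 diag rng pre.
have sep := generating_separating P2 diag rng gen_all.
have [v vn tb] := tubing_split rng nfull nc sep.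
exists v, K, ij; split=> //.
have [blk _ _] := tb.
by apply/(isom_EndK_tubes P2 diag rng vn blk).
Qed.

End SiltingTubes.

(** * Retracts and cones in thick subcategories *)

Section Thick.
Variables (R : nzRingType) (P : complex R).

Lemma bounded_shift (X : complex R) : bounded_proj X -> bounded_proj (shift X).
Proof.
move=> [pX [a [b ab]]]; split=> [i|]; first exact: pX.
by exists (a - 1), (b - 1) => i ib; apply: ab; lia.
Qed.

Lemma thick_retract (X Y : complex R) (u : chain_map X Y) (w : chain_map Y X) :
  bounded_proj X -> (forall i (x : X i), w i (u i x) = x) -> thick P Y -> thick P X.
Proof.
move=> bX wu; apply: (thick_summand (i := u) (p := w)) => //.
by exists (fun i => \0) => i x /=; rewrite wu subrr raddf0 addr0.
Qed.

Lemma thick_zero (X : complex R) : bounded_proj X -> (forall i, zero_module (X i)) ->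
  thick P X.
Proof.
move=> bX X0; apply: (thick_retract (u := czero X P) (w := czero P X)) => //;
  last exact: thick_gen.
by move=> i x; rewrite (X0 _ x).
Qed.

Lemma pair_linear (M N1 N2 : lmodType R) (f : {linear M -> N1}) (g : {linear M -> N2}) :
  linear (fun x => (f x, g x) : (N1 * N2)%type).
Proof. by move=> a x y; rewrite !linearP. Qed.
Definition pair_lin (M N1 N2 : lmodType R) (f : {linear M -> N1})
  (g : {linear M -> N2}) :
  {linear M -> (N1 * N2)%type} := linear_pack (pair_linear f g).

Lemma fst_linear (N1 N2 : lmodType R) : linear (fun x : N1 * N2 => x.1).
Proof. by []. Qed.
Definition fst_lin (N1 N2 : lmodType R) : {linear (N1 * N2)%type -> N1} :=
  linear_pack (@fst_linear N1 N2).

Lemma snd_linear (N1 N2 : lmodType R) : linear (fun x : N1 * N2 => x.2).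
Proof. by []. Qed.
Definition snd_lin (N1 N2 : lmodType R) : {linear (N1 * N2)%type -> N2} :=
  linear_pack (@snd_linear N1 N2).

(** The complex X need not be the sum of the Y s, which are combined by
    iterated cones of zero maps; these contain shifts of the Y s, so it is
    the shift of X that embeds. *)
Lemma thick_sum (X : complex R) (I : Type) (r : seq I) (Y : I -> complex R)
    (al : forall s, chain_map X (Y s)) (be : forall s, chain_map (Y s) X) :
  bounded_proj X -> (forall s, thick P (Y s)) ->
  (forall i (x : X i), \sum_(s <- r) be s i (al s i x) = x) -> thick P X.
Proof.
move=> bX tY id_sum; apply: thick_unshift.
suff [Z [u [w [tZ wu]]]] : exists Z (u : chain_map (shift X) Z)
  (w : chain_map Z (shift X)),
    thick P Z /\ forall i (x : shift X i), w i (u i x) = \sum_(s <- r) be s (i + 1)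
      (al s (i + 1) x).
  apply: (thick_retract (u := u) (w := w)) => //; first exact: bounded_shift.
  by move=> i x; rewrite wu id_sum.
elim: r {id_sum} => [|s r [Z [u [w [tZ wu]]]]].
  exists P, (czero _ _), (czero _ _); split; first exact: thick_gen.
  by move=> i x; rewrite big_nil.
pose Z' := cone (czero (Y s) Z).
pose u' i : {linear shift X i -> Z' i} := pair_lin (al s (i + 1)) (u i).
pose w' i : {linear Z' i -> shift X i} :=
  (be s (i + 1) \o fst_lin _ _) \+ (w i \o snd_lin _ _).
have u'd i (x : shift X i) : u' (i + 1) (diff (shift X) i x) = diff Z' i (u' i x).
  have E1 : al s (i + 1 + 1) (- diff X (i + 1) x) = - diff (Y s) (i + 1)
    (al s (i + 1) x).
    by rewrite raddfN /= cmap_diff.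
  have E2 : u (i + 1) (diff (shift X) i x) = 0 + diff Z i (u i x).
    by rewrite cmap_diff; apply/esym/add0r.
  exact: (congr2 pair E1 E2).
have w'd i (x : Z' i) : w' (i + 1) (diff Z' i x) = diff (shift X) i (w' i x).
  case: x => y z.
  have E : be s (i + 1 + 1) (- diff (Y s) (i + 1) y) + w (i + 1) (0 + diff Z i z) =
     - diff X (i + 1) (be s (i + 1) y + w i z).
    have -> : (0 + diff Z i z) = diff Z i z by apply: add0r.
    rewrite raddfN /= !cmap_diff [in RHS]raddfD opprD; congr (_ + _).
  exact: E.
exists Z', (ChainMap u'd), (ChainMap w'd); split; first exact: thick_cone.
by move=> i x; rewrite big_cons -wu.
Qed.

Section Octahedron.
Variables (A B L : lmodType R) (be : {linear L -> B}) (al : {linear B -> A})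
  (ga : {linear L -> A}).
Hypothesis gaE : forall x, ga x = al (be x).
Hypotheses (pA : fg_projective A) (pB : fg_projective B) (pL : fg_projective L).
Let Xb := two_term_complex be.
Let Xa := two_term_complex al.
Let Xg := two_term_complex ga.
Let b2 : two_term Xb := @two_term_complexP _ _ _ be.
Let a2 : two_term Xa := @two_term_complexP _ _ _ al.
Let g2 : two_term Xg := @two_term_complexP _ _ _ ga.

(** One third of the octahedral axiom for the composite ga of L -> B -> A:
    the complex of al is a retract of the cone of the map from the complex
    of be to that of ga. *)
Lemma thick_cone_incl : thick P Xb -> thick P Xg -> thick P Xa.
Proof.
move=> tb tg.
have phi_comm (x : Xb (-1)) :
    (al : {linear Xb 0 -> Xg 0}) (diff Xb (-1) x) = diff Xg (-1)
      ((idfun : {linear Xb (-1) -> Xg (-1)}) x).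
  by rewrite /= gaE.
pose phi := two_term_map b2 g2 phi_comm.
pose C := cone phi.
pose u i : {linear Xa i -> C i} := match i return {linear Xa i -> C i} with
  | Negz 0 => pair_lin (idfun : {linear B -> B}) (\0 : {linear B -> L})
  | Posz 0 => pair_lin (\0 : {linear A -> zero_mod R}) (idfun : {linear A -> A})
  | _ => \0 end.
pose w i : {linear C i -> Xa i} := match i return {linear C i -> Xa i} with
  | Negz 0 => fst_lin B L \+ (be \o snd_lin B L)
  | Posz 0 => snd_lin (zero_mod R) A
  | _ => \0 end.
have C1 i (x y : C i) : x.1 = y.1 -> x.2 = y.2 -> x = y.
  by case: x y => [x1 x2] [y1 y2] /= -> ->.
have ud i (x : Xa i) : u (i + 1) (diff Xa i x) = diff C i (u i x).
  case: i x => [[|m]|[|m]] x.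
  - apply: C1; first exact: etrans (zero_modP _) (esym (zero_modP _)).
    exact: etrans (zero_modP _) (esym (zero_modP _)).
  - by rewrite (zero_modP x) !raddf0.
  - apply: C1; first exact: etrans (zero_modP _) (esym (zero_modP _)).
    have E : al x = al x + ga 0 by rewrite raddf0 addr0.
    exact: E.
  - by rewrite (zero_modP x) !raddf0.
have wd i (x : C i) : w (i + 1) (diff C i x) = diff Xa i (w i x).
  case: i x => [[|m]|[|[|m]]] [x y].
  - exact: etrans (zero_modP _) (esym (zero_modP _)).
  - exact: etrans (zero_modP _) (esym (zero_modP _)).
  - have E : al x + ga y = al (x + be y) by rewrite gaE raddfD.
    exact: E.
  - have E' : - be x + be (x + (0 : L)) = 0 by rewrite addr0 addNr.
    have y0 : y = 0 := zero_modP y.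
    rewrite y0; apply: etrans E' (esym _); exact: raddf0.
  - exact: etrans (zero_modP _) (esym (zero_modP _)).
apply: (thick_retract (u := ChainMap ud) (w := ChainMap wd)).
- exact: two_term_bounded.
- case=> [[|m]|[|m]] x //.
  + by rewrite (zero_modP x) !raddf0.
  + by rewrite /= raddf0 addr0.
  + by rewrite (zero_modP x) !raddf0.
- exact: thick_cone.
Qed.

(** The shift of the complex of be is a retract of the cone of the map from
    the complex of ga to that of al. *)
Lemma thick_cone_quot : thick P Xa -> thick P Xg -> thick P Xb.
Proof.
move=> ta tg; apply: thick_unshift.
have phi_comm (x : Xg (-1)) :
    (idfun : {linear Xg 0 -> Xa 0}) (diff Xg (-1) x) = diff Xa (-1)
      ((be : {linear Xg (-1) -> Xa (-1)}) x).
  by rewrite /= gaE.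
pose phi := two_term_map g2 a2 phi_comm.
pose C := cone phi; pose S := shift Xb.
pose u i : {linear S i -> C i} := match i return {linear S i -> C i} with
  | Negz 0 => pair_lin (\- al) (idfun : {linear B -> B})
  | Negz 1 => pair_lin (\- (idfun : {linear L -> L})) (\0 : {linear L -> zero_mod R})
  | _ => \0 end.
pose w i : {linear C i -> S i} := match i return {linear C i -> S i} with
  | Negz 0 => snd_lin A B
  | Negz 1 => \- (fst_lin L (zero_mod R))
  | _ => \0 end.
have C1 i (x y : C i) : x.1 = y.1 -> x.2 = y.2 -> x = y.
  by case: x y => [x1 x2] [y1 y2] /= -> ->.
have S0 i (x : S i) : (i != -1 - 1) && (i != -1) -> x = 0.
  by move=> ni; apply: (two_term_eq0 b2); lia.
have S1 i (x y : S i) : (i != -1 - 1) && (i != -1) -> x = y.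
  by move=> ni; rewrite (S0 _ x ni) (S0 _ y ni).
have ud i (x : S i) : u (i + 1) (diff S i x) = diff C i (u i x).
  case: i x => [m|[|[|m]]] x.
  - by rewrite (S0 _ x) ?raddf0 //; lia.
  - apply: C1; first exact: etrans (zero_modP _) (esym (zero_modP _)).
    have E : 0 = - al x + al x by rewrite addNr.
    exact: E.
  - have E1 : - al (- be x) = - ga (- x) by rewrite gaE !raddfN.
    have E2 : - be x = be (- x) + (0 : B) by rewrite raddfN addr0.
    exact: (congr2 pair E1 E2).
  - by rewrite (S0 _ x) ?raddf0 //; lia.
have wd i (x : C i) : w (i + 1) (diff C i x) = diff S i (w i x).
  case: i x => [m|[|[|[|m]]]] [x y].
  - by apply: S1; lia.
  - by apply: S1; lia.
  - have y0 : y = 0 := zero_modP y.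
    have E : be x + (0 : B) = - be (- x) by rewrite raddfN opprK addr0.
    rewrite y0; apply: etrans E => //; congr (be x + _); exact: raddf0.
  - have x0 : x = 0 := zero_modP x.
    have y0 : y = 0 := zero_modP y.
    by rewrite x0 y0 !raddf0.
  - by apply: S1; lia.
apply: (thick_retract (u := ChainMap ud) (w := ChainMap wd)).
- by apply: bounded_shift; apply: two_term_bounded.
- case=> [m|[|[|m]]] x //.
  + by rewrite (S0 _ x) ?raddf0 //; lia.
  + exact: opprK.
  + by rewrite (S0 _ x) ?raddf0 //; lia.
- exact: thick_cone.
Qed.

End Octahedron.
End Thick.

(** * Truncation of complexes *)

Section Truncation.
Variable R : nzRingType.

(** M or 0. A case distinction in the module, instead of one on the degree,
    keeps the types of differentials uniform in the truncations below. *)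
Definition bmod (b : bool) (M : lmodType R) : lmodType R := if b then M else zero_mod R.
Definition bin b (M : lmodType R) : {linear M -> bmod b M} :=
  if b return {linear M -> bmod b M} then idfun else \0.
Definition bout b (M : lmodType R) : {linear bmod b M -> M} :=
  if b return {linear bmod b M -> M} then idfun else \0.

Lemma boutK b (M : lmodType R) (x : bmod b M) : bin b M (bout b M x) = x.
Proof. by case: b x => x //; rewrite (zero_modP x). Qed.

Lemma binK b (M : lmodType R) (x : M) : bout b M (bin b M x) = if b then x else 0.
Proof. by case: b. Qed.

Lemma bout_out b (M : lmodType R) (x : bmod b M) : ~~ b -> bout b M x = 0.
Proof. by case: b x. Qed.

Lemma bmodK b b' (M : lmodType R) (x : bmod b M) : b' = b ->
  bin b M (bout b' M (bin b' M (bout b M x))) = x.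
Proof. by move=> ->; rewrite !boutK. Qed.

Lemma bout_inj b (M : lmodType R) : injective (bout b M).
Proof. exact: can_inj (@boutK b M). Qed.

Lemma bmod_fg_projective b (M : lmodType R) : fg_projective M ->
  fg_projective (bmod b M).
Proof. by case: b => // _; apply: zero_fg_projective => x; apply: zero_modP. Qed.

Section Trunc.
Variables (p : int -> bool) (X : complex R).

Definition trunc_diff i : {linear bmod (p i) (X i) -> bmod (p (i + 1)) (X (i + 1))} :=
  bin (p (i + 1)) (X (i + 1)) \o diff X i \o bout (p i) (X i).

Lemma trunc_diffK i (x : bmod (p i) (X i)) : trunc_diff (i + 1) (trunc_diff i x) = 0.
Proof. by rewrite /= binK; case: ifP => _; rewrite ?diffK !raddf0. Qed.

Definition trunc : complex R := Complex trunc_diffK.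

Lemma trunc_bounded : bounded_proj X -> bounded_proj trunc.
Proof.
move=> [pX [a [b ab]]]; split=> [i|]; first exact: bmod_fg_projective.
exists a, b => i /ab X0 x; apply: (@bout_inj (p i)).
by rewrite (X0 (bout _ _ x)) raddf0.
Qed.

Lemma trunc_zero : (forall i, p i -> zero_module (X i)) -> forall i,
  zero_module (trunc i).
Proof.
move=> pX i x; apply: (@bout_inj (p i)); rewrite raddf0.
have [/pX X0|np] : p i \/ ~~ p i by case: (p i); [left|right].
  exact: X0.
exact: bout_out.
Qed.
End Trunc.

Definition const_complex (M : lmodType R) : complex R.
Proof. by exists (fun _ => M) (fun _ => (\0 : {linear M -> M})). Defined.

Definition stalk (c : int) (M : lmodType R) : complex R :=
  trunc (fun i => i == c) (const_complex M).

Lemma stalk_bounded c M : fg_projective M -> bounded_proj (stalk c M).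
Proof.
move=> pM; split=> [i|]; first exact: bmod_fg_projective.
exists c, c => i ic x; apply: (@bout_inj (i == c)); rewrite raddf0; apply: bout_out;
  lia.
Qed.

Variable P : complex R.

(** The shift of a stalk complex is isomorphic, not equal, to the next stalk
    complex. *)
Lemma thick_stalk_shift c M : fg_projective M ->
  thick P (stalk c M) <-> thick P (stalk (c + 1) M).
Proof.
move=> pM; pose S := stalk c M; pose S' := shift (stalk (c + 1) M).
pose u i : {linear S i -> S' i} := bin (i + 1 == c + 1) M \o bout (i == c) M.
pose w i : {linear S' i -> S i} := bin (i == c) M \o bout (i + 1 == c + 1) M.
have S0 i (x : S i) : diff S i x = 0 by exact: raddf0.
have S0' i (x : S' i) : diff S' i x = 0.
  have E : diff (stalk (c + 1) M) (i + 1) x = 0 by exact: raddf0.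
  exact: etrans (congr1 (fun z => - z) E) (oppr0 _).
have ud i (x : S i) : u (i + 1) (diff S i x) = diff S' i (u i x) by rewrite S0 S0'
  raddf0.
have wd i (x : S' i) : w (i + 1) (diff S' i x) = diff S i (w i x) by rewrite S0 S0'
  raddf0.
have eqi i : (i + 1 == c + 1) = (i == c) by lia.
have wu i (x : S i) : w i (u i x) = x by apply: (bmodK (b := i == c)).
have uw i (x : S' i) : u i (w i x) = x by apply: (bmodK (b := i + 1 == c + 1));
  rewrite eqi.
split=> t.
  apply: thick_unshift; apply: (thick_retract (u := ChainMap wd) (w := ChainMap ud)) t
    => //.
  by apply: bounded_shift; apply: stalk_bounded.
apply: (thick_retract (u := ChainMap ud) (w := ChainMap wd)) (thick_shift t) => //.
exact: stalk_bounded.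
Qed.

Lemma thick_stalk M : fg_projective M -> thick P (stalk 0 M) -> forall c,
  thick P (stalk c M).
Proof.
move=> pM t0; elim/int_rect => [//|m IH|m IH].
  by rewrite (_ : m.+1%:Z = m%:Z + 1); [exact: (proj1 (thick_stalk_shift _ pM))|lia].
by apply: (proj2 (thick_stalk_shift _ pM)); rewrite (_ : - m.+1%:Z + 1 = - m%:Z) //;
  lia.
Qed.

(** A bounded complex is an iterated extension of its stalks: the shift of
    the part in degrees at least c is a retract of the cone of the
    differential from the stalk in degree c to the shift of the part in
    degrees at least c + 1. *)
Lemma thick_trunc (X : complex R) : bounded_proj X ->
  (forall c, thick P (trunc (fun i => i == c) X)) -> thick P X.
Proof.
move=> bX tX; have [pX [a [b ab]]] := bX.
pose T c := trunc (fun i => c <= i)%R X.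
have step c : thick P (T (c + 1)) -> thick P (T c).
  move=> tc; apply: thick_unshift.
  pose X1 := trunc (fun i => i == c) X; pose Y1 := shift (T (c + 1)).
  pose del i : {linear X1 i -> Y1 i} :=
    bin (c + 1 <= i + 1) (X (i + 1)) \o diff X i \o bout (i == c) (X i).
  have deld i (x : X1 i) : del (i + 1) (diff X1 i x) = diff Y1 i (del i x).
    rewrite /= !binK; case: ifP => _; case: ifP => _; rewrite ?diffK ?raddf0 ?oppr0 //.
  pose C := cone (ChainMap deld); pose S := shift (T c).
  pose u i : {linear S i -> C i} := pair_lin
     (\- (bin (i + 1 == c) (X (i + 1)) \o bout (c <= i + 1) (X (i + 1))))
     (bin (c + 1 <= i + 1) (X (i + 1)) \o bout (c <= i + 1) (X (i + 1))).
  pose w i : {linear C i -> S i} :=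
    (\- (bin (c <= i + 1) (X (i + 1)) \o bout (i + 1 == c) (X (i + 1)) \o fst_lin _
      _)) \+
    (bin (c <= i + 1) (X (i + 1)) \o bout (c + 1 <= i + 1) (X (i + 1)) \o snd_lin _ _).
  have ud i (x : S i) : u (i + 1) (diff S i x) = diff C i (u i x).
    pose bx := bout (c <= i + 1) (X (i + 1)) x.
    have b0 : (c <= i + 1) = false -> bx = 0 by move=> /negbT; apply: bout_out.
    have E1 : - bin (i + 1 + 1 == c) (X (i + 1 + 1))
      (bout (c <= i + 1 + 1) (X (i + 1 + 1))
         (- bin (c <= i + 1 + 1) (X (i + 1 + 1)) (diff X (i + 1) bx))) =
       - bin (i + 1 + 1 == c) (X (i + 1 + 1))
         (diff X (i + 1) (bout (i + 1 == c) (X (i + 1))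
           (- bin (i + 1 == c) (X (i + 1)) bx))).
      congr (- _); apply: bout_inj; rewrite ?raddfN /= ?raddfN /= ?binK ?raddfN /=
        ?binK; congr (- _).
      do 3?[case: ifP => ?]; rewrite ?raddf0 //; try (by exfalso; lia).
      by rewrite b0 ?raddf0 //; lia.
    have E2 : bin (c + 1 <= i + 1 + 1) (X (i + 1 + 1))
      (bout (c <= i + 1 + 1) (X (i + 1 + 1))
         (- bin (c <= i + 1 + 1) (X (i + 1 + 1)) (diff X (i + 1) bx))) =
       bin (c + 1 <= i + 1 + 1) (X (i + 1 + 1))
         (diff X (i + 1) (bout (i + 1 == c) (X (i + 1))
           (- bin (i + 1 == c) (X (i + 1)) bx))) +
       - bin (c + 1 <= i + 1 + 1) (X (i + 1 + 1))
         (diff X (i + 1) (bout (c + 1 <= i + 1) (X (i + 1))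
           (bin (c + 1 <= i + 1) (X (i + 1)) bx))).
      apply: bout_inj; rewrite [RHS]raddfD /= ?raddfN /= ?raddfN /= ?binK ?raddfN /=
        ?binK.
      do 5?[case: ifP => ?]; rewrite ?raddf0 ?oppr0 ?addr0 ?add0r //;
        try (by exfalso; lia).
    exact: (congr2 pair E1 E2).
  have wd i (x : C i) : w (i + 1) (diff C i x) = diff S i (w i x).
    case: x => y z; pose by' := bout (i + 1 == c) (X (i + 1)) y.
    pose bz := bout (c + 1 <= i + 1) (X (i + 1)) z.
    have y0 : (i + 1 == c) = false -> by' = 0 by move=> /negbT; apply: bout_out.
    have z0 : (c + 1 <= i + 1) = false -> bz = 0 by move=> /negbT; apply: bout_out.
    have E : - bin (c <= i + 1 + 1) (X (i + 1 + 1))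
      (bout (i + 1 + 1 == c) (X (i + 1 + 1))
        (- bin (i + 1 + 1 == c) (X (i + 1 + 1)) (diff X (i + 1) by'))) +
      bin (c <= i + 1 + 1) (X (i + 1 + 1)) (bout (c + 1 <= i + 1 + 1) (X (i + 1 + 1))
        (bin (c + 1 <= i + 1 + 1) (X (i + 1 + 1)) (diff X (i + 1) by') +
         - bin (c + 1 <= i + 1 + 1) (X (i + 1 + 1)) (diff X (i + 1) bz))) =
      - bin (c <= i + 1 + 1) (X (i + 1 + 1)) (diff X (i + 1)
        (bout (c <= i + 1) (X (i + 1))
          (- bin (c <= i + 1) (X (i + 1)) by' + bin (c <= i + 1) (X (i + 1)) bz))).
      apply: bout_inj; rewrite ?(raddfN, raddfD) /= ?(raddfN, raddfD) /= ?binK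
        ?(raddfN, raddfD) /= ?binK.
      do 5?[case: ifP => ?]; rewrite ?raddf0 ?oppr0 ?addr0 ?add0r ?opprK //;
        try (by exfalso; lia);
        rewrite ?[by']y0 ?[bz]z0 ?raddf0 ?oppr0 ?addr0 ?add0r ?opprK //; lia.
    exact: E.
  apply: (thick_retract (u := ChainMap ud) (w := ChainMap wd)).
  - by apply: bounded_shift; apply: trunc_bounded.
  - move=> i x; pose bx := bout (c <= i + 1) (X (i + 1)) x.
    have b0 : (c <= i + 1) = false -> bx = 0 by move=> /negbT; apply: bout_out.
    have E : - bin (c <= i + 1) (X (i + 1)) (bout (i + 1 == c) (X (i + 1))
        (- bin (i + 1 == c) (X (i + 1)) bx)) +
       bin (c <= i + 1) (X (i + 1)) (bout (c + 1 <= i + 1) (X (i + 1))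
        (bin (c + 1 <= i + 1) (X (i + 1)) bx)) = x.
      apply: bout_inj; rewrite -/bx ?(raddfN, raddfD) /= ?(raddfN, raddfD) /= ?binK
        ?(raddfN, raddfD) /= ?binK.
      do 5?[case: ifP => ?]; rewrite ?raddf0 ?oppr0 ?addr0 ?add0r ?opprK //;
        try (by exfalso; lia).
      by rewrite b0 //; lia.
    exact: E.
  - apply: thick_cone; first exact: tX.
    exact: thick_shift.
have down m : thick P (T (b + 1 - m%:Z)).
  elim: m => [|m IH].
    rewrite subr0; apply: thick_zero; first exact: trunc_bounded.
    by apply: trunc_zero => i bi; apply: ab; lia.
  by apply: step; rewrite (_ : b + 1 - m.+1%:Z + 1 = b + 1 - m%:Z) //; lia.
have [m am] : exists m : nat, b + 1 - m%:Z <= a.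
  by exists (`|(b + 1 - a)%R|)%N; lia.
set c := b + 1 - m%:Z in am; have tc := down m; rewrite -/c in tc.
have pc i : (c <= i) = false -> zero_module (X i) by move=> ci; apply: ab; lia.
pose u i : {linear X i -> T c i} := bin (c <= i) (X i).
pose w i : {linear T c i -> X i} := bout (c <= i) (X i).
have ud i (x : X i) : u (i + 1) (diff X i x) = diff (T c) i (u i x).
  rewrite /= binK; case: ifP => // ci.
  by rewrite (pc _ ci x) !raddf0.
have wd i (x : T c i) : w (i + 1) (diff (T c) i x) = diff X i (w i x).
  rewrite /= binK; case: ifP => // ci.
  by rewrite (pc _ ci (diff X i _)).
apply: (thick_retract (u := ChainMap ud) (w := ChainMap wd)) => // i x.
by rewrite /= binK; case: ifP => // ci; rewrite (pc _ ci x).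
Qed.
End Truncation.

(** * Tubings give silting complexes *)

(** Think of E i j as: the complex P_j -> P_i is in a given thick
    subcategory. For i < j < l, the octahedral axiom gives any one of E i j,
    E j l, E i l from the other two. The claim is proved by descent in the
    binary tree: if i is left of the root r of (a, b), then E i r holds by
    induction for the left subtube (a, r), so that E a i and then E i b
    follow. *)
Lemma tube_generation n (T : nat -> nat -> bool) (E : nat -> nat -> Prop) :
  (forall i j, T i j -> (j <= n.+1)%N) ->
  (forall i j k l, T i j -> T k l -> ~~ crossing (i, j) (k, l)) ->
  (forall p q, (p < q <= n)%N -> exists i j, T i j /\ tube (i, j) p != tube (i, j) q) ->
  (forall i j, T i j -> E i j) ->
  (forall k a l, (k < a < l)%N -> (l <= n.+1)%N -> E k a -> E k l -> E a l) ->
  (forall a b l, (a < b < l)%N -> (l <= n.+1)%N -> E b l -> E a l -> E a b) ->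
  forall a b, T a b -> forall i, (a <= i < b)%N -> E i b.
Proof.
move=> T_le T_nc T_sep TE quot incl a b.
have [N] := ubnP (b - a)%N; elim: N a b => // N IHN a b ltN Tab i iab.
have bn := T_le _ _ Tab.
have [|r rab [left_r right_r]] := tube_root T_le T_nc T_sep Tab; first by lia.
case: (ltngtP a i) => [ai|ia|<-]; [|lia|exact: TE].
case: (leqP i r) => ir; last first.
  have Trb : T r.+1 b by case: right_r => // e; lia.
  by apply: (IHN r.+1 b) => //; lia.
have Tar : T a r by case: left_r => // e; lia.
have Eai : E a i.
  case: (ltngtP i r) => [ir'|ri|->]; [|lia|exact: TE].
  apply: (incl a i r); [lia|lia| |exact: TE].
  by apply: (IHN a r) => //; lia.
by apply: (quot a i b) => //; [lia|exact: TE].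
Qed.

Section StdSilting.
Variables (k : fieldType) (H : falgType k) (n : nat) (inc : incidence H n 0).
Local Notation rl := (block_le n 0).
Local Notation eps := (eps inc).
Local Notation crd := (crd inc).
Variables (v : nat) (K : finType) (ij : K -> nat * nat).
Hypothesis vn : (v <= n)%N.
Hypothesis tb : tubing n v ij.
Let blk : forall s, in_blocks n v (ij s) := let: And3 b _ _ := tb in b.
Let nc : noncrossing ij := let: And3 _ b _ := tb in b.
Let sep : separating n ij := let: And3 _ _ b := tb in b.
Lemma tubing_range s : ((ij s).1 <= (ij s).2 <= n.+1)%N.
Proof. by have := blk s; rewrite /in_blocks; lia. Qed.
Let rng := tubing_range.

Let M : lmodType H^c := fmod_of (proj_shape n 0 (fun s => (ij s).2)) inc.
Let N : lmodType H^c := fmod_of (proj_shape n 0 (fun s => (ij s).1)) inc.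
Let cM : coords inc M (fun s => rl (ij s).2) :=
  fmod_coord inc (proj_shape n 0 (fun s => (ij s).2)).
Let cN : coords inc N (fun s => rl (ij s).1) :=
  fmod_coord inc (proj_shape n 0 (fun s => (ij s).1)).

Lemma std_adm s : admissible n 0 (rl (ij s).2) (rl (ij s).1).
Proof. by have := rng s => r p q; move: r; rewrite /block_le; lia. Qed.

Definition std_diff : {linear M -> N} := diag_map cM cN std_adm.
Definition std_complex : complex H^c := two_term_complex std_diff.
Local Notation P := std_complex.
Let P2 : two_term P := @two_term_complexP _ _ _ std_diff.
Let pM : fg_projective M := coords_fg_projective cM.
Let pN : fg_projective N := coords_fg_projective cN.

Lemma std_diagonal : diagonal std_diff cM cN.
Proof. by move=> x s p sp; rewrite co_diag_map sp. Qed.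

(** The entries of a map from degree -1 to degree 0 are maps from P_j to
    P_k. They factor through P_l when l <= j, and otherwise through P_i,
    because the tubes (i, j) and (k, l) do not cross. *)
Lemma std_presilting : presilting P.
Proof.
apply: factor_presilting => //; first exact: two_term_bounded.
move=> phi; pose phi' : {linear M -> N} := phi.
pose C s t := co cN (phi' (gen cM s (ij s).2)) t (ij s).2.
have Cle s t : C s t != 0 -> rl (ij t).1 (ij s).2.
  by apply: contraNT => np; apply/eqP/(co_out cN).
pose A s t := if ((ij t).2 <= (ij s).2)%N then C s t else 0.
pose B s t := if ((ij t).2 <= (ij s).2)%N then 0 else C s t.
have admA s t : A s t != 0 -> admissible n 0 (rl (ij s).2) (rl (ij t).2).
  rewrite /A; case: ifP => [le _ p q|_]; last by rewrite eqxx.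
  by move: le; rewrite /block_le; lia.
have admB s t : B s t != 0 -> admissible n 0 (rl (ij s).1) (rl (ij t).1).
  rewrite /B; case: ifP => [|le /Cle ki p q]; first by rewrite eqxx.
  have := nc s t; have := rng s; have := rng t; rewrite /crossing.
  by move: le ki; rewrite /block_le; lia.
exists (matrix_map cM cM admA), (matrix_map cN cN admB) => x.
change (phi' x = std_diff (matrix_map cM cM admA x) + matrix_map cN cN admB
  (std_diff x)).
apply: (co_inj (c := cN)) => t p tp; rewrite coD co_diag_map tp !co_matrix_map tp
  (proj_matrix phi' cM cN).
have -> : (if rl (ij t).2 p then \sum_s co cM x s p * A s t else 0) =
   \sum_s co cM x s p * (if rl (ij t).2 p then A s t else 0).
  by case: ifP => // _; rewrite big1 // => s _; rewrite mulr0.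
rewrite -big_split; apply: eq_bigr => s _ /=; rewrite co_diag_map -/(C s t).
case: (boolP (rl (ij s).2 p)) => sp; last by rewrite co_out ?if_same ?mul0r ?addr0.
rewrite /A /B; case: (boolP (_ <= _)%N) => le.
  rewrite mulr0 addr0 (_ : rl (ij t).2 p) //.
  by have := rng t; move: le sp tp; rewrite /block_le; lia.
rewrite if_same mulr0 add0r; case: (C s t =P 0) => [->|/eqP/Cle ki];
  first by rewrite !mulr0.
rewrite (_ : rl (ij s).1 p) //.
have := nc s t; have := rng s; have := rng t; rewrite /crossing.
by move: le ki tp sp; rewrite /block_le; lia.
Qed.

(** The indecomposable projective of the point a, zero if a is 0 or n + 1. *)
Definition Qmod (a : nat) : lmodType H^c := fmod_of
  (proj_shape n 0 (fun _ : unit => a)) inc.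
Definition cQ (a : nat) : coords inc (Qmod a) (fun _ : unit => rl a) :=
  fmod_coord inc (proj_shape n 0 (fun _ : unit => a)).

Lemma Qmod_fg_projective a : fg_projective (Qmod a).
Proof. exact: (coords_fg_projective (cQ a)). Qed.

Lemma Qmod_zero a : ~~ rl a a -> zero_module (Qmod a).
Proof.
move=> na x; apply: (co_inj (c := cQ a)) => s p ap.
by rewrite (block_le_refll ap) in na.
Qed.

Lemma iota_adm a b (s t : unit) : ((a <= b)%N%:R : k) != 0 ->
  admissible n 0 (rl b) (rl a).
Proof.
case: leqP => [ab _ p q|_]; last by rewrite eqxx.
by move: ab; rewrite /block_le; lia.
Qed.
Definition Qincl b a : {linear Qmod b -> Qmod a} :=
  matrix_map (cQ b) (cQ a) (@iota_adm a b).
Lemma co_Qincl b a x s p : (a <= b)%N -> co (cQ a) (Qincl b a x) s p =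
  if rl a p then co (cQ b) x s p else 0.
Proof.
move=> ab; rewrite co_matrix_map; case: ifP => // _.
by rewrite (bigD1 s) //= ab mulr1 big1 ?addr0 // => -[]; case: s.
Qed.

(** The cone of the inclusion of P_b in P_a is in the thick subcategory
    generated by P. *)
Definition edge a b : Prop := thick P (two_term_complex (Qincl b a)).

Lemma Qincl_comp a b l x : (a <= b <= l)%N -> (l <= n.+1)%N ->
  Qincl l a x = Qincl b a (Qincl l b x).
Proof.
move=> abl ln; apply: (co_inj (c := cQ a)) => s p ap; rewrite !co_Qincl ?ap; try lia.
case: (boolP (rl l p)) => lp; last by rewrite co_out // if_same.
by rewrite (_ : rl b p) //; move: ap lp; rewrite /block_le; lia.
Qed.

Lemma edge_tube s : edge (ij s).1 (ij s).2.
Proof.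
have admU (tau : K -> nat) (x : unit) (t : K) :
    ((t == s)%:R : k) != 0 -> admissible n 0 (rl (tau s)) (rl (tau t)).
  by case: (t =P s) => [->|_]; rewrite ?eqxx // => _ p q pq sp sq; rewrite sp sq.
have admW (tau : K -> nat) (t : K) (x : unit) :
    ((t == s)%:R : k) != 0 -> admissible n 0 (rl (tau t)) (rl (tau s)).
  by case: (t =P s) => [->|_]; rewrite ?eqxx // => _ p q pq sp sq; rewrite sp sq.
pose X := two_term_complex (Qincl (ij s).2 (ij s).1).
have X2 : two_term X := @two_term_complexP _ _ _ (Qincl (ij s).2 (ij s).1).
pose u1 : {linear Qmod (ij s).2 -> M} := matrix_map (cQ _) cM
  (@admU (fun t => (ij t).2)).
pose u0 : {linear Qmod (ij s).1 -> N} := matrix_map (cQ _) cN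
  (@admU (fun t => (ij t).1)).
pose w1 : {linear M -> Qmod (ij s).2} := matrix_map cM (cQ _)
  (@admW (fun t => (ij t).2)).
pose w0 : {linear N -> Qmod (ij s).1} := matrix_map cN (cQ _)
  (@admW (fun t => (ij t).1)).
have unitE (F : unit -> k) : \sum_x F x = F tt.
  by rewrite (bigD1 tt) //= big1 ?addr0 // => -[].
have rs := rng s.
have uc x : u0 (Qincl (ij s).2 (ij s).1 x) = std_diff (u1 x).
  apply: (co_inj (c := cN)) => t p tp; rewrite co_diag_map tp !co_matrix_map tp !unitE.
  rewrite co_Qincl; last by lia.
  case: (t =P s) tp => [->|_] tp; last by rewrite !mulr0 if_same.
  by rewrite tp; case: ifP => // /negbT np; rewrite co_out ?mul0r.
have wc x : w0 (std_diff x) = Qincl (ij s).2 (ij s).1 (w1 x).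
  apply: (co_inj (c := cQ _)) => t p tp; rewrite co_Qincl ?tp; last by lia.
  rewrite !co_matrix_map tp !sum_delta co_diag_map tp.
  by case: ifP => // /negbT np; rewrite co_out.
have w1u1 x : w1 (u1 x) = x.
  apply: (co_inj (c := cQ _)) => -[] p tp; rewrite co_matrix_map tp sum_delta
    co_matrix_map tp unitE.
  by rewrite eqxx mulr1.
have w0u0 x : w0 (u0 x) = x.
  apply: (co_inj (c := cQ _)) => -[] p tp; rewrite co_matrix_map tp sum_delta
    co_matrix_map tp unitE.
  by rewrite eqxx mulr1.
apply: (thick_retract (u := @two_term_map _ X P X2 P2 u1 u0 uc)
                      (w := @two_term_map _ P X P2 X2 w1 w0 wc)).
- by apply: two_term_bounded; apply: Qmod_fg_projective.
- case=> [[|m]|[|m]] x.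
  + exact: w0u0.
  + exact: etrans (zero_modP _) (esym (zero_modP _)).
  + exact: w1u1.
  + exact: etrans (zero_modP _) (esym (zero_modP _)).
- exact: thick_gen.
Qed.

(** The tube (0, n + 1), whose complex is zero, may be added to the tubing;
    all points are in it, so that [tube_generation] applies to every i. *)
Lemma edge_last i : (i <= n)%N -> edge i n.+1.
Proof.
(* Empty tubes are left out, and the full interval is added. *)
pose T a b := (tubes ij a b && (a < b)%N) || ((a == 0%N) && (b == n.+1)).
have le_n a b : T a b -> (b <= n.+1)%N.
  by case/orP=> [/andP[/tubesP[s es] _]|]; [have := rng s; rewrite es /=; lia|lia].
move=> iln; apply: (@tube_generation n T edge _ _ _ _ _ _ 0%N n.+1) => //;
  last by rewrite /T !eqxx orbT.
- move=> a b e f /orP[/andP[/tubesP[s es] _]|/andP[/eqP -> /eqP ->]]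
  /orP[/andP[/tubesP[t et] _]|/andP[/eqP -> /eqP ->]].
  + by have := nc s t; rewrite es et.
  + by rewrite /crossing /=; lia.
  + by have := rng t; rewrite et /crossing /=; lia.
  + by rewrite /crossing /=; lia.
- move=> p q /sep[s ne]; exists (ij s).1, (ij s).2; split;
  last by rewrite -surjective_pairing.
  apply/orP; left; apply/andP; split; first by apply/tubesP; exists s;
    rewrite -surjective_pairing.
  by move: ne; rewrite /tube; lia.
- move=> a b /orP[/andP[/tubesP[s es] _]|/andP[/eqP -> /eqP ->]].
    by have := edge_tube s; rewrite es.
  apply: thick_zero; first by apply: two_term_bounded; apply: Qmod_fg_projective.
  case=> [[|m]|[|m]] x; try exact: zero_modP; apply: Qmod_zero; rewrite /block_le; lia.
- move=> a b l abl ln; apply: thick_cone_quot; try exact: Qmod_fg_projective.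
  by move=> x; apply: Qincl_comp => //; lia.
- move=> a b l abl ln; apply: thick_cone_incl; try exact: Qmod_fg_projective.
  by move=> x; apply: Qincl_comp => //; lia.
Qed.

(** The complex P_(n + 1) -> P_a is the stalk of P_a. *)
Lemma thick_stalk_Q a c : thick P (stalk c (Qmod a)).
Proof.
apply: thick_stalk; first exact: Qmod_fg_projective.
have pS := stalk_bounded 0 (Qmod_fg_projective a).
case: (boolP (rl a a)) => ra; last first.
  apply: thick_zero => // i; apply: trunc_zero => j _; exact: Qmod_zero.
pose S := stalk 0 (Qmod a); pose X := two_term_complex (Qincl n.+1 a).
pose u i : {linear S i -> X i} := match i return {linear S i -> X i} with
  | Posz 0 => idfun | _ => \0 end.
pose w i : {linear X i -> S i} := match i return {linear X i -> S i} with
  | Posz 0 => idfun | _ => \0 end.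
have Q0 (x : Qmod n.+1) : x = 0 by apply: Qmod_zero; rewrite /block_le; lia.
have S0 i (x : S i) : diff S i x = 0 by exact: raddf0.
have X0 i (x : X i) : diff X i x = 0.
  by case: i x => [[|m]|[|m]] x //; rewrite (Q0 x) raddf0.
have ud i (x : S i) : u (i + 1) (diff S i x) = diff X i (u i x).
  by rewrite S0 X0 raddf0.
have wd i (x : X i) : w (i + 1) (diff X i x) = diff S i (w i x).
  by rewrite S0 X0 raddf0.
apply: (thick_retract (u := ChainMap ud) (w := ChainMap wd)) => //.
  by case=> [[|m]|m] x //; apply: etrans (zero_modP _) (esym (zero_modP _)).
by apply: edge_last; move: ra; rewrite /block_le; lia.
Qed.

Lemma std_generates X : bounded_proj X -> thick P X.
Proof.
move=> bX; apply: thick_trunc => // c; have [pX _] := bX.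
have [I [tau [cX _]]] := torsion_free_coords (inc := inc) (proj1 (pX c))
   (@fg_projective_torsion_free _ _ _ _ inc _ (pX c)).
have admA (s t : I) (x : unit) : ((t == s)%:R : k) != 0 ->
  admissible n 0 (rl (tau t)) (rl (tau s)).
  by case: (t =P s) => [->|_]; rewrite ?eqxx // => _ p q pq sp sq; rewrite sp sq.
have admB (s : I) (x : unit) (t : I) : ((t == s)%:R : k) != 0 ->
  admissible n 0 (rl (tau s)) (rl (tau t)).
  by case: (t =P s) => [->|_]; rewrite ?eqxx // => _ p q pq sp sq; rewrite sp sq.
pose al0 s : {linear X c -> Qmod (tau s)} := matrix_map cX (cQ _) (@admA s).
pose be0 s : {linear Qmod (tau s) -> X c} := matrix_map (cQ _) cX (@admB s).
have albe0 x : \sum_s be0 s (al0 s x) = x.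
  apply: (co_inj (c := cX)) => t p tp; rewrite co_sum (bigD1 t) //=.
  rewrite co_matrix_map tp (bigD1 tt) //= [X in _ + X + _]big1 ?addr0; last by case.
  rewrite eqxx mulr1 co_matrix_map tp sum_delta big1 ?addr0 // => s ne.
  rewrite co_matrix_map tp big1 // => y _.
  by rewrite eq_sym (negbTE ne) mulr0.
(* The maps to and from the summands are extended by 0 to the degrees other
   than c. *)
have ch i : exists ab : forall s : I, {linear X i -> Qmod (tau s)} *
  {linear Qmod (tau s) -> X i},
    i = c -> forall x, \sum_s (ab s).2 ((ab s).1 x) = x.
  case: (i =P c) => [->|ne]; first by exists (fun s => (al0 s, be0 s)).
  by exists (fun s => ((\0 : {linear X i -> Qmod (tau s)}),
    (\0 : {linear Qmod (tau s) -> X i}))) => /ne.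
have ab i := constructive_indefinite_description _ (ch i).
pose al i s := (sval (ab i) s).1; pose be i s := (sval (ab i) s).2.
have albe i : i = c -> forall x, \sum_s be i s (al i s x) = x by apply: (svalP (ab i)).
pose Y s := stalk c (Qmod (tau s)).
pose Z := trunc (fun i => i == c) X.
pose f s i : {linear Z i -> Y s i} := bin (i == c) (Qmod (tau s)) \o al i s \o bout
  (i == c) (X i).
pose g s i : {linear Y s i -> Z i} := bin (i == c) (X i) \o be i s \o bout (i == c)
  (Qmod (tau s)).
have Z0 i (x : Z i) : diff Z i x = 0.
  apply: (@bout_inj _ (i + 1 == c)); rewrite raddf0 /= binK; case: ifP => // ic.
  by rewrite bout_out ?raddf0 //; lia.
have Y0 s i (x : Y s i) : diff (Y s) i x = 0 by exact: raddf0.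
have fd s i (x : Z i) : f s (i + 1) (diff Z i x) = diff (Y s) i (f s i x).
  by rewrite Z0 Y0 raddf0.
have gd s i (x : Y s i) : g s (i + 1) (diff (Y s) i x) = diff Z i (g s i x).
  by rewrite Z0 Y0 raddf0.
apply: (@thick_sum _ P Z I (index_enum I) Y (fun s => ChainMap (fd s))
  (fun s => ChainMap (gd s))).
- exact: trunc_bounded.
- by move=> s; apply: thick_stalk_Q.
move=> i x; apply: (@bout_inj _ (i == c)); rewrite raddf_sum.
have E' b s (y : bmod b (X i)) : bout b (X i) (bin b (X i) (be i s
    (bout b (Qmod (tau s)) (bin b (Qmod (tau s)) (al i s (bout b (X i) y)))))) =
    if b then be i s (al i s (bout b (X i) y)) else 0.
  by case: b y.
have E s : bout (i == c) (X i) (g s i (f s i x)) =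
    if i == c then be i s (al i s (bout (i == c) (X i) x)) else 0 by apply: E'.
transitivity (\sum_s (if i == c then be i s (al i s (bout (i == c) (X i) x)) else 0)).
  by apply: eq_bigr => s _; apply: E.
have [ic|ic] : (i == c) = true \/ (i == c) = false by case: (i == c); [left|right].
  transitivity (\sum_s be i s (al i s (bout (i == c) (X i) x))).
    by apply: eq_bigr => s _; rewrite {1}ic.
  by apply: albe; apply/eqP.
rewrite big1 => [|s _]; last by rewrite {1}ic.
by apply/esym/bout_out; rewrite ic.
Qed.

Theorem tubing_silted (A : falgType k) : isom_tubes ij A -> silted H A.
Proof.
move=> isoA; exists P; split=> //.
  by split; [exact: std_presilting|exact: std_generates].
by apply/(@isom_EndK_tubes _ _ _ inc P P2 K ij cM cN std_diagonal rng v vn blk).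
Qed.

End StdSilting.

(** * Path algebras of linear quivers *)

Section LinearPaths.
Variables (k : fieldType) (r : nat).
Local Notation Q := (linear_aquiver r).
Local Notation H := (typeA k r).
Local Notation path := (qpath Q).
Hypothesis r_gt0 : (0 < r)%N.

Definition psrc (p : path) : nat := nat_of_ord (path_source p : 'I_r.-1.+1).
Definition ptgt (p : path) : nat := nat_of_ord (path_target p : 'I_r.-1.+1).

(** A walk in the linear quiver is determined by its source and its length. *)
Lemma linear_walk (x : vertex Q) (s : seq (arrow Q)) : walk x s ->
  [seq nat_of_ord (a : 'I_r.-1) | a <- s] = iota (nat_of_ord (x : 'I_r.-1.+1))
    (size s) /\
  nat_of_ord (walk_end x s : 'I_r.-1.+1) = (nat_of_ord (x : 'I_r.-1.+1) + size s)%N.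
Proof.
elim: s x => [|a s IHs] x /=; first by rewrite addn0.
case/andP=> /eqP <- /IHs[-> E]; split=> //.
by rewrite -[walk_end _ _]/(walk_end (target a) s) E /= /bump leq0n add1n addSnnS.
Qed.

Lemma ptgtE p : ptgt p = (psrc p + size (path_arrows p))%N.
Proof. by have [_ E] := linear_walk (path_walk p); exact: E. Qed.

Lemma ptgt_lt p : (ptgt p < r)%N.
Proof. by apply: leq_trans (ltn_ord (path_target p : 'I_r.-1.+1)) _; rewrite prednK.
  Qed.

Lemma path_unique p q : psrc p = psrc q -> ptgt p = ptgt q -> p = q.
Proof.
move=> es et; have sz : size (path_arrows p) = size (path_arrows q).
  by move: et; rewrite !ptgtE es => /addnI.
apply: qpath_eq; first exact: val_inj.
apply: (inj_map (f := fun a : arrow Q => nat_of_ord (a : 'I_r.-1)));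
  first exact: val_inj.
have [-> _] := linear_walk (path_walk p); have [-> _] := linear_walk (path_walk q).
by rewrite sz -[nat_of_ord _]/(psrc p) es.
Qed.

Lemma path_between a b : (a <= b < r)%N -> exists p, psrc p = a /\ ptgt p = b.
Proof.
move=> ab; have ltP c : (c < r)%N -> (c < r.-1.+1)%N by lia.
suff [s [ws es]] : exists s, walk (Ordinal (ltP a ltac:(lia)) : vertex Q) s /\ size s
  = (b - a)%N.
  have [p [sp ap]] := qpath_exists ws; exists p; rewrite ptgtE /psrc sp ap es /=.
  by split=> //; lia.
have : (a + (b - a) < r)%N by lia.
elim: (b - a)%N => [|m IHm] am; first by exists [::].
have [|s [ws es]] := IHm; first by lia.
have lt : (a + m < r.-1)%N by lia.
exists (rcons s (Ordinal lt)); split; last by rewrite size_rcons es.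
rewrite -cats1 walk_cat ws /= andbT; apply/eqP/val_inj.
by have [_ /= ->] := linear_walk ws; rewrite es.
Qed.

Definition pst a b (p : path) := (psrc p == a) && (ptgt p == b).

(** A sum with at most one term, by [path_unique]. *)
Definition path_crd (f : H) (a b : nat) : k := \sum_(p | pst a b p) (f p : k).
Definition path_elt (F : nat -> nat -> k) : H := [ffun p => F (psrc p) (ptgt p) : k^o].

Lemma path_crdE f p : path_crd f (psrc p) (ptgt p) = f p.
Proof.
rewrite /path_crd (big_pred1 p) // => q; apply/andP/eqP => [[/eqP es /eqP et]|->//].
exact: path_unique.
Qed.

Lemma block_le_same n a b : block_le n n a b = (a <= b < n)%N.
Proof. by rewrite /block_le; lia. Qed.

Lemma path_crdM (f g : H) a b :
  path_crd (f * g) a b = \sum_(w < r.+1) path_crd f a w * path_crd g w b.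
Proof.
transitivity (\sum_p1 \sum_p2 \sum_(p | pst a b p && is_concat p1 p2 p)
  ((f p1 : k) * g p2)).
  rewrite /path_crd.
  under eq_bigr => p _ do rewrite ffunE.
  rewrite exchange_big; apply: eq_bigr => p1 _ /=.
  by rewrite (exchange_big_dep predT).
transitivity (\sum_p1 \sum_p2 \sum_(w < r.+1)
   if pst a w p1 && pst w b p2 then (f p1 : k) * g p2 else 0).
  apply: eq_bigr => p1 _; apply: eq_bigr => p2 _.
  rewrite (@sum_unique _ _ _ [&& psrc p1 == a, ptgt p1 == psrc p2 & ptgt p2 == b]).
  - case: ifP => [/and3P[/eqP s1 /eqP t1 /eqP t2]|ne].
      rewrite (@sum_point _ r (fun w => if pst a w p1 && pst w b p2 then (f p1 : k) *
        g p2 else 0) (ptgt p1)).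
      + by rewrite /pst s1 t2 t1 !eqxx.
      + by apply: ltnW; apply: ptgt_lt.
      + by move=> w ne; rewrite /pst [_ == w]eq_sym (negbTE ne) andbF.
    rewrite big1 // => w _; case: ifP => // /andP[/andP[s1 /eqP t1] /andP[s2 t2]].
    by move: ne; rewrite s1 t2 t1 eq_sym s2.
  - move=> p /andP[/andP[/eqP sp /eqP tp] /and3P[/eqP s1 /eqP t1 /eqP ap]].
    have es : psrc p = psrc p1 by rewrite /psrc s1.
    have e12 : ptgt p1 = psrc p2 by rewrite /ptgt t1.
    rewrite -es sp e12 !eqxx /= -tp !ptgtE ap size_cat es -e12 ptgtE; lia.
  - case/and3P=> [/eqP s1 /eqP t1 /eqP t2].
    have [p [sp tp]] : exists p, psrc p = a /\ ptgt p = b.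
      by apply: path_between; have := ptgt_lt p2; move: s1 t1 t2; rewrite !ptgtE; lia.
    have t1' : path_target p1 = path_source p2 by apply: val_inj.
    have := path_walk p1 => w1; have := path_walk p2; rewrite -t1' => w2.
    have [q [sq aq]] : exists q : path, path_source q = path_source p1 /\
        path_arrows q = path_arrows p1 ++ path_arrows p2.
      by apply: qpath_exists; rewrite walk_cat w1.
    exists q; rewrite /pst /is_concat sq aq t1' !eqxx !andbT /=.
    rewrite /psrc sq -/(psrc p1) s1 eqxx /=.
    rewrite ptgtE /psrc sq aq size_cat -/(psrc p1) addnA -ptgtE t1 -ptgtE t2 //.
  - move=> p q /andP[_ /and3P[/eqP s1 _ /eqP a1]] /andP[_ /and3P[/eqP s2 _ /eqP a2]].
    by apply: qpath_eq; rewrite ?s1 ?s2 ?a1 ?a2.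
rewrite [RHS](eq_bigr (fun w : 'I_r.+1 => \sum_p1 \sum_p2
   if pst a w p1 && pst w b p2 then (f p1 : k) * g p2 else 0)).
  rewrite [RHS]exchange_big; apply: eq_bigr => p1 _ /=.
  by rewrite [RHS]exchange_big.
move=> w _; rewrite /path_crd mulr_suml [LHS]big_mkcond; apply: eq_bigr => p1 _.
case: (pst a w p1); last by rewrite big1.
by rewrite mulr_sumr [LHS]big_mkcond.
Qed.

(** The vertices of the linear quiver are the points below v = r. *)
Lemma typeA_incidence : incidence H r r.
Proof.
exists path_crd path_elt.
- by move=> f g a b; rewrite /path_crd -big_split; apply: eq_bigr => p _; rewrite ffunE.
- by move=> c f a b; rewrite /path_crd mulr_sumr; apply: eq_bigr => p _; rewrite ffunE.
- exact: path_crdM.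
- move=> a b; rewrite block_le_same.
  case: (boolP (a <= b < r)%N) => ab.
    have [p [<- <-]] := path_between ab.
    rewrite path_crdE ffunE ptgtE.
    have := ptgt_lt p; rewrite ptgtE leqnn => lt.
    rewrite (_ : (psrc p < r)%N) /=; last by lia.
    by rewrite -[X in X == _]addn0 eqn_add2l eq_sym.
  rewrite /path_crd big_pred0 => [|p]; last first.
    apply/negP => /andP[/eqP es /eqP et]; case/negP: ab.
    by rewrite -et -es ptgt_lt ptgtE leq_addr.
  case: eqP => [e|_]; last by rewrite andbF.
  by move: ab; rewrite e !leqnn /= => /negbTE ->.
- move=> f a b; rewrite block_le_same => ab; rewrite /path_crd big_pred0 // => p.
  apply/negP => /andP[/eqP es /eqP et]; case/negP: ab.
  by rewrite -et -es ptgt_lt ptgtE leq_addr.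
- move=> F a b; rewrite block_le_same; case: ifP => ab.
    have [p [<- <-]] := path_between ab.
    by rewrite path_crdE ffunE.
  rewrite /path_crd big_pred0 // => p.
  apply/negP => /andP[/eqP es /eqP et]; case/negP: ab.
  by rewrite -et -es ptgt_lt ptgtE leq_addr.
- by move=> f g fg; apply/ffunP => p; rewrite -!path_crdE.
Qed.

End LinearPaths.

(** The points may be renumbered so that the omitted one comes first. *)
Lemma incidence_shift (k : fieldType) (H : falgType k) (n : nat) :
  incidence H n n -> incidence H n 0.
Proof.
move=> inc.
have rE p q : block_le n 0 p q = [&& 0 < p, 0 < q & block_le n n p.-1 q.-1]%N.
  by rewrite /block_le; lia.
exists (fun a p q => if (0 < p)%N && (0 < q)%N then crd inc a p.-1 q.-1 else 0)
  (fun F => elt inc (fun p q => F p.+1 q.+1)).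
- by move=> a b p q; case: ifP => _; rewrite ?crdD ?addr0.
- by move=> c a p q; case: ifP => _; rewrite ?crdZ ?mulr0.
- move=> a b p q; rewrite big_ord_recl /= andbF mul0r add0r.
  case: ifP => [/andP[p0 q0]|npq].
    rewrite crdM big_ord_recr /= [crd inc a _ n]crd_out; last first.
      by rewrite /block_le; lia.
    by rewrite mul0r addr0; apply: eq_bigr => w _; rewrite p0 q0.
  rewrite big1 // => w _; rewrite andbT.
  by case: (0 < p)%N npq => /= [->|_]; rewrite ?mulr0 ?mul0r.
- move=> p q; rewrite rE; case: p q => [|p] [|q] //=; first by rewrite andbF.
  rewrite crd1 eqSS; case: (p =P q) => [->|_]; by rewrite ?andbF.
- move=> a p q; rewrite rE; case: ifP => // /andP[p0 q0]; rewrite p0 q0 /=.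
  exact: crd_out.
- by move=> F p q; rewrite crd_elt rE; case: p q => [|p] [|q].
- move=> a b ab; apply: (crd_inj (i := inc)) => p q; exact: (ab p.+1 q.+1).
Qed.

(** The first factor occupies the points below m and the second those above
    m. *)
Lemma incidence_prod (k : fieldType) (H1 H2 : falgType k) (m l : nat) :
  incidence H1 m m -> incidence H2 l 0 -> incidence (H1 * H2)%type (m + l) m.
Proof.
move=> i1 i2.
have rE p q : block_le (m + l) m p q =
  if (q < m)%N then block_le m m p q else (m <= p)%N && block_le l 0 (p - m) (q - m).
  by case: ifP; rewrite /block_le; lia.
exists (fun x p q => if (q < m)%N then crd i1 x.1 p q
                     else if (m <= p)%N then crd i2 x.2 (p - m) (q - m) else 0)
  (fun F => (elt i1 F, elt i2 (fun p q => F (p + m)%N (q + m)%N))).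
- by move=> a b p q; do 2?[case: ifP => _]; rewrite ?crdD ?addr0.
- by move=> c a p q; do 2?[case: ifP => _]; rewrite ?crdZ ?mulr0.
- move=> a b p q; rewrite -addnS big_split_ord /=.
  case: ifP => qm; last case: ifP => pm.
  + rewrite [X in _ = _ + X]big1 ?addr0 => [|w _]; last first.
      by rewrite [crd i1 b.1 _ _]crd_out ?mulr0 // /block_le; lia.
    rewrite crdM big_ord_recr /= [crd i1 a.1 p m]crd_out; last first.
      by rewrite /block_le; lia.
    by rewrite mul0r addr0; apply: eq_bigr => w _; rewrite ltn_ord.
  + rewrite [X in _ = X + _]big1 ?add0r => [|w _]; last first.
      by rewrite [(m <= w)%N]leqNgt ltn_ord mulr0.
    rewrite crdM; apply: eq_bigr => w _.
    by rewrite ltnNge leq_addr /= addKn.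
  rewrite [X in _ = X + _]big1 ?add0r => [|w _]; last first.
    by rewrite [(m <= w)%N]leqNgt ltn_ord mulr0.
  by rewrite big1 // => w _; rewrite ltnNge leq_addr /= mul0r.
- move=> p q; rewrite rE; case: ifP => qm.
    by rewrite crd1; case: (p =P q) => [->|_]; rewrite ?andbF // qm.
  case: ifP => pm.
    rewrite crd1 ltnNge pm /= (_ : (p - m == q - m)%N = (p == q)) //; lia.
  by case: (p =P q) => [e|_]; rewrite ?andbF //; lia.
- move=> a p q; rewrite rE; case: ifP => _; first exact: crd_out.
  by case: ifP => //= _; apply: crd_out.
- move=> F p q; rewrite rE; case: ifP => qm; first by rewrite crd_elt.
  case: ifP => //= pm; rewrite crd_elt !subnK //; lia.
- move=> [a1 a2] [b1 b2] ab; congr pair.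
    apply: (crd_inj (i := i1)) => p q; have := ab p q; case: ifP => //= qm _.
    by rewrite !crd_out // /block_le; lia.
  apply: (crd_inj (i := i2)) => p q; have := ab (p + m)%N (q + m)%N => /=.
  by rewrite !addnK leq_addl ltnNge leq_addl.
Qed.

Theorem theorem1p1 (k : closedFieldType) (n : nat) (A : falgType k) :
  (1 <= n)%N ->
  (silted (typeA k n) A <->
   tilted (typeA k n) A \/
   exists m : nat, (1 <= m <= n - 1)%N /\
     tilted (typeA k m * typeA k (n - m)%N)%type A).
Proof.
move=> n_gt0.
have inc_n : incidence (typeA k n) n n := typeA_incidence k n_gt0.
have inc_0 := incidence_shift inc_n.
have inc_m m : (1 <= m <= n - 1)%N ->
    incidence (typeA k m * typeA k (n - m)%N)%type n m.
  move=> mn; have -> : n = (m + (n - m))%N by lia.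
  rewrite [(m + (n - m) - m)%N]addKn.
  apply: incidence_prod; first by apply: typeA_incidence; lia.
  by apply/incidence_shift/typeA_incidence; lia.
split=> [/(silted_tubing inc_0)[v [K [ij [vn tb isoA]]]]|].
  case: (posnP v) => [v0|v_gt0].
    by left; rewrite v0 in tb; apply: (tubing_tilted inc_0 _ tb).
  case: (ltngtP v n) => [vn'|nv|v_n]; last by left; rewrite v_n in tb;
    apply: (tubing_tilted inc_n _ tb).
    right; exists v; have vr : (1 <= v <= n - 1)%N by lia.
    by split=> //; apply: (tubing_tilted (inc_m v vr) _ tb).
  by rewrite leqNgt nv in vn.
case=> [/(tilted_tubing inc_0 (leq0n n))[K [ij [tb isoA]]]|[m [mn]]].
  exact: (tubing_silted inc_0 _ tb).
have mn' : (m <= n)%N by lia.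
move=> /(tilted_tubing (inc_m m mn) mn')[K [ij [tb isoA]]].
exact: (tubing_silted inc_0 mn' tb).
Qed.
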